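(* Let $C,C_1,C_0$ be the curves associated with the non-singular complete intersections $\mathcal X=G\cap Q$, $\mathcal X_1=G\cap Q_1$, $\mathcal X_0=G\cap Q_0$ respectively (all defined in the context). Then $C,C_1,C_0$ are non-singular and of genus $2$. Moreover, with $t$ the affine coordinate on the pencil: (a) $C$ is given by $$z^2+(t+a_1)(t+a_2)(t+a_3)z=c_1d_1(t+a_2)^2(t+a_3)^2+c_2d_2(t+a_1)^2(t+a_3)^2+c_3d_3(t+a_1)^2(t+a_2)^2.$$ (b) $C_1$ is given by $$z^2+(t+a_1)(t+a_2)^2z=(t+a_2)^4c_1d_1$$ $$+(t+a_1)^2(t+a_2)^2\left(b_1b_2+c_2d_2+c_3d_3+b_1\sqrt{c_3d_2}+b_2\sqrt{c_2d_3}+b_3\sqrt{d_2d_3}+b_4\sqrt{c_2c_3}\right)$$ $$+(t+a_1)^2(t+a_2)\{b_3(b_1d_2+b_2d_3)+b_4(b_2c_2+b_1c_3)\}.$$ (c) $C_0$ is given by $$z^2+(t+a)^3z=(t+a)^4(c_1d_1+c_2d_2+c_3d_3+b_1b_2+b_5b_6)$$ $$+(t+a)^3\{b_6b_8c_1+(b_2b_4+b_5b_8)c_2+b_1b_4c_3+b_5b_7d_1+(b_1b_3+b_6b_7)d_2+b_2b_3d_3\}$$ $$+(t+a)^2\{b_8^2c_1c_2+b_6^2c_1d_2+b_5^2c_2d_1+b_7^2d_1d_2+b_4^2c_2c_3+b_2^2c_2d_3+b_1^2c_3d_2+b_3^2d_2d_3+b_1b_3b_5b_8+b_2b_4b_6b_7\}$$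 $$+(t+a)\{(b_1b_3b_8^2+b_2b_4b_6^2)c_1+(b_1b_3b_5^2+b_2b_4b_7^2)d_1+(b_1^2b_5b_8+b_4^2b_6b_7)c_3+(b_3^2b_5b_8+b_2^2b_6b_7)d_3\}$$ $$+(b_1b_8+b_4b_6)^2c_1c_3+(b_2b_6+b_3b_8)^2c_1d_3+(b_1b_5+b_4b_7)^2c_3d_1+(b_2b_7+b_3b_5)^2d_1d_3.$$
   Context: $k$ is an algebraically closed field of characteristic $2$ (square roots in $k$ are unique). $\mathbf P^5$ has homogeneous coordinates $(X_1,X_2,X_3,Y_1,Y_2,Y_3)$. Let $G=\{\sum_{i=1}^3X_iY_i=0\}$. Three kinds of second quadrics are considered, with all constants in $k$: (a) $Q:\ \sum_{i=1}^3(a_iX_iY_i+c_iX_i^2+d_iY_i^2)=0$ with $a_1,a_2,a_3$ pairwise distinct; (b) $Q_1:\ \sum_{i=1}^3(a_iX_iY_i+c_iX_i^2+d_iY_i^2)+b_1X_2Y_3+b_2X_3Y_2+b_3X_2X_3+b_4Y_2Y_3=0$ with $a_1\neq a_2=a_3$; (c) $Q_0:\ \sum_{i=1}^3(aX_iY_i+c_iX_i^2+d_iY_i^2)+b_1X_2Y_3+b_2X_3Y_2+b_3X_2X_3+b_4Y_2Y_3+b_5X_1Y_2+b_6X_2Y_1+b_7X_1X_2+b_8Y_1Y_2=0$. In (b) and (c) there are $\alpha_i,\beta_i,\gamma_i,\delta_i\in k$ $(i=1,2,3)$ with $\alpha_i\delta_i+\beta_i\gamma_i=1$ such that $b_1=\beta_3\gamma_2$,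 $b_2=\alpha_2\delta_3$, $b_3=\gamma_2\delta_3$, $b_4=\alpha_2\beta_3$ and (in case (c)) $b_5=\beta_2\gamma_1$, $b_6=\alpha_1\delta_2$, $b_7=\gamma_1\delta_2$, $b_8=\alpha_1\beta_2$. In particular $b_1b_2=b_3b_4$ and $b_5b_6=b_7b_8$. $\mathcal X=G\cap Q$, $\mathcal X_1=G\cap Q_1$, $\mathcal X_0=G\cap Q_0$ are assumed non-singular. Associated curve: let $G(3,6)$ be the Grassmannian of planes in $\mathbf P^5$, write $t_0G+t_1Q$ for the quadric defined by $t_0q_G+t_1q_Q$ (where $q_G,q_Q$ are the displayed quadratic forms), let $$Z=\{((t_0:t_1),P)\in\mathbf P^1\times G(3,6):\ P\subset t_0G+t_1Q\}$$ with first projection $pr:Z\to\mathbf P^1$ (whose general fibre has two connected components), and set $C=\mathrm{Spec}(pr_*\mathcal O_Z)$, a double covering of $\mathbf P^1$. The curves $C_1$, $C_0$ are defined in the same way using $Q_1$, $Q_0$. The affine coordinate on $\mathbf P^1$ is $t=t_0/t_1$, so that $t$ corresponds to the quadric $tG+Q$. ''The curve is given by'' an equation in $(t,z)$ means that the part of the curve over the affine line with coordinate $t$ is the affine plane curve with that equation, the double covering being $(t,z)\mapsto t$. *)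

(* Defs.v *)
From HB Require Import structures.
From mathcomp Require Import all_boot all_algebra.
From mathcomp Require Import mpoly.
From mathcomp Require Import boolp classical_sets functions.

Set Implicit Arguments.
Unset Strict Implicit.
Unset Printing Implicit Defensive.

Import GRing.Theory.

Local Open Scope classical_set_scope.
Local Open Scope ring_scope.

Section CommutativeAlgebra.
Variable A : comPzRingType.
Implicit Types m I J : set A.

Definition is_ideal I :=
  [/\ I 0, forall x y, I x -> I y -> I (x + y) & forall a x, I x -> I (a * x)].

Definition maximal_ideal m :=
  [/\ is_ideal m, ~ m 1 &
      forall I, is_ideal I -> m `<=` I -> I = m \/ I = setT].

Definition ideal_mul I J : set A := [set x | exists s : seq (A * A),
  (forall p, p \in s -> I p.1 /\ J p.2) /\ x = \sum_(p <- s) p.1 * p.2].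

(* For m maximal: the vector space m / m^2 over the field A / m has dimension *)
(* n, with basis the classes of the x i. It is the Zariski cotangent space of *)
(* Spec A at m.                                                               *)
Definition cotangent_dim m (n : nat) := exists x : 'I_n -> A,
  [/\ forall i, m (x i),
      forall y, m y ->
        exists a : 'I_n -> A, ideal_mul m m (y - \sum_i a i * x i) &
      forall a : 'I_n -> A,
        ideal_mul m m (\sum_i a i * x i) -> forall i, m (a i)].

Definition integral_ring :=
  (1 : A) <> 0 /\ forall x y : A, x * y = 0 -> x = 0 \/ y = 0.

End CommutativeAlgebra.

Definition quotient_dim (k : fieldType) (V : lmodType k) (W : set V) (n : nat) :=
  exists e : 'I_n -> V,
    (forall v, exists a : 'I_n -> k, W (v - \sum_i a i *: e i)) /\
    (forall a : 'I_n -> k, W (\sum_i a i *: e i) -> forall i, a i = 0).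

Section Incidence.
Variable k : closedFieldType.

Definition Grass (d n : nat) := {P : {vspace 'rV[k]_n} | \dim P == d}.

Definition P1 := Grass 1 2.
Definition G36 := Grass 3 6.

Definition hcoord (L : P1) (i : 'I_2) : k := (vbasis (val L))`_0 0 i.

(* The Pluecker coordinates are indexed by all maps s : 'I_3 -> 'I_6, not     *)
(* just by the 20 increasing ones: the other ones are 0 or, up to sign, a     *)
(* repetition, so the embedding is the usual one followed by a linear         *)
(* embedding of projective spaces.                                            *)
Definition plucker (P : G36) (s : {ffun 'I_3 -> 'I_6}) : k :=
  \det (\matrix_(i < 3, j < 3) (vbasis (val P))`_i 0 (s j)).

Definition nplucker := #|{ffun 'I_3 -> 'I_6}|.

(* k[t_0, t_1][(p_s)_s]                                                       *)
Definition bipoly := {mpoly {mpoly k[nplucker]}[2]}.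

Definition bihomog (d e : nat) (g : bipoly) :=
  g \is d.-homog /\ forall m : 'X_{1..2}, g@_m \is e.-homog.

Definition bieval (g : bipoly) (z : P1 * G36) : k :=
  (g.@[fun i => (hcoord z.1 i)%:MP]).@[fun s => plucker z.2 (enum_val s)].

Variables q1 q2 : {mpoly k[6]}.

(* The complete intersection q1 = q2 = 0 in P^5 is non-singular of            *)
(* codimension 2.                                                             *)
Definition nonsingular_ci :=
  forall v : 'rV[k]_6, v != 0 -> q1.@[v 0] = 0 -> q2.@[v 0] = 0 ->
  \rank (\matrix_(i < 2, j < 6)
           ((if i == 0 then q1 else q2)^`M(j)).@[v 0]) = 2.

Definition pencil (L : P1) : {mpoly k[6]} :=
  hcoord L 0 *: q1 + hcoord L 1 *: q2.

Definition Z : set (P1 * G36) :=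
  [set z : P1 * G36 | forall v : 'rV[k]_6, v \in val z.2 -> (pencil z.1).@[v 0] = 0].

(* pr^-1(U), where pr is the first projection of Z                            *)
Definition Zover (U : set P1) : set (P1 * G36) := Z `&` fst @^-1` U.

(* Regular functions on pr^-1(U): locally quotients of bihomogeneous          *)
(* polynomials of the same bidegree. Such a quotient does not depend on the   *)
(* bases chosen to define hcoord and plucker. Z is taken as a variety, that   *)
(* is, with its reduced structure, so that a regular function is determined   *)
(* by its values.                                                             *)
Definition regular (U : set P1) (f : Zover U -> k^o) :=
  forall z : Zover U, exists (d e : nat) (g h : bipoly),
    [/\ bihomog d e g, bihomog d e h, bieval h (val z) != 0 &
        forall w : Zover U, bieval h (val w) != 0 ->
          f w = bieval g (val w) / bieval h (val w)].

Definition regularb (U : set P1) : {pred Zover U -> k^o} :=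
  fun f => `[< regular f >].
Arguments regularb : clear implicits.

Lemma bihomogM d e d' e' g h :
  bihomog d e g -> bihomog d' e' h -> bihomog (d + d') (e + e') (g * h).
Proof.
move=> [g1 g2] [h1 h2]; split; first exact: dhomogM.
by move=> m; rewrite mcoeffM rpred_sum // => i _; apply: dhomogM.
Qed.

Lemma bihomogB d e g h : bihomog d e g -> bihomog d e h -> bihomog d e (g - h).
Proof.
by move=> [g1 g2] [h1 h2]; split=> [|m]; rewrite ?mcoeffB rpredB.
Qed.

Lemma dhomogC n (R : nzRingType) (c : R) : c%:MP_[n] \is 0.-homog.
Proof. by rewrite -[c%:MP]mulr1 mul_mpolyC rpredZ // dhomog1. Qed.

Lemma bihomogC (a : k) : bihomog 0 0 a%:MP%:MP.
Proof.
split=> [|m]; first by rewrite dhomogC.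
by rewrite mcoeffC; case: eqP => _; rewrite ?mulr1 ?mulr0 ?rpred0 ?dhomogC.
Qed.

Lemma bievalM g h z : bieval (g * h) z = bieval g z * bieval h z.
Proof. by rewrite /bieval !mevalM. Qed.

Lemma bievalB g h z : bieval (g - h) z = bieval g z - bieval h z.
Proof. by rewrite /bieval !mevalB. Qed.

Lemma bievalC a z : bieval a%:MP%:MP z = a.
Proof. by rewrite /bieval !mevalC. Qed.

Lemma regular_cst U (a : k) : regular (fun _ : Zover U => a : k^o).
Proof.
move=> z; exists 0%N, 0%N, a%:MP%:MP, 1%:MP%:MP.
split; [exact: bihomogC|exact: bihomogC|by rewrite bievalC oner_neq0|].
by move=> w _; rewrite !bievalC divr1.
Qed.

Lemma regular_sub U (f f' : Zover U -> k^o) :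
  regular f -> regular f' -> regular (f - f').
Proof.
move=> rf rf' z; have [d [e [g [h [Hg Hh hz E]]]]] := rf z.
have [d' [e' [g' [h' [Hg' Hh' hz' E']]]]] := rf' z.
exists (d + d')%N, (e + e')%N, (g * h' - g' * h), (h * h'); split.
- apply: bihomogB; first exact: bihomogM.
  by rewrite mulrC; exact: bihomogM.
- exact: bihomogM.
- by rewrite bievalM mulf_neq0.
- move=> w; rewrite bievalM mulf_eq0 negb_or => /andP[hw hw'].
  have -> : (f - f') w = f w - f' w by [].
  by rewrite E // E' // bievalB !bievalM -mulNr addf_div // mulNr.
Qed.

Lemma regular_mul U (f f' : Zover U -> k^o) :
  regular f -> regular f' -> regular (f * f').
Proof.
move=> rf rf' z; have [d [e [g [h [Hg Hh hz E]]]]] := rf z.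
have [d' [e' [g' [h' [Hg' Hh' hz' E']]]]] := rf' z.
exists (d + d')%N, (e + e')%N, (g * g'), (h * h'); split.
- exact: bihomogM.
- exact: bihomogM.
- by rewrite bievalM mulf_neq0.
- move=> w; rewrite bievalM mulf_eq0 negb_or => /andP[hw hw'].
  have -> : (f * f') w = f w * f' w by [].
  by rewrite E // E' // !bievalM mulf_div.
Qed.

Lemma regularb_subring U : subring_closed (regularb U).
Proof.
split=> [|f f' /asboolP rf /asboolP rf'|f f' /asboolP rf /asboolP rf'];
  apply/asboolP.
- exact: regular_cst.
- exact: regular_sub.
- exact: regular_mul.
Qed.

Lemma regularb_scaler U : GRing.scaler_closed (regularb U).
Proof.
move=> a f /asboolP rf; apply/asboolP.
exact: regular_mul (regular_cst a) rf.
Qed.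

HB.instance Definition _ U := GRing.isSubringClosed.Build
  (Zover U -> k^o) (regularb U) (regularb_subring U).
HB.instance Definition _ U := GRing.isScaleClosed.Build
  k (Zover U -> k^o) (regularb U) (@regularb_scaler U).

(* Gamma(U, pr_* O_Z)                                                         *)
Record pushO (U : set P1) :=
  PushO { pushO_fun :> Zover U -> k^o; _ : pushO_fun \in regularb U }.

HB.instance Definition _ U := [isSub for @pushO_fun U].
HB.instance Definition _ U := [Choice of pushO U by <:].
HB.instance Definition _ U := 
  GRing.SubChoice_isSubComPzRing.Build (Zover U -> k^o) (regularb U) (pushO U)
    (subringClosedP _).
HB.instance Definition _ U := [SubZmodule_isSubLmodule of pushO U by <:].

Lemma Zover_sub U V : V `<=` U -> forall w : Zover V, val w \in Zover U.
Proof. by move=> sVU [w /= /set_mem [wZ wV]]; apply/mem_set; split=> //; apply: sVU. Qed.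

Definition Zover_incl U V (sVU : V `<=` U) (w : Zover V) : Zover U :=
  exist _ (val w) (Zover_sub sVU w).

Lemma regular_res U V (sVU : V `<=` U) (f : pushO U) :
  (f \o Zover_incl sVU : Zover V -> k^o) \in regularb V.
Proof.
apply/asboolP => z; have /asboolP rf := valP f.
have [d [e [g [h [Hg Hh hz E]]]]] := rf (Zover_incl sVU z).
by exists d, e, g, h; split=> // w hw; apply: E.
Qed.

Definition res U V (sVU : V `<=` U) (f : pushO U) : pushO V :=
  PushO (regular_res sVU f).

(* The curve C = Spec (pr_* O_Z) is glued from the spectra of the rings       *)
(* pushO U for U one of the two standard affine opens of P^1; it is finite    *)
(* over P^1, hence of dimension 1.                                            *)

Definition U_t0 : set P1 := [set L | hcoord L 0 != 0].
Definition U_t1 : set P1 := [set L | hcoord L 1 != 0].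

Definition tcoord (L : P1) : k := hcoord L 0 / hcoord L 1.

Definition curve_integral :=
  [/\ integral_ring (pushO U_t0), integral_ring (pushO U_t1) &
      integral_ring (pushO (U_t0 `&` U_t1))].

Definition curve_nonsingular :=
  [/\ curve_integral,
      forall m : set (pushO U_t0), maximal_ideal m -> cotangent_dim m 1 &
      forall m : set (pushO U_t1), maximal_ideal m -> cotangent_dim m 1].

(* dim H^1(C, O_C) = g, the cohomology being that of the Cech complex         *)
(* O(U_t0) x O(U_t1) -> O(U_t0 `&` U_t1) of an affine cover of C.             *)
Definition curve_genus (g : nat) :=
  quotient_dim [set f : pushO (U_t0 `&` U_t1) |
    exists (f0 : pushO U_t0) (f1 : pushO U_t1),
      f = res (@subIsetl _ U_t0 U_t1) f0 - res (@subIsetr _ U_t0 U_t1) f1] g.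

(* The part of C over t_1 != 0 is the affine plane curve F(t, z) = 0, as a    *)
(* scheme over the t-line: phi induces an isomorphism of k[t]-algebras        *)
(* k[t][z]/(F) ~ pushO U_t1. In {poly {poly k}}, 'X is z and 'X%:P is t.      *)
Definition curve_given_by (F : {poly {poly k}}) :=
  exists phi : {rmorphism {poly {poly k}} -> pushO U_t1},
    [/\ forall (p : {poly k}) (w : Zover U_t1),
          phi p%:P w = p.[tcoord (val w).1],
        forall f, exists p, phi p = f &
        forall p, phi p = 0 <-> exists r, p = r * F].

End Incidence.

Arguments nonsingular_ci {k} q1 q2.
Arguments curve_nonsingular {k} q1 q2.
Arguments curve_genus {k} q1 q2 g.
Arguments curve_given_by {k} q1 q2 F.

(* The equation z^2 + B(t) z = A(t), with 'X for z                            *)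
Definition quadratic_eq (k : closedFieldType) (B A : {poly k}) :
    {poly {poly k}} :=
  'X^2 + B%:P * 'X - A%:P.

Definition i1 : 'I_3 := @Ordinal 3 0 isT.
Definition i2 : 'I_3 := @Ordinal 3 1 isT.
Definition i3 : 'I_3 := @Ordinal 3 2 isT.

Section Quadrics.
Variable k : closedFieldType.

Definition X_ (i : 'I_3) : {mpoly k[6]} := 'X_(@lshift 3 3 i).
Definition Y_ (i : 'I_3) : {mpoly k[6]} := 'X_(@rshift 3 3 i).

Definition qG : {mpoly k[6]} := \sum_(i < 3) X_ i * Y_ i.

Variables a c d : 'I_3 -> k.

Definition qQ : {mpoly k[6]} :=
  \sum_(i < 3) (a i *: (X_ i * Y_ i) + c i *: X_ i ^+ 2 + d i *: Y_ i ^+ 2).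

Variables b1 b2 b3 b4 : k.

Definition qQ1 : {mpoly k[6]} :=
  qQ + b1 *: (X_ i2 * Y_ i3) + b2 *: (X_ i3 * Y_ i2)
     + b3 *: (X_ i2 * X_ i3) + b4 *: (Y_ i2 * Y_ i3).

Variables b5 b6 b7 b8 : k.

Definition qQ0 : {mpoly k[6]} :=
  qQ1 + b5 *: (X_ i1 * Y_ i2) + b6 *: (X_ i2 * Y_ i1)
      + b7 *: (X_ i1 * X_ i2) + b8 *: (Y_ i1 * Y_ i2).

End Quadrics.

Arguments qG {k}.

Lemma sqrt_exists (k : closedFieldType) (x : k) : exists y, y ^+ 2 == x.
Proof.
have [y Hy] := @solve_monicpoly k 2 (fun i => if i == 0%N then x else 0) isT.
by exists y; rewrite Hy !big_ord_recl big_ord0 /= mul0r !addr0 expr0 mulr1.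
Qed.

Definition sqrt (k : closedFieldType) (x : k) : k := xchoose (sqrt_exists x).

Lemma sqr_sqrt (k : closedFieldType) (x : k) : sqrt x ^+ 2 = x.
Proof. exact/eqP/(xchooseP (sqrt_exists x)). Qed.

Lemma sqrt_unique (k : closedFieldType) (x y : k) :
  2%N \in [pchar k] -> y ^+ 2 = x -> y = sqrt x.
Proof.
move=> char2 <-; apply/(fmorph_inj (pFrobenius_aut char2)).
by rewrite /= !pFrobenius_autE sqr_sqrt.
Qed.

(* Main.v *)
Require Import Defs.
From HB Require Import structures.
From mathcomp Require Import all_boot perm all_algebra ring.
From mathcomp Require Import mpoly.
From mathcomp Require Import boolp classical_sets functions.

Set Implicit Arguments.
Unset Strict Implicit.
Unset Printing Implicit Defensive.

Import GRing.Theory.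

Local Open Scope classical_set_scope.
Local Open Scope ring_scope.

(* Over each of the two affine charts of P^1, with coordinate T, a linear     *)
(* change of coordinates over k[T] brings the pencil to the diagonal form     *)
(* sum_i n_i xi_i eta_i + u_i xi_i^2 + v_i eta_i^2, where at most one n_i     *)
(* vanishes at any point. On the isotropic planes of such a form there is a   *)
(* function lam (an Arf invariant) which takes one value on each of the two   *)
(* families of planes and satisfies lam^2 + B lam = A, with B = prod_i n_i    *)
(* and A = sum_i u_i v_i prod_(j != i) n_j^2; replacing lam by lam + kap, for *)
(* a suitable polynomial kap, gives the equations of the theorem. A regular   *)
(* function f on pr^-1(U) is constant on each family of planes, because two   *)
(* isotropic planes meeting in a point lie on a line of the orthogonal        *)
(* Grassmannian. Hence f is determined by its values on the planes that have  *)
(* a line in each (xi_i, eta_i)-plane; these lines are given by roots z_i of  *)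
(* z^2 + n_i z = u_i v_i, and since f is invariant under conjugating two of   *)
(* the z_i at a time it is of the form p + q lam, with p and q in k[T]. So    *)
(* the curve is z^2 + B z = A over the chart. At a singular point of this     *)
(* plane curve some n_l vanishes, and the point with coordinates              *)
(* (sqrt v_l, sqrt u_l) of the (xi_l, eta_l)-plane is then a singular point   *)
(* of the complete intersection. Finally B and A are the dehomogenizations of *)
(* forms of degree 3 and 6, so that the functions lam of the two charts are   *)
(* related by lam_0 = t^-3 lam_1 + h(1/t), and H^1 has the basis lam_1 / t,   *)
(* lam_1 / t^2.                                                               *)

(** * Rational functions of one variable *)

(** In characteristic 2 a quadratic form in six variables has as half-discriminant the Pfaffian B of
    its polar form, and where B is nonzero its two families of isotropic planes correspond to the
    two roots of an Arf equation z^2 + B z = A. For the generic member of the pencil this describes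
    the double covering birationally. The work is to make it integral over k[t]: the functions on Z
    over a chart must be exactly k[t] + k[t] lam, the plane curve must be smooth, and the two charts
    must glue with z of weight 3.

    The root is explicit. In suitably sheared coordinates an isotropic plane is a graph, and a
    combination of the relations expressing isotropy is the Arf equation ([lamc_quadratic]).
    [good_shear] provides the coordinates and [lam_indep] shows that the root does not depend on
    them.

    That there are no other functions rests on [rational_const]: a regular function agrees on
    isotropic planes meeting in exactly a point. By [meets_Dz] every plane can be replaced by one
    given by three quadratic irrationalities. Taking norms removes these from the denominators
    ([ms_global]), invariance under even numbers of conjugations leaves only the combination that
    occurs in lam ([ms_f_linear]), and [regular_generation] collects the local statements.
    Independence of 1 and lam is [lamZ_free].

    Non-singularity of the complete intersection enters through [pencil_transversal], which yields
    both the mildness of the diagonal forms ([nonsingular_mild]) and the Jacobian criterion for the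
    plane curve ([nonsingular_smooth]). The latter gives integrality ([norm_eq0]) and
    one-dimensional cotangent spaces ([cotangent_quadratic]). As B has degree 3, [comparison] and
    [glued_genus] give genus 3 - 1 = 2.

    The three cases differ in the elementary divisors of the bilinear part of the pencil: the n_i
    are t + a_i in case (a); t + a_1, 1, (t + a_2)^2 in case (b); and 1, 1, (t + a)^3 in case (c).
    See [diagonalized_a], [diagonalized_b], [diagonalized_c]; they are fed into
    [diagonalized_curve]. *)

Section InfiniteField.
Variable k : closedFieldType.
Implicit Types (p q d : {poly k}).

(** The nonconstant polynomial [p * 'X + 1] has a root, and [p] cannot vanish there. *)
Lemma poly_nonroot p : p != 0 -> exists x, p.[x] != 0.
Proof.
move=> p0; have X1 : (1 < size (p * 'X + 1%:P)%R)%N.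
  by rewrite size_MXaddC (negPf p0) /= ltnS lt0n size_poly_eq0.
have /closed_rootP [x] : size (p * 'X + 1%:P) != 1%N by rewrite neq_ltn X1 orbT.
rewrite /root !hornerE => /eqP E; exists x; apply/eqP => px.
by move: E; rewrite px mul0r add0r => /eqP; rewrite oner_eq0.
Qed.

Lemma poly_eq_except d p q :
  d != 0 -> (forall x, d.[x] != 0 -> p.[x] = q.[x]) -> p = q.
Proof.
move=> d0 E; apply/eqP; rewrite -subr_eq0; apply/negPn/negP => pq.
have /poly_nonroot [x] : d * (p - q) != 0 by rewrite mulf_neq0.
rewrite !hornerE mulf_eq0 negb_or => /andP[/E ->].
by rewrite subrr eqxx.
Qed.

Lemma poly_ext p q : (forall x, p.[x] = q.[x]) -> p = q.
Proof. by move=> E; apply: (@poly_eq_except 1) => [|x _]; rewrite ?oner_eq0. Qed.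

(* The generator of I has no zero where d is nonzero, hence divides a power   *)
(* of d.                                                                      *)
Lemma ideal_locally_unit (I : {poly k} -> Prop) d : d != 0 ->
  (forall p q, I p -> I q -> I (p - q)) -> (forall p q, I p -> I (q * p)) ->
  (forall x, d.[x] != 0 -> exists2 p, I p & p.[x] != 0) ->
  exists n, I (d ^+ n).
Proof.
move=> d0 IB IM loc.
have [x0 dx0] := poly_nonroot d0; have [p0 Ip0 px0] := loc _ dx0.
have exI : exists n, `[< exists2 p, I p & p != 0 /\ size p = n >].
  exists (size p0); apply/asboolP; exists p0 => //; split=> //.
  by apply/eqP => E; rewrite E horner0 eqxx in px0.
have [n0 /asboolP [h Ih [h0 sh]] hmin] := ex_minnP exI.
have hdvd p : I p -> h %| p.
  move=> Ip; rewrite /dvdp; apply/negPn/negP => r0.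
  have /hmin : `[< exists2 q, I q & q != 0 /\ size q = size (p %% h) >].
    apply/asboolP; exists (p %% h) => //.
    have -> : p %% h = p - p %/ h * h by rewrite {2}(divp_eq p h) addrAC subrr add0r.
    by apply: IB => //; apply: IM.
  by rewrite -sh leqNgt ltn_modp h0.
have hd x : root h x -> root d x.
  move=> hx; apply/negPn/negP => dx; have [p /hdvd/dvdpP[q ->]] := loc x dx.
  by rewrite hornerM (eqP hx) mulr0 eqxx.
suff [n hn] : exists n, h %| d ^+ n.
  by exists n; have /dvdpP [q ->] := hn; apply: IM.
have [m sm] := ubnP (size h); exists m; move: sm hd h0 {hmin hdvd Ih sh}.
elim: m h => [//|n IH] h; rewrite ltnS => sh hd h0.
have [s1|s1] := boolP (size h == 1%N).
  by rewrite size_poly_eq1 in s1; rewrite (eqp_dvdl _ s1) dvd1p.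
have /closed_rootP [x hx] := s1; have /factor_theorem [q hq] := hx.
have q0 : q != 0 by apply: contraNneq h0 => q0; rewrite hq q0 mul0r.
rewrite hq exprSr dvdp_mul //; last by rewrite dvdp_XsubCl hd.
apply: IH => // [|y qy]; last by apply: hd; rewrite hq rootM qy.
by move: sh; rewrite hq size_Mmonic ?monicXsubC // size_XsubC addn2.
Qed.

Lemma locally_rational_poly (f : k -> k) :
  (forall x0, exists p q, p.[x0] != 0 /\
     forall x, p.[x] != 0 -> f x = q.[x] / p.[x]) ->
  exists p, forall x, f x = p.[x].
Proof.
move=> loc; pose I p := exists q, forall x, p.[x] * f x = q.[x].
have [||||n [q E]] := @ideal_locally_unit I 1; rewrite ?oner_eq0 //.
- move=> p q [p' Ep] [q' Eq]; exists (p' - q') => x.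
  by rewrite !hornerE mulrBl Ep Eq.
- move=> p q [p' Ep]; exists (q * p') => x.
  by rewrite !hornerE -mulrA Ep.
(* Nothing is known about [f] at the zeros of [p]; the second factor [p] makes the identity hold
   there as 0 = 0. *)
- move=> x0 _; have [p [q [px0 E]]] := loc x0; exists (p * p).
    exists (p * q) => x; rewrite !hornerE; have [->|px] := eqVneq p.[x] 0.
      by rewrite !mul0r.
    by rewrite E // -mulrA [_ * (_ / _)]mulrC divfK.
  by rewrite hornerM mulf_neq0.
- by exists q => x; rewrite -E expr1n hornerE mul1r.
Qed.

(* A regular function on the projective line, given in its two affine charts. *)
Lemma regular_P1_const (f g : k -> k) :
  (forall x0, exists p q, p.[x0] != 0 /\
     forall x, p.[x] != 0 -> f x = q.[x] / p.[x]) ->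
  (forall x0, exists p q, p.[x0] != 0 /\
     forall x, p.[x] != 0 -> g x = q.[x] / p.[x]) ->
  (forall x, x != 0 -> f x = g x^-1) -> f 0 = g 0.
Proof.
move=> /locally_rational_poly [p fp] /locally_rational_poly [q gq] fg.
(* Both functions are polynomials p and q, and x^(n-1) q(1/x) is the reversal r of q. Hence p
   X^(n-1) = r has size at most n, which forces p to be constant. *)
pose n := size q; pose r := \poly_(i < n) q`_(n.-1 - i).
have E : p * 'X^(n.-1) = r.
  apply: (@poly_eq_except 'X); rewrite ?polyX_eq0 // => x; rewrite hornerX => x0.
  rewrite !hornerE -fp fg // gq horner_poly horner_coef mulr_suml.
  rewrite (reindex_inj rev_ord_inj) /=; apply: eq_bigr => i _.
  have ni : (i <= n.-1)%N by rewrite -ltnS prednK // (leq_ltn_trans _ (ltn_ord i)).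
  have -> : (size q - i.+1 = n.-1 - i)%N by rewrite -/n subnS predn_sub.
  rewrite -mulrA; congr (_ * _); rewrite -[in x ^+ n.-1](subnK ni) exprD mulrA.
  by rewrite -exprMn mulVf // expr1n mul1r.
have [q0|q0] := eqVneq q 0.
  have p0 : p = 0.
    apply: (@poly_eq_except 'X); rewrite ?polyX_eq0 // => x; rewrite hornerX => x0.
    by rewrite -fp fg // gq q0 !horner0.
  by rewrite fp gq p0 q0 !horner0.
have n0 : (0 < n)%N by rewrite lt0n size_poly_eq0.
have [p0|p0] := eqVneq p 0.
  have : q = 0.
    apply: (@poly_eq_except 'X); rewrite ?polyX_eq0 // => x; rewrite hornerX => x0.
    by rewrite -gq -[x]invrK -fg ?invr_eq0 // fp p0 !horner0.
  by move=> E0; rewrite E0 eqxx in q0.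
have sp : (size p <= 1)%N.
  have : (size r <= n)%N by apply: size_poly.
  rewrite -E size_mul ?expf_neq0 ?polyX_eq0 // size_polyXn addnS /=.
  by rewrite -{2}(prednK n0) -addn1 [(n.-1 + 1)%N]addnC leq_add2r.
have pE x : f x = p`_0 by rewrite fp (size1_polyC sp) hornerC coefC.
have qE : q = (p`_0)%:P.
  apply: (@poly_eq_except 'X); rewrite ?polyX_eq0 // => x; rewrite hornerX => x0.
  by rewrite -gq -[x]invrK -fg ?invr_eq0 // pE hornerC.
by rewrite pE gq qE hornerC.
Qed.

Lemma quadratic_roots (b c : k) : exists r1 r2,
  forall x, x ^+ 2 + b * x - c = (x - r1) * (x - r2).
Proof.
pose P := 'X^2 + b *: 'X - c%:P.
have sP : size P = 3%N.
  rewrite /P -addrA size_polyDl ?size_polyXn // ltnS.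
  rewrite (leq_trans (size_polyD _ _)) // geq_max.
  rewrite (leq_trans (size_scale_leq _ _)) ?size_polyX // size_polyN.
  by rewrite (leq_trans (size_polyC_leq1 _)).
have Pm : P \is monic.
  rewrite monicE lead_coefE sP /P !coefE /=.
  by rewrite mulr0 subr0 addr0.
have [r def] := closed_field_poly_normal P.
have : size r = 2%N.
  have := size_prod_XsubC r id; rewrite (monicP Pm) scale1r in def.
  by rewrite -def sP => [[->]].
case: r def => [//|r1 [//|r2 [|//]]] def _; exists r1, r2 => x.
move: def; rewrite (monicP Pm) scale1r !big_cons big_nil mulr1 => /(congr1 (horner^~ x)).
by rewrite /P !hornerE.
Qed.

(** With r1, r2 the roots of the quadratic, (g - r1 h)(g - r2 h) vanishes where h does not, hence
    identically; so one factor is 0 and g / h is constantly r1 or r2. *)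
Lemma two_valued (g h : {poly k}) (b c : k) :
  (forall x, h.[x] != 0 -> (g.[x] / h.[x]) ^+ 2 + b * (g.[x] / h.[x]) = c) ->
  forall x y, h.[x] != 0 -> h.[y] != 0 -> g.[x] / h.[x] = g.[y] / h.[y].
Proof.
move=> E x y hx hy; have [r1 [r2 R]] := quadratic_roots b c.
have h0 : h != 0 by apply: contraNneq hx => ->; rewrite horner0.
have /eqP : (g - r1 *: h) * (g - r2 *: h) = 0.
  apply: (poly_eq_except h0) => z hz; rewrite horner0 !hornerE.
  have /eqP := E z hz; rewrite -subr_eq0 R => /eqP R0.
  by rewrite -[g.[z]](divfK hz) -!mulrBl mulrACA R0 mul0r.
have const r : g - r *: h == 0 -> forall z, h.[z] != 0 -> g.[z] / h.[z] = r.
  by rewrite subr_eq0 => /eqP -> z hz; rewrite hornerZ mulfK.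
by rewrite mulf_eq0 => /orP[] /const {}R; rewrite !R.
Qed.

End InfiniteField.

(** * Algebras of functions on a set *)

Section PolynomialFunctions.
Variable k : closedFieldType.

(** The predicate is arbitrary because the same closure properties serve for polynomial functions of
    one parameter and for the rings [S0] to [S3] of functions on a multisection. *)
Definition subalg (X : Type) (A : (X -> k) -> Prop) :=
  [/\ forall c, A (fun=> c),
      forall f g, A f -> A g -> A (fun x => f x + g x) &
      forall f g, A f -> A g -> A (fun x => f x * g x)].

Section Closure.
Variables (X : Type) (A : (X -> k) -> Prop).
Hypothesis sA : subalg A.

Lemma subalg_cst c : A (fun=> c). Proof. by case: sA. Qed.

Lemma subalg_add f g : A f -> A g -> A (fun x => f x + g x).
Proof. by case: sA => _ H _; exact: H. Qed.

Lemma subalg_mul f g : A f -> A g -> A (fun x => f x * g x).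
Proof. by case: sA => _ _ H; exact: H. Qed.

Lemma subalg_opp f : A f -> A (fun x => - f x).
Proof.
move=> Af; under eq_fun do rewrite -mulN1r; apply: subalg_mul => //.
exact: subalg_cst.
Qed.

Lemma subalg_exp f m : A f -> A (fun x => f x ^+ m).
Proof.
move=> Af; elim: m => [|m IH].
  under eq_fun do rewrite expr0; exact: subalg_cst.
by under eq_fun do rewrite exprS; apply: subalg_mul.
Qed.

Lemma subalg_sum (I : Type) (r : seq I) (P : pred I) (F : I -> X -> k) :
  (forall i, P i -> A (F i)) -> A (fun x => \sum_(i <- r | P i) F i x).
Proof.
move=> AF; elim: r => [|i r IH].
  under eq_fun do rewrite big_nil; exact: subalg_cst.
case Pi: (P i); under eq_fun do rewrite big_cons Pi //.
  by apply: subalg_add => //; apply: AF.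
exact: IH.
Qed.

Lemma subalg_prod (I : Type) (r : seq I) (P : pred I) (F : I -> X -> k) :
  (forall i, P i -> A (F i)) -> A (fun x => \prod_(i <- r | P i) F i x).
Proof.
move=> AF; elim: r => [|i r IH].
  under eq_fun do rewrite big_nil; exact: subalg_cst.
case Pi: (P i); under eq_fun do rewrite big_cons Pi //.
  by apply: subalg_mul => //; apply: AF.
exact: IH.
Qed.

Lemma subalg_det m (N : X -> 'M[k]_m) :
  (forall i j, A (fun x => N x i j)) -> A (fun x => \det (N x)).
Proof.
move=> AN; apply: subalg_sum => s _; apply: subalg_mul; first exact: subalg_cst.
by apply: subalg_prod => i _; apply: AN.
Qed.

Lemma subalg_mulmx m p q (M : X -> 'M[k]_(m, p)) (N : X -> 'M[k]_(p, q)) :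
  (forall i j, A (fun x => M x i j)) -> (forall i j, A (fun x => N x i j)) ->
  forall i j, A (fun x => (M x *m N x) i j).
Proof.
move=> AM AN i j; under eq_fun do rewrite mxE; apply: subalg_sum => l _.
exact: subalg_mul.
Qed.

Lemma subalg_adj m (N : X -> 'M[k]_m) : (forall i j, A (fun x => N x i j)) ->
  forall i j, A (fun x => (\adj (N x)) i j).
Proof.
move=> AN i j; under eq_fun do rewrite mxE; apply: subalg_mul.
  exact: subalg_cst.
apply: subalg_det => r s; under eq_fun do rewrite !mxE; exact: AN.
Qed.

End Closure.

Lemma subalg_poly : subalg (fun f : k -> k => exists p, forall s, f s = p.[s]).
Proof.
split=> [c|f g [p fp] [q gq]|f g [p fp] [q gq]].
- by exists c%:P => s; rewrite hornerC.
- by exists (p + q) => s; rewrite hornerD fp gq.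
- by exists (p * q) => s; rewrite hornerM fp gq.
Qed.

End PolynomialFunctions.

(** * Identities in characteristic 2 and the three indices *)

Lemma eq_of_add0 (R : comPzRingType) (x y : R) :
  2%:R = 0 :> R -> x + y = 0 -> x = y.
Proof.
move=> two0 xy; apply: subr0_eq; have -> : x - y = (x + y) - 2%:R * y by ring.
by rewrite xy two0 mul0r subr0.
Qed.

Lemma even_nat0 (R : comPzRingType) : 2%:R = 0 :> R ->
  [/\ 4%:R = 0 :> R, 6%:R = 0 :> R, 8%:R = 0 :> R & 10%:R = 0 :> R].
Proof.
move=> two0; have E m : (2 * m)%:R = 0 :> R by rewrite natrM two0 mul0r.
by split; [exact: (E 2%N)|exact: (E 3%N)|exact: (E 4%N)|exact: (E 5%N)].
Qed.

(* An identity in characteristic 2, H being 2 = 0. The tactic ring only       *)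
(* rewrites with an equation between constants when a coefficient equals its  *)
(* left-hand side, whence the four other equations.                           *)
Ltac ring2 H :=
  let h4 := fresh in let h6 := fresh in let h8 := fresh in let h10 := fresh in
  apply: (eq_of_add0 H); have [h4 h6 h8 h10] := even_nat0 H;
  ring: h4 h6 h8 h10 H.

Lemma ord3_others (l : 'I_3) : exists i j : 'I_3, [/\ i != l, j != l & i != j].
Proof.
case: l => [[|[|[|m]]] H] //; [exists i2, i3|exists i1, i3|exists i1, i2];
  by split.
Qed.

Lemma sum_ord3_distinct (V : nmodType) (F : 'I_3 -> V) (i j l : 'I_3) :
  i != l -> j != l -> i != j -> \sum_t F t = F i + F j + F l.
Proof.
move=> il jl ij; rewrite (bigD1 l) // (bigD1 i) //= (bigD1 j) /=; last first.
  by rewrite jl eq_sym.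
rewrite big1 ?addr0 1?addrC // => t; rewrite -andbA => /and3P[tl ti tj].
have := max_card (mem [:: t; i; j; l]); rewrite card_ord (card_uniqP _) //=.
by rewrite !inE negb_or !negb_or ti tj tl ij il jl.
Qed.

Lemma ord3_ind (i j l : 'I_3) (P : 'I_3 -> Prop) :
  i != l -> j != l -> i != j -> P i -> P j -> P l -> forall t, P t.
Proof.
move=> il jl ij Pi Pj Pl t; have [->//|tl] := eqVneq t l.
have [->//|ti] := eqVneq t i; have [->//|tj] := eqVneq t j.
have := max_card (mem [:: t; i; j; l]); rewrite card_ord (card_uniqP _) //=.
by rewrite !inE negb_or !negb_or ti tj tl ij il jl.
Qed.

Lemma ord3_choose (T : Type) (i j l : 'I_3) (x y z : T) :
  i != l -> j != l -> i != j -> exists f, [/\ f i = x, f j = y & f l = z].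
Proof.
move=> il jl ij; exists (fun t => if t == l then z else if t == i then x else y).
by rewrite eqxx (negPf il) (negPf jl) eqxx (eq_sym j) (negPf ij).
Qed.

Lemma prod_ord3_others (R : comPzRingType) (n : 'I_3 -> R) (i j l : 'I_3) :
  i != l -> j != l -> i != j -> \prod_(t | t != i) n t = n j * n l.
Proof.
move=> il jl ij; rewrite (bigD1 l) 1?eq_sym //= (bigD1 j) /=; last first.
  by rewrite (eq_sym j) ij jl.
rewrite big1 ?mulr1 1?mulrC // => t; rewrite -andbA => /and3P[ti tl tj].
have := max_card (mem [:: t; i; j; l]); rewrite card_ord (card_uniqP _) //=.
by rewrite !inE negb_or !negb_or ti tj tl ij il jl.
Qed.

(** * Isotropic planes of a diagonal quadratic form *)

Section DiagonalForm.
Variable k : closedFieldType.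
Hypothesis char2 : 2%N \in [pchar k].
Variables n u v : 'I_3 -> k.

Let two0 : 2%:R = 0 :> k. Proof. exact: pcharf0. Qed.

Definition xc (w : 'rV[k]_6) (i : 'I_3) := w 0 (@lshift 3 3 i).
Definition yc (w : 'rV[k]_6) (i : 'I_3) := w 0 (@rshift 3 3 i).

Definition dq (w : 'rV[k]_6) :=
  \sum_i (n i * xc w i * yc w i + u i * xc w i ^+ 2 + v i * yc w i ^+ 2).

Definition pol (w w' : 'rV[k]_6) :=
  \sum_i n i * (xc w i * yc w' i + yc w i * xc w' i).

Lemma dqD w w' : dq (w + w') = dq w + dq w' + pol w w'.
Proof.
rewrite /dq /pol -!big_split; apply: eq_bigr => i _.
rewrite /xc /yc !mxE /=; ring2 two0.
Qed.

Lemma dqZ a w : dq (a *: w) = a ^+ 2 * dq w.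
Proof.
rewrite /dq mulr_sumr; apply: eq_bigr => i _.
rewrite /xc /yc !mxE; ring.
Qed.

Lemma polDl w1 w2 w : pol (w1 + w2) w = pol w1 w + pol w2 w.
Proof.
rewrite /pol -big_split; apply: eq_bigr => i _.
rewrite /xc /yc !mxE /=; ring.
Qed.

Lemma polZl a w w' : pol (a *: w) w' = a * pol w w'.
Proof.
rewrite /pol mulr_sumr; apply: eq_bigr => i _.
rewrite /xc /yc !mxE; ring.
Qed.

Lemma polC w w' : pol w w' = pol w' w.
Proof. by apply: eq_bigr => i _; ring. Qed.

Lemma polDr w w1 w2 : pol w (w1 + w2) = pol w w1 + pol w w2.
Proof. by rewrite polC polDl !(polC w). Qed.

Lemma polZr a w w' : pol w (a *: w') = a * pol w w'.
Proof. by rewrite polC polZl polC. Qed.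

Definition iso m (M : 'M[k]_(m, 6)) := forall w, (w <= M)%MS -> dq w = 0.

Lemma iso_pol m (M : 'M_(m, 6)) w w' :
  iso M -> (w <= M)%MS -> (w' <= M)%MS -> pol w w' = 0.
Proof.
move=> isoM wM w'M; have := isoM _ (addmx_sub wM w'M).
by rewrite dqD !isoM // !add0r.
Qed.

Definition vec (i : 'I_3) (a b : k) : 'rV[k]_6 :=
  row_mx (a *: delta_mx 0 i) (b *: delta_mx 0 i) : 'rV_(3 + 3).

Lemma xc_vec i a b j : xc (vec i a b) j = if j == i then a else 0.
Proof. rewrite (_ : xc _ _ = (a *: delta_mx 0 i : 'rV_3) 0 j); last exact: row_mxEl.
by rewrite !mxE eqxx /=; case: eqP => _; rewrite ?mulr1 ?mulr0. Qed.

Lemma yc_vec i a b j : yc (vec i a b) j = if j == i then b else 0.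
Proof. rewrite (_ : yc _ _ = (b *: delta_mx 0 i : 'rV_3) 0 j); last exact: row_mxEr.
by rewrite !mxE eqxx /=; case: eqP => _; rewrite ?mulr1 ?mulr0. Qed.

Lemma dq_vec i a b : dq (vec i a b) = n i * a * b + u i * a ^+ 2 + v i * b ^+ 2.
Proof.
rewrite /dq (bigD1 i) //= !xc_vec !yc_vec eqxx big1 ?addr0 // => j /negPf ji.
by rewrite xc_vec yc_vec ji; ring.
Qed.

Lemma pol_vec i a b w : pol (vec i a b) w = n i * (a * yc w i + b * xc w i).
Proof.
rewrite /pol (bigD1 i) //= !xc_vec !yc_vec eqxx big1 ?addr0 // => j /negPf ji.
by rewrite xc_vec yc_vec ji; ring.
Qed.

Lemma pol_vec_neq i j a b a' b' : i != j -> pol (vec i a b) (vec j a' b') = 0.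
Proof. by move=> /negPf ij; rewrite pol_vec xc_vec yc_vec ij; ring. Qed.

(** A nondegenerate binary form has two distinct isotropic lines, distinctness being the nonzero
    pairing. If v_i is nonzero they are spanned by (v_i, r) and (v_i, r + n_i), where r is a root of
    z^2 + n_i z = u_i v_i. *)
Lemma hyperbolic_lines i : n i != 0 -> exists a b a' b',
  [/\ dq (vec i a b) = 0, dq (vec i a' b') = 0 &
      pol (vec i a b) (vec i a' b') != 0].
Proof.
move=> ni; have [vi|vi] := eqVneq (v i) 0.
  exists 0, 1, (n i), (u i); rewrite !dq_vec pol_vec xc_vec yc_vec eqxx vi.
  split; [ring|ring2 two0|].
  by rewrite mul0r mul1r add0r mulf_neq0.
have [r1 [r2 R]] := quadratic_roots (n i) (u i * v i).
have R1 : r1 ^+ 2 + n i * r1 = u i * v i.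
  by apply/eqP; rewrite -subr_eq0 R subrr mul0r.
exists (v i), r1, (v i), (r1 + n i); rewrite !dq_vec pol_vec xc_vec yc_vec eqxx.
have E : n i * v i * r1 + u i * v i ^+ 2 + v i * r1 ^+ 2 = 0.
  by transitivity (v i * (r1 ^+ 2 + n i * r1 + u i * v i)); [ring|rewrite R1; ring2 two0].
split=> //.
  by rewrite -[RHS]E; ring2 two0.
have -> : n i * (v i * (r1 + n i) + r1 * v i) = n i * (n i * v i) by ring2 two0.
by rewrite !mulf_neq0.
Qed.

(* One of the pairs (w1, w2), (w1', w2), (w1, w2'), (w1', w2') will do.       *)
Lemma transverse_pair m (M : 'M_(m, 6)) i j : iso M -> i != j ->
  n i != 0 -> n j != 0 -> exists a b a' b',
  [/\ dq (vec i a b) = 0, dq (vec j a' b') = 0 & forall x y,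
      ((x *: vec i a b + y *: vec j a' b')%R <= M)%MS -> x = 0 /\ y = 0].
Proof.
move=> isoM ij /hyperbolic_lines [a1 [b1 [a1' [b1' [q1 q1' p1]]]]].
move=> /hyperbolic_lines [a2 [b2 [a2' [b2' [q2 q2' p2]]]]].
set w1 := vec i a1 b1 in q1 p1; set w1' := vec i a1' b1' in q1' p1.
set w2 := vec j a2 b2 in q2 p2; set w2' := vec j a2' b2' in q2' p2.
have ort (a b a' b' : k) : pol (vec i a b) (vec j a' b') = 0.
  exact: pol_vec_neq.
have ort' (a b a' b' : k) : pol (vec j a b) (vec i a' b') = 0.
  by rewrite polC.
pose tr (w w' : 'rV[k]_6) := forall x y : k, ((x *: w + y *: w')%R <= M)%MS -> x = 0 /\ y = 0.
have [t|nt] := pselect (tr w1 w2); first by exists a1, b1, a2, b2.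
have [t|nt1] := pselect (tr w1' w2); first by exists a1', b1', a2, b2.
have [t|nt2] := pselect (tr w1 w2'); first by exists a1, b1, a2', b2'.
exists a1', b1', a2', b2'; split => // x y; rewrite -/w1' -/w2' => xyM.
have ntr (w w' : 'rV[k]_6) : ~ tr w w' -> exists x y,
    ((x *: w + y *: w')%R <= M)%MS /\ (x != 0 \/ y != 0).
  move=> H; apply: contrapT => H'; apply: H => x' y' xyM'.
  have [x0|x0] := eqVneq x' 0; have [y0|y0] := eqVneq y' 0 => //.
  - by case: H'; exists x', y'; split; [|right].
  - by case: H'; exists x', y'; split; [|left].
  - by case: H'; exists x', y'; split; [|left].
have sub0 (c : k) (w : 'rV[k]_6) : c != 0 -> (c *: w <= M)%MS -> (w <= M)%MS.
  by move=> c0; rewrite (eqmx_scale _ c0).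
have [c [d [cdM cd0]]] := ntr _ _ nt.
(* If the first three pairs fail, pairing the offending vectors of M with each other puts w1 and w2
   in M. A vector of M in the span of w1' and w2' is then orthogonal to w1 and w2, hence 0. *)
have both : (w1 <= M)%MS /\ (w2 <= M)%MS.
  have [c0|c0] := eqVneq c 0.
    have d0 : d != 0 by case: cd0; rewrite ?c0 ?eqxx.
    have w2M : (w2 <= M)%MS by apply: (sub0 d) => //; move: cdM; rewrite c0 scale0r add0r.
    have [e [f [efM ef0]]] := ntr _ _ nt2.
    have := iso_pol isoM w2M efM; rewrite polDr !polZr ort' mulr0 add0r.
    move/eqP; rewrite mulf_eq0 (negPf p2) orbF => /eqP f0.
    split=> //; apply: (sub0 e); last by move: efM; rewrite f0 scale0r addr0.
    by case: ef0; rewrite ?f0 ?eqxx.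
  have [e [f [efM ef0]]] := ntr _ _ nt1.
  have := iso_pol isoM cdM efM.
  rewrite polDr !polZr !polDl !polZl ort' !ort.
  have -> : pol w2 w2 = 0 by rewrite pol_vec xc_vec yc_vec; case: eqP => _; ring2 two0.
  rewrite !(mulr0, addr0) => /eqP; rewrite !mulf_eq0 (negPf p1) (negPf c0) !orbF.
  move=> /eqP e0; have f0 : f != 0 by case: ef0; rewrite ?e0 ?eqxx.
  have w2M : (w2 <= M)%MS by apply: (sub0 f) => //; move: efM; rewrite e0 scale0r add0r.
  split=> //; apply: (sub0 c) => //.
  have -> : c *: w1 = c *: w1 + d *: w2 + (- d) *: w2 by rewrite scaleNr addrK.
  by rewrite addmx_sub // scalemx_sub.
have [w1M w2M] := both.
have := iso_pol isoM w1M xyM; rewrite polDr !polZr ort mulr0 addr0 => /eqP.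
rewrite mulf_eq0 (negPf p1) orbF => /eqP x0.
have := iso_pol isoM w2M xyM; rewrite polDr !polZr ort' mulr0 add0r => /eqP.
by rewrite mulf_eq0 (negPf p2) orbF => /eqP y0.
Qed.

Lemma vecP (w w' : 'rV[k]_6) :
  (forall i, xc w i = xc w' i) -> (forall i, yc w i = yc w' i) -> w = w'.
Proof.
move=> X Y; apply/rowP => j.
by case: (split_ordP (j : 'I_(3 + 3))) => i ->; [exact: X|exact: Y].
Qed.

Definition Dm (a b : 'I_3 -> k) : 'M[k]_(3, 6) :=
  row_mx (diag_mx (\row_i a i)) (diag_mx (\row_i b i)) : 'M_(3, 3 + 3).

Lemma xc_mul (x : 'rV[k]_3) (A B : 'M[k]_3) i :
  xc (x *m (row_mx A B : 'M_(3, 6))) i = (x *m A) 0 i.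
Proof.
have -> : x *m (row_mx A B : 'M_(3, 6)) = row_mx (x *m A) (x *m B) :> 'rV_(3 + 3).
  exact: mul_mx_row.
exact: row_mxEl.
Qed.

Lemma yc_mul (x : 'rV[k]_3) (A B : 'M[k]_3) i :
  yc (x *m (row_mx A B : 'M_(3, 6))) i = (x *m B) 0 i.
Proof.
have -> : x *m (row_mx A B : 'M_(3, 6)) = row_mx (x *m A) (x *m B) :> 'rV_(3 + 3).
  exact: mul_mx_row.
exact: row_mxEr.
Qed.

Lemma xc_Dm (x : 'rV[k]_3) a b i : xc (x *m Dm a b) i = x 0 i * a i.
Proof. by rewrite xc_mul mul_mx_diag !mxE. Qed.

Lemma yc_Dm (x : 'rV[k]_3) a b i : yc (x *m Dm a b) i = x 0 i * b i.
Proof. by rewrite yc_mul mul_mx_diag !mxE. Qed.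

Lemma dq_Dm (x : 'rV[k]_3) a b :
  dq (x *m Dm a b) = \sum_i x 0 i ^+ 2 * dq (vec i (a i) (b i)).
Proof. by apply: eq_bigr => i _; rewrite xc_Dm yc_Dm dq_vec; ring. Qed.

Lemma iso_Dm a b : (forall i, dq (vec i (a i) (b i)) = 0) -> iso (Dm a b).
Proof.
move=> ab w /submxP [x ->]; rewrite dq_Dm big1 // => i _.
by rewrite ab mulr0.
Qed.

Lemma Dm_sum (x : 'rV[k]_3) a b i j l : i != l -> j != l -> i != j ->
  x *m Dm a b = x 0 i *: vec i (a i) (b i) + x 0 j *: vec j (a j) (b j)
                + x 0 l *: vec l (a l) (b l).
Proof.
move=> il jl ij; rewrite -(sum_ord3_distinct (fun t => x 0 t *: vec t (a t) (b t))) //.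
apply: vecP => t; rewrite (xc_Dm, yc_Dm) /xc /yc summxE (bigD1 t) //= big1.
- by rewrite addr0 mxE -/(xc _ _) xc_vec eqxx.
- by move=> s /negPf st; rewrite mxE -/(xc _ _) xc_vec eq_sym st mulr0.
- by rewrite addr0 mxE -/(yc _ _) yc_vec eqxx.
- by move=> s /negPf st; rewrite mxE -/(yc _ _) yc_vec eq_sym st mulr0.
Qed.

(* At most one of the n i vanishes, namely n l, and the form is not zero on   *)
(* the corresponding plane.                                                   *)
Definition mild l :=
  (forall i, i != l -> n i != 0) /\ [|| n l != 0, u l != 0 | v l != 0].

Lemma mild_aniso l : mild l -> exists a b, dq (vec l a b) != 0.
Proof.
case=> _; have [u0|u0 _] := eqVneq (u l) 0; last first.
  by exists 1, 0; rewrite dq_vec mulr0 expr0n expr1n mulr0 mulr1 addr0 add0r.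
have [v0|v0 _] := eqVneq (v l) 0; last first.
  by exists 0, 1; rewrite dq_vec mulr0 expr0n expr1n mul0r mulr0 !mulr1 !add0r.
by rewrite !orbF => n0; exists 1, 1; rewrite dq_vec u0 v0 !mul0r !addr0 !mulr1.
Qed.

Lemma mx_row_free m p (A : 'M[k]_(m, p)) :
  (forall x : 'rV_m, x *m A = 0 -> x = 0) -> row_free A.
Proof.
move=> inj; rewrite -kermx_eq0; apply/rowV0P => x /sub_kermxP; exact: inj.
Qed.

Lemma row_free_inj0 m p (A : 'M[k]_(m, p)) (x : 'rV_m) :
  row_free A -> x *m A = 0 -> x = 0.
Proof. by move=> /row_free_inj inj xA; apply: inj; rewrite mul0mx. Qed.

Lemma vec0 i : vec i 0 0 = 0.
Proof. by apply: vecP => j; rewrite ?xc_vec ?yc_vec /xc /yc !mxE if_same. Qed.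

Lemma transverse_pair_neq0 m (M : 'M[k]_(m, 6)) i j a b a' b' :
  (forall x y, ((x *: vec i a b + y *: vec j a' b')%R <= M)%MS -> x = 0 /\ y = 0) ->
  (a != 0) || (b != 0) /\ (a' != 0) || (b' != 0).
Proof.
move=> tr; rewrite -!negb_and; split; apply/negP => /andP[/eqP a0 /eqP b0].
  have := tr 1 0; rewrite a0 b0 vec0 scaler0 scale0r addr0 sub0mx.
  by move=> /(_ isT) [/eqP]; rewrite oner_eq0.
have := tr 0 1; rewrite a0 b0 vec0 scaler0 scale0r addr0 sub0mx.
by move=> /(_ isT) [_ /eqP]; rewrite oner_eq0.
Qed.

(** The frame consists of isotropic lines in the two nondegenerate planes and an anisotropic vector
    in the l-th one. On its span the form is a nonzero multiple of x_l^2, so a common vector with M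
    has x_l = 0 and [transverse_pair] applies. *)
Lemma transverse_frame m (M : 'M_(m, 6)) l : mild l -> iso M -> exists a b,
  (forall i, (a i != 0) || (b i != 0)) /\
  forall x : 'rV_3, (x *m Dm a b <= M)%MS -> x = 0.
Proof.
move=> ml isoM; have [i [j [il jl ij]]] := ord3_others l.
have [ai [bi [aj [bj [qi qj tr]]]]] :=
  transverse_pair isoM ij (ml.1 _ il) (ml.1 _ jl).
have [al [bl ql]] := mild_aniso ml.
have [a [ai' aj' al']] := ord3_choose ai aj al il jl ij.
have [b [bi' bj' bl']] := ord3_choose bi bj bl il jl ij.
have [nzi nzj] := transverse_pair_neq0 tr.
exists a, b; split=> [|x xM].
  apply: (ord3_ind il jl ij); rewrite ?ai' ?bi' ?aj' ?bj' ?al' ?bl' //.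
  rewrite -negb_and; apply: contraNN ql => /andP[/eqP -> /eqP ->].
  by rewrite dq_vec; apply/eqP; ring.
have q0 := isoM _ xM; move: q0 xM.
rewrite dq_Dm (Dm_sum x _ _ il jl ij) (sum_ord3_distinct _ il jl ij).
rewrite ai' bi' aj' bj' al' bl' qi qj !mulr0 !add0r => /eqP.
rewrite mulf_eq0 (negPf ql) orbF sqrf_eq0 => /eqP xl.
rewrite xl scale0r addr0 => /tr [xi xj].
by apply/rowP; apply: (ord3_ind il jl ij); rewrite mxE.
Qed.

Lemma iso_rank m (M : 'M_(m, 6)) l : mild l -> iso M -> (\rank M <= 3)%N.
Proof.
move=> ml isoM; have [a [b [_ tr]]] := transverse_frame ml isoM.
have rD : \rank (Dm a b) = 3%N.
  by apply/eqP/mx_row_free => x xD; apply: tr; rewrite xD sub0mx.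
have cap0 : (Dm a b :&: M)%MS = 0.
  apply/eqP/rowV0P => w; rewrite sub_capmx => /andP[/submxP[x ->] /tr ->].
  by rewrite mul0mx.
have := mxrank_sum_cap (Dm a b) M; rewrite cap0 mxrank0 addn0 rD => E.
have := rank_leq_col (Dm a b + M)%MS; rewrite E.
by rewrite -[6%N]/(3 + 3)%N leq_add2l.
Qed.

Definition Ax (M : 'M[k]_(3, 6)) : 'M[k]_3 := lsubmx (M : 'M_(3, 3 + 3)).
Definition By (M : 'M[k]_(3, 6)) : 'M[k]_3 := rsubmx (M : 'M_(3, 3 + 3)).

Lemma Ax_By M : M = row_mx (Ax M) (By M) :> 'M_(3, 3 + 3).
Proof. by rewrite hsubmxK. Qed.

Lemma xc_Ax (x : 'rV[k]_3) M i : xc (x *m M) i = (x *m Ax M) 0 i.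
Proof. by rewrite -(xc_mul x (Ax M) (By M)) -Ax_By. Qed.

Lemma yc_By (x : 'rV[k]_3) M i : yc (x *m M) i = (x *m By M) 0 i.
Proof. by rewrite -(yc_mul x (Ax M) (By M)) -Ax_By. Qed.

(** The xi-coordinates of the rows of M after replacing xi_i by xi_i + c_i eta_i. It is invertible
    when M is a graph over these coordinates. *)
Definition shear (c : 'I_3 -> k) M := Ax M + By M *m diag_mx (\row_i c i).

Lemma line_coord (a b x y : k) : (a != 0) || (b != 0) -> a * y = b * x ->
  exists c, x = c * a /\ y = c * b.
Proof.
have [a0 /= b0|a0 _] := eqVneq a 0; move=> E.
  exists (y / b); rewrite divfK // a0 mulr0; split=> //.
  by move/eqP: E; rewrite a0 mul0r eq_sym mulf_eq0 (negPf b0) => /eqP.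
exists (x / a); rewrite divfK //; split=> //.
by rewrite mulrAC [x * b]mulrC -E mulrAC divff ?mul1r.
Qed.

Lemma det_poly_mx (P : 'M[{poly k}]_3) s : (\det P).[s] = \det (map_mx (horner^~ s) P).
Proof. by rewrite -[_.[s]]/(horner_eval s _) -det_map_mx. Qed.

(** Transversality of M to a frame [Dm a b] makes [D b] invertible: a kernel vector would give a
    vector of M proportional to (a_i, b_i) in each plane, that is, a vector of the frame. If all b_i
    are nonzero, [D b] is, up to scaling its columns, the shear by a_i / b_i. *)
Lemma good_shear M l : mild l -> iso M -> row_free M ->
  exists c, \det (shear c M) != 0.
Proof.
move=> ml isoM rfM; have [a [b [ab tr]]] := transverse_frame ml isoM.
pose D (b' : 'I_3 -> k) :=
  Ax M *m diag_mx (\row_i b' i) + By M *m diag_mx (\row_i a i).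
have D0 : \det (D b) != 0.
  apply/negP => /det0P [x x0 xD]; case/negP: x0; apply/eqP.
  apply: (row_free_inj0 rfM).
  have E i : xc (x *m M) i * b i = yc (x *m M) i * a i.
    have /rowP/(_ i) := xD; rewrite xc_Ax yc_By.
    rewrite /D mulmxDr !mulmxA !mul_mx_diag !mxE => /eqP.
    by rewrite addr_eq0 => /eqP ->; rewrite oppr_pchar2.
  have [y yE] : exists y : 'rV_3, x *m M = y *m Dm a b.
    have /(_ _)/cid-/all_sig [y yE] : forall i, exists c,
        xc (x *m M) i = c * a i /\ yc (x *m M) i = c * b i.
      by move=> i; apply: line_coord => //; rewrite mulrC -E mulrC.
    exists (\row_i y i); apply: vecP => i; rewrite ?xc_Dm ?yc_Dm mxE.
      by case: (yE i).
    by case: (yE i).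
  by rewrite yE (tr y) ?mul0mx // -yE submxMl.
(* To reach nonzero b_j, b is moved along the line from b (parameter 0) to the vector of ones
   (parameter 1). The determinant is nonzero at 0 and the product of the b_j at 1, so some parameter
   suits both. *)
pose bX j : {poly k} := (b j)%:P + 'X * (1 - b j)%:P.
pose P : 'M[{poly k}]_3 :=
  \matrix_(i, j) ((Ax M i j)%:P * bX j + (By M i j * a j)%:P).
have PE s : (\det P).[s] = \det (D (fun j => (bX j).[s])).
  rewrite det_poly_mx; congr (\det _); apply/matrixP => i j.
  by rewrite /D !mul_mx_diag !mxE !hornerE.
have P0 : \det P != 0.
  apply: contraNneq D0 => P0; have := PE 0; rewrite P0 horner0 => ->.
  apply/eqP; congr (\det (D _)); apply/funext => j.
  by rewrite /bX !hornerE.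
have R0 : \prod_j bX j != 0.
  have : (\prod_j bX j).[1] != 0.
    by rewrite horner_prod big1 ?oner_eq0 // => j _; rewrite /bX hornerD hornerM !hornerC hornerX mul1r addrC subrK.
  by apply: contraNneq => ->; rewrite horner0.
have [s] : exists s, (\det P * \prod_j bX j).[s] != 0.
  by apply: poly_nonroot; rewrite mulf_neq0.
rewrite hornerM mulf_eq0 negb_or PE horner_prod => /andP[Ds bs].
have bs0 j : (bX j).[s] != 0.
  by apply: contraNneq bs => E; rewrite (bigD1 j) //= E mul0r.
exists (fun j => a j / (bX j).[s]); apply: contraNneq Ds => S0.
suff -> : D (fun j => (bX j).[s]) = shear (fun j => a j / (bX j).[s]) M
    *m diag_mx (\row_j (bX j).[s]) by rewrite det_mulmx S0 mul0r.
apply/matrixP => i j; rewrite /D /shear !mul_mx_diag !mxE mulrDl; congr (_ + _).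
by rewrite -mulrA divfK.
Qed.

Definition gram : 'M[k]_6 :=
  block_mx 0 (diag_mx (\row_i n i)) (diag_mx (\row_i n i)) 0 : 'M_(3 + 3).

Lemma polE w w' : pol w w' = (w *m gram *m w'^T) 0 0.
Proof.
have -> : w *m gram *m w'^T =
  lsubmx (w : 'rV_(3 + 3)) *m diag_mx (\row_i n i) *m (rsubmx (w' : 'rV_(3 + 3)))^T +
  rsubmx (w : 'rV_(3 + 3)) *m diag_mx (\row_i n i) *m (lsubmx (w' : 'rV_(3 + 3)))^T.
  pose N := diag_mx (\row_i n i).
  transitivity (row_mx (lsubmx (w : 'rV_(3 + 3))) (rsubmx (w : 'rV_(3 + 3)))
    *m block_mx 0 N N 0
    *m (row_mx (lsubmx (w' : 'rV_(3 + 3))) (rsubmx (w' : 'rV_(3 + 3))))^T).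
    by rewrite !hsubmxK.
  rewrite mul_row_block tr_row_mx mul_row_col.
  by rewrite !mulmx0 add0r addr0 addrC.
rewrite mxE !mul_mx_diag !mxE -big_split; apply: eq_bigr => i _.
by rewrite !mxE /xc /yc /=; ring.
Qed.

(** Orthogonality to two isotropic lines in the planes i and j imposes two conditions on the
    three-dimensional M, so some nonzero y in M satisfies them. Its components in these planes lie
    on the two lines; since y is isotropic, so is its l-th component, which spans the third line.
    Transversality of the first two lines to M makes the intersection no larger than the line of
    y. *)
Lemma meets_frame (M : 'M[k]_(3, 6)) l : mild l -> iso M -> row_free M ->
  exists a b, [/\ forall i, (a i != 0) || (b i != 0),
    forall i, dq (vec i (a i) (b i)) = 0 & \rank (M :&: Dm a b)%MS = 1%N].
Proof.
move=> ml isoM rfM; have [i [j [il jl ij]]] := ord3_others l.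
have [ai [bi [aj [bj [qi qj tr]]]]] :=
  transverse_pair isoM ij (ml.1 _ il) (ml.1 _ jl).
have ni := ml.1 _ il; have nj := ml.1 _ jl.
pose L : 'M[k]_(1 + 1, 6) := col_mx (vec i ai bi) (vec j aj bj).
have [x x0 xL] : exists2 x : 'rV_3, x != 0 & x *m (M *m gram *m L^T) = 0.
  have : kermx (M *m gram *m L^T) != 0.
    rewrite kermx_eq0 /row_free; apply/negP => /eqP r3.
    by have := rank_leq_col (M *m gram *m L^T); rewrite r3.
  by case/rowV0Pn => x /sub_kermxP xK x0; exists x.
set y := x *m M; have yM : (y <= M)%MS by apply: submxMl.
have y0 : y != 0 by apply: contraNneq x0 => /(row_free_inj0 rfM) ->.
have [pi pj] : pol (vec i ai bi) y = 0 /\ pol (vec j aj bj) y = 0.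
  rewrite !(polC _ y) !polE; move: xL; rewrite !mulmxA /L tr_col_mx -/y.
  by rewrite mul_mx_row -row_mx0 => /eq_row_mx [-> ->]; rewrite !mxE.
have [nzi nzj] := transverse_pair_neq0 tr.
have prop i' a b : n i' != 0 -> (a != 0) || (b != 0) -> pol (vec i' a b) y = 0 ->
    exists s, xc y i' = s * a /\ yc y i' = s * b.
  move=> ni' ab py; apply: line_coord => //.
  apply/eqP; rewrite -subr_eq0 oppr_pchar2 //; move/eqP: py.
  by rewrite pol_vec mulf_eq0 (negPf ni').
have [si [xi yi]] := prop _ _ _ ni nzi pi.
have [sj [xj yj]] := prop _ _ _ nj nzj pj.
have [a [ai' aj' al']] := ord3_choose ai aj (xc y l) il jl ij.
have [b [bi' bj' bl']] := ord3_choose bi bj (yc y l) il jl ij.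
have [s [s_i s_j s_l]] := ord3_choose si sj 1 il jl ij.
have yE : y = (\row_t s t) *m Dm a b.
  apply: vecP; apply: (ord3_ind il jl ij); rewrite ?xc_Dm ?yc_Dm mxE.
  - by rewrite s_i ai'.
  - by rewrite s_j aj'.
  - by rewrite s_l al' mul1r.
  - by rewrite s_i bi'.
  - by rewrite s_j bj'.
  - by rewrite s_l bl' mul1r.
exists a, b; split.
- apply: (ord3_ind il jl ij); rewrite ?ai' ?bi' ?aj' ?bj' ?al' ?bl' //.
  rewrite -negb_and; apply: contraNN y0 => /andP[/eqP xl /eqP yl].
  move: yM; rewrite yE (Dm_sum _ _ _ il jl ij) !mxE s_i s_j ai' bi' aj' bj' al' bl'.
  rewrite xl yl vec0 scaler0 addr0 => /tr [-> ->].
  by rewrite !scale0r addr0.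
- have := isoM _ yM; rewrite yE dq_Dm (sum_ord3_distinct _ il jl ij) !mxE.
  rewrite ai' bi' aj' bj' qi qj !mulr0 !add0r s_l expr1n mul1r => ql.
  by apply: (ord3_ind il jl ij); rewrite ?ai' ?bi' ?aj' ?bj'.
apply/eqP; rewrite eqn_leq; apply/andP; split; last first.
  rewrite lt0n mxrank_eq0; apply: contraNneq y0 => c0.
  by rewrite -submx0 -c0 sub_capmx yM yE submxMl.
rewrite (@leq_trans (\rank y)) ?rank_leq_row // mxrankS //.
apply/rV_subP => w; rewrite sub_capmx => /andP[wM /submxP [z wE]].
have zM : (w - z 0 l *: y <= M)%MS by rewrite addmx_sub // eqmx_opp scalemx_sub.
suff /eqP : w - z 0 l *: y = 0 by rewrite subr_eq0 => /eqP ->; apply: scalemx_sub.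
pose z' := z - z 0 l *: \row_t s t.
have E : w - z 0 l *: y = z' *m Dm a b by rewrite mulmxBl -scalemxAl -yE -wE.
have z'l : z' 0 l = 0 by rewrite !mxE s_l mulr1 subrr.
move: zM; rewrite E (Dm_sum _ _ _ il jl ij) z'l scale0r addr0 ai' bi' aj' bj'.
by move=> /tr [-> ->]; rewrite !scale0r addr0.
Qed.

Lemma mx_row_base m (A : 'M[k]_(m, 6)) r : \rank A = r ->
  exists2 K : 'M_(r, 6), (K :=: A)%MS & row_free K.
Proof.
by move=> <-; exists (row_base A); [exact: eq_row_base|exact: row_base_free].
Qed.

(* The line in the orthogonal Grassmannian through two planes meeting in a    *)
(* point y.                                                                   *)
Lemma iso_path (M M' : 'M[k]_(3, 6)) l : mild l ->
  iso M -> iso M' -> row_free M -> row_free M' -> \rank (M :&: M')%MS = 1%N ->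
  exists (y : 'rV[k]_6) (K K' : 'M[k]_(2, 6)),
  let N s t : 'M[k]_(3, 6) := col_mx y (s *: K + t *: K') : 'M_(1 + 2, 6) in
  [/\ forall s t, (s != 0) || (t != 0) -> row_free (N s t) /\ iso (N s t),
      (N 1 0 :=: M)%MS & (N 0 1 :=: M')%MS].
Proof.
move=> ml isoM isoM' rM rM' r1.
have rkM : \rank M = 3%N by apply/eqP.
have rkM' : \rank M' = 3%N by apply/eqP.
have [y ydef ry] := mx_row_base r1.
have [K Kdef rK] : exists2 K : 'M_(2, 6), (K :=: M :\: M')%MS & row_free K.
  by apply: mx_row_base; have := mxrank_cap_compl M M'; rewrite r1 rkM => -[].
have [K' K'def rK'] : exists2 K : 'M_(2, 6), (K :=: M' :\: M)%MS & row_free K.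
  apply: mx_row_base; have := mxrank_cap_compl M' M.
  by rewrite capmxC r1 rkM' => -[].
have KM : (K <= M)%MS by rewrite Kdef diffmxSl.
have K'M' : (K' <= M')%MS by rewrite K'def diffmxSl.
have [yM yM'] : (y <= M)%MS /\ (y <= M')%MS.
  by apply/andP; rewrite -sub_capmx ydef.
have defM : (y + K :=: M)%MS.
  apply: eqmx_trans (addsmx_diff_cap_eq M M'); rewrite addsmxC.
  exact: adds_eqmx.
have defM' : (y + K' :=: M')%MS.
  apply: eqmx_trans (addsmx_diff_cap_eq M' M); rewrite addsmxC.
  by apply: adds_eqmx => //; rewrite capmxC.
have subw p (A : 'M[k]_(p, 6)) (x : 'rV_p) q (B : 'M[k]_(q, 6)) :
  (A <= B)%MS -> (x *m A <= B)%MS by apply: submx_trans (submxMl _ _).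
(* The pairing of the complements of the common line is nondegenerate: a vector of K orthogonal to
   M' could be added to M', giving an isotropic space of dimension 4, against [iso_rank]. *)
pose Om := K *m gram *m K'^T.
have uOm : Om \in unitmx.
  rewrite -row_free_unit; apply: mx_row_free => x xOm.
  set w := x *m K; have wM : (w <= M)%MS by apply: subw.
  have pw m' : (m' <= M')%MS -> pol w m' = 0.
    rewrite -defM' => /sub_addsmxP [[c z] /= ->]; rewrite polDr.
    rewrite (iso_pol isoM) ?subw // add0r polE trmx_mul !mulmxA /w.
    by move: xOm; rewrite /Om !mulmxA => ->; rewrite mul0mx mxE.
  have isoMw : iso (M' + w)%MS.
    move=> _ /sub_addsmxP [[c z] /= ->].
    rewrite dqD isoM' ?submxMl // isoM ?subw // polC.
    have -> : z *m w = z 0 0 *: w.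
      by rewrite -mul_scalar_mx -mx11_scalar.
    by rewrite polZl pw ?submxMl // mulr0 !addr0.
  have wM' : (w <= M')%MS.
    have /mxrank_leqif_sup/geq_leqif : (M' <= M' + w)%MS by apply: addsmxSl.
    rewrite rkM' (iso_rank ml isoMw) => /esym.
    by apply: submx_trans; apply: addsmxSr.
  have : (w <= (M :\: M') :&: M')%MS.
    by rewrite sub_capmx wM' -Kdef submxMl.
  rewrite capmx_diff submx0 => /eqP; exact: row_free_inj0.
(* K' is replaced by a multiple for which the pairing with K is J, an alternating matrix in
   characteristic 2. Then z K and z K' are orthogonal for each z, so every combination of K and K'
   is isotropic. *)
pose J : 'M[k]_2 := \matrix_(i, j) (i != j)%:R.
have JT : J^T = J by apply/matrixP => i j; rewrite !mxE eq_sym.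
have uJ : J \in unitmx.
  rewrite unitmxE (expand_det_row _ 0) !big_ord_recl big_ord0 !mxE /= /cofactor.
  by rewrite !det_mx11 !mxE /=; rewrite !(mul0r, mul1r, mulr1, add0r, addr0) unitrX ?unitrN1.
pose S := J *m invmx Om^T.
have uS : S \in unitmx by rewrite unitmx_mul uJ unitmx_inv unitmx_tr.
exists y, K, (S *m K') => N.
have KK z : pol (z *m K) (z *m (S *m K')) = 0.
  have E : K *m gram *m (S *m K')^T = J.
    by rewrite trmx_mul /S trmx_mul trmx_inv trmxK JT !mulmxA -/Om mulmxV // mul1mx.
  rewrite polE [in (z *m _)^T]trmx_mul.
  have -> : z *m K *m gram *m ((S *m K')^T *m z^T) = z *m J *m z^T.
    by rewrite -E !mulmxA.
  rewrite !mxE !big_ord_recl big_ord0 !mxE !big_ord_recl !big_ord0 !mxE /=.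
  by ring2 two0.
have SK' : (S *m K' :=: K')%MS by apply: eqmxMfull; rewrite row_full_unit.
have SK'M' : (S *m K' <= M')%MS by rewrite SK'.
have rSK' : row_free (S *m K').
  by rewrite /row_free SK' -/(row_free K').
have NE s t (z0 : 'rV_1) (z1 : 'rV_2) : row_mx z0 z1 *m N s t =
    z0 *m y + s *: (z1 *m K) + t *: (z1 *m (S *m K')).
  by rewrite mul_row_col mulmxDr -!scalemxAr addrA.
split=> [s t st||].
- split.
    apply: mx_row_free => z; rewrite -[z](@hsubmxK _ 1 1 2).
    set z0 := lsubmx _; set z1 := rsubmx _; rewrite NE => E.
    have b0 : t *: (z1 *m (S *m K')) = 0.
      have bM' : (t *: (z1 *m (S *m K')) <= M' :\: M)%MS.
        by rewrite scalemx_sub // -K'def -SK' submxMl.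
      have bM : (t *: (z1 *m (S *m K')) <= M)%MS.
        move/eqP: E; rewrite addrC addr_eq0 => /eqP ->.
        by rewrite eqmx_opp addmx_sub ?scalemx_sub ?subw.
      have : (t *: (z1 *m (S *m K')) <= (M' :\: M) :&: M)%MS by rewrite sub_capmx bM'.
      by rewrite capmx_diff submx0 => /eqP.
    have a0 : s *: (z1 *m K) = 0.
      have aM : (s *: (z1 *m K) <= M :\: M')%MS by rewrite scalemx_sub // -Kdef submxMl.
      have aM' : (s *: (z1 *m K) <= M')%MS.
        move/eqP: E; rewrite b0 addr0 addrC addr_eq0 => /eqP ->.
        by rewrite eqmx_opp subw.
      have : (s *: (z1 *m K) <= (M :\: M') :&: M')%MS by rewrite sub_capmx aM.
      by rewrite capmx_diff submx0 => /eqP.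
    have z00 : z0 = 0.
      by apply: (row_free_inj0 ry); move: E; rewrite a0 b0 !addr0.
    have z10 : z1 = 0.
      case/orP: st => [s0|t0].
        move/eqP: a0; rewrite scaler_eq0 (negPf s0) => /eqP; exact: row_free_inj0.
      move/eqP: b0; rewrite scaler_eq0 (negPf t0) => /eqP; exact: row_free_inj0.
    by rewrite z00 z10 row_mx0.
  move=> _ /submxP [z ->]; rewrite -[z](@hsubmxK _ 1 1 2).
  set z0 := lsubmx _; set z1 := rsubmx _; rewrite NE dqD.
  rewrite isoM ?addmx_sub ?scalemx_sub ?subw // isoM' ?scalemx_sub ?subw //.
  rewrite polDl !polZr !polZl KK (iso_pol isoM') ?subw //.
  by rewrite !mulr0 !addr0.
- apply: eqmx_trans defM; rewrite /N scale1r scale0r addr0.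
  by apply: eqmx_sym; apply: addsmxE.
- apply: eqmx_trans defM'; rewrite /N scale1r scale0r add0r.
  apply: (@eqmx_trans _ _ _ _ _ _ (y + S *m K')%MS); last exact: adds_eqmx.
  by apply: eqmx_sym; apply: addsmxE.
Qed.

(** [arfB] is the Pfaffian of the polar form, and [arfA] divided by its square is the Arf invariant,
    the sum of the u_i v_i / n_i^2. *)
Definition arfB := \prod_i n i.
Definition arfA := \sum_i u i * v i * (\prod_(j | j != i) n j) ^+ 2.

(** The coefficient of eta_i^2 in the coordinates sheared by c; n_i and u_i are unchanged. *)
Definition vs (c : 'I_3 -> k) i := v i + n i * c i + u i * c i ^+ 2.

(* The eigenvalue on the isotropic plane M of a generator of the centre of    *)
(* the even Clifford algebra of dq; see lam below.                            *)
Definition lamc c M := \sum_i \prod_(j | j != i) n j *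
  (vs c i * (invmx (shear c M) *m By M) i i + c i * u i).

Definition lnum c M := \sum_i \prod_(j | j != i) n j *
  (vs c i * (\adj (shear c M) *m By M) i i + c i * u i * \det (shear c M)).

Lemma lamcE c M : \det (shear c M) != 0 -> lamc c M = lnum c M / \det (shear c M).
Proof.
move=> d0; rewrite /lamc /lnum mulr_suml; apply: eq_bigr => i _.
rewrite -mulrA; congr (_ * _); rewrite [RHS]mulrDl mulfK //; congr (_ + _).
rewrite -mulrA; congr (_ * _); rewrite /invmx unitmxE unitfE d0 -scalemxAl mxE.
by rewrite mulrC.
Qed.

(** In sheared coordinates M is the graph eta = xi R. Isotropy on basis vectors and on their sums
    gives [rel1] and [rel2], and the equation is a combination of these. *)
Lemma lamc_quadratic c M : iso M -> \det (shear c M) != 0 ->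
  lamc c M ^+ 2 + arfB * lamc c M = arfA.
Proof.
move=> isoM d0; have uS : shear c M \in unitmx by rewrite unitmxE unitfE.
pose R := invmx (shear c M) *m By M.
have rel (y : 'rV_3) : \sum_i (n i * y 0 i * (y *m R) 0 i + u i * y 0 i ^+ 2
    + vs c i * (y *m R) 0 i ^+ 2) = 0.
  rewrite -[RHS](isoM (y *m invmx (shear c M) *m M) (submxMl _ _)).
  apply: eq_bigr => i _.
  rewrite xc_Ax yc_By -[y *m _ *m By M]mulmxA -/R.
  have -> : (y *m invmx (shear c M) *m Ax M) 0 i = y 0 i + (y *m R) 0 i * c i.
    have -> : Ax M = shear c M + By M *m diag_mx (\row_i c i).
      apply/matrixP => r s; rewrite /shear !mxE -addrA -mulr2n -mulr_natr.
      by rewrite two0 mulr0 addr0.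
    rewrite mulmxDr mulmxKV // !mulmxA -[y *m _ *m By M]mulmxA -/R mul_mx_diag.
    by rewrite !mxE.
  rewrite /vs; ring2 two0.
have rel1 j : n j * R j j + u j + \sum_i vs c i * R j i ^+ 2 = 0.
  rewrite -[RHS](rel (delta_mx 0 j)) big_split /= -rowE; congr (_ + _).
    rewrite (bigD1 j) //= big1 ?addr0 => [|i /negPf ij]; rewrite !mxE ?eqxx ?ij /=.
      by ring.
    by ring.
  by apply: eq_bigr => i _; rewrite !mxE.
have rel2 i j : i != j -> n i * R j i + n j * R i j = 0.
  move=> ij; pose e : 'rV[k]_3 := delta_mx 0 i + delta_mx 0 j; have := rel e.
  have -> : \sum_t (n t * e 0 t * (e *m R) 0 t + u t * e 0 t ^+ 2 +
      vs c t * (e *m R) 0 t ^+ 2) =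
    (n i * R i i + u i + \sum_t vs c t * R i t ^+ 2) +
    (n j * R j j + u j + \sum_t vs c t * R j t ^+ 2) + (n i * R j i + n j * R i j).
    have -> : (n i * R i i + u i + \sum_t vs c t * R i t ^+ 2) +
      (n j * R j j + u j + \sum_t vs c t * R j t ^+ 2) + (n i * R j i + n j * R i j)
      = (n i * (R i i + R j i) + u i) + (n j * (R j j + R i j) + u j) +
        \sum_t vs c t * (R i t + R j t) ^+ 2.
      have -> : \sum_t vs c t * (R i t + R j t) ^+ 2 =
          \sum_t vs c t * R i t ^+ 2 + \sum_t vs c t * R j t ^+ 2.
        by rewrite -big_split; apply: eq_bigr => t _; rewrite /=; ring2 two0.
      by ring.
    rewrite /e big_split /= mulmxDl -!rowE; congr (_ + _); last first.
      by apply: eq_bigr => t _; rewrite !mxE.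
    rewrite (bigD1 i) // (bigD1 j) 1?eq_sym //= big1 => [|t /andP[/negPf ti /negPf tj]].
      by rewrite !mxE !eqxx (negPf ij) (eq_sym j i) (negPf ij) /=; ring.
    by rewrite !mxE ti tj /=; ring.
  by rewrite !rel1 !add0r.
have ord3P := erefl : (i1 != i3) && (i2 != i3) && (i1 != i2).
rewrite /arfA /arfB /lamc -/R.
have s3 (F : 'I_3 -> k) : \sum_i F i = F i1 + F i2 + F i3 by exact: sum_ord3_distinct.
rewrite !s3.
have -> : \prod_i n i = n i1 * n i2 * n i3.
  by rewrite (bigD1 i1) //= (@prod_ord3_others _ _ i1 i2 i3) // mulrA.
rewrite (@prod_ord3_others _ _ i1 i2 i3) // (@prod_ord3_others _ _ i2 i1 i3) //.
rewrite (@prod_ord3_others _ _ i3 i1 i2) //.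
have E1 := rel1 i1; have E2 := rel1 i2; have E3 := rel1 i3; rewrite !s3 in E1 E2 E3.
have E12 := @rel2 i1 i2 isT; have E13 := @rel2 i1 i3 isT; have E23 := @rel2 i2 i3 isT.
rewrite /vs in E1 E2 E3 *.
move: (R i1 i1) (R i1 i2) (R i1 i3) (R i2 i1) (R i2 i2) (R i2 i3) (R i3 i1) (R i3 i2) (R i3 i3) E1 E2 E3 E12 E13 E23.
move: (n i1) (n i2) (n i3) (u i1) (u i2) (u i3) (v i1) (v i2) (v i3) (c i1) (c i2) (c i3).
move=> n1 n2 n3 u1 u2 u3 v1 v2 v3 c1 c2 c3 R11 R12 R13 R21 R22 R23 R31 R32 R33.
set w1 := v1 + _ + _; set w2 := v2 + _ + _; set w3 := v3 + _ + _.
move=> E1 E2 E3 E12 E13 E23.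
apply: subr0_eq; rewrite oppr_pchar2 //.
(* The relations [rel1] appear with coefficients w_i times the square of the product of the other
   n_j. The relations [rel2] appear squared, as the cross terms w_i w_j demand. *)
transitivity (w1 * (n2 * n3) ^+ 2 * (n1 * R11 + u1 + (w1 * R11 ^+ 2 + w2 * R12 ^+ 2 + w3 * R13 ^+ 2))
 + w2 * (n1 * n3) ^+ 2 * (n2 * R22 + u2 + (w1 * R21 ^+ 2 + w2 * R22 ^+ 2 + w3 * R23 ^+ 2))
 + w3 * (n1 * n2) ^+ 2 * (n3 * R33 + u3 + (w1 * R31 ^+ 2 + w2 * R32 ^+ 2 + w3 * R33 ^+ 2))
 + w1 * w2 * (n3 * (n1 * R21 + n2 * R12)) ^+ 2 + w1 * w3 * (n2 * (n1 * R31 + n3 * R13)) ^+ 2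
 + w2 * w3 * (n1 * (n2 * R32 + n3 * R23)) ^+ 2); last first.
  by rewrite E1 E2 E3 E12 E13 E23; ring.
by rewrite /w1 /w2 /w3; ring2 two0.
Qed.

(** The shear is chosen arbitrarily, which is harmless by [lam_indep]; by [good_shear] the value 0
    is not reached on isotropic planes of a mild form. *)
Definition lam M : k :=
  if pselect (exists c, \det (shear c M) != 0) is left e
  then lamc (projT1 (cid e)) M else 0.

Lemma lnum_polyfun (X : Type) (A : (X -> k) -> Prop) (c : X -> 'I_3 -> k)
    (M : X -> 'M[k]_(3, 6)) : subalg A -> (forall i, A (fun x => c x i)) ->
  (forall i j, A (fun x => M x i j)) ->
  A (fun x => lnum (c x) (M x)) /\ A (fun x => \det (shear (c x) (M x))).
Proof.
move=> sA Ac AM.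
have AB i j : A (fun x => By (M x) i j) by under eq_fun do rewrite mxE.
have AS i j : A (fun x => shear (c x) (M x) i j).
  under eq_fun do rewrite /shear mul_mx_diag !mxE.
  by apply: subalg_add => //; apply: subalg_mul.
split; last exact: subalg_det.
apply: subalg_sum => // i _; apply: subalg_mul => //; first exact: subalg_cst.
apply: subalg_add => //; last first.
  apply: subalg_mul => //; last exact: subalg_det.
  by apply: subalg_mul => //; apply: subalg_cst.
apply: subalg_mul => //; last by apply: subalg_mulmx => //; apply: subalg_adj.
rewrite /vs; apply: subalg_add => //; last first.
  by apply: subalg_mul => //; [exact: subalg_cst|exact: subalg_exp].
apply: subalg_add => //; first exact: subalg_cst.
by apply: subalg_mul => //; apply: subalg_cst.
Qed.

(** Along the segment from c to c' the value is a rational function of the parameter satisfying an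
    equation with constant coefficients, so [two_valued] applies. *)
Lemma lam_indep c c' M : iso M -> \det (shear c M) != 0 ->
  \det (shear c' M) != 0 -> lamc c M = lamc c' M.
Proof.
move=> isoM d0 d0'; pose cs s i := c i + s * (c' i - c i).
have [||[g gE] [h hE]] := @lnum_polyfun _ _ cs (fun=> M) (subalg_poly k).
- move=> i; exists ((c i)%:P + 'X * (c' i - c i)%:P) => s.
  by rewrite hornerD hornerM !hornerC hornerX.
- by move=> i j; exists (M i j)%:P => s; rewrite hornerC.
have c0 : cs 0 = c by apply/funext => i; rewrite /cs mul0r addr0.
have c1 : cs 1 = c' by apply/funext => i; rewrite /cs mul1r addrC subrK.
have R s : h.[s] != 0 -> g.[s] / h.[s] = lamc (cs s) M.
  by rewrite -gE -hE => hs; rewrite lamcE.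
have h0 : h.[0] != 0 by rewrite -hE c0.
have h1 : h.[1] != 0 by rewrite -hE c1.
have -> : lamc c M = g.[0] / h.[0] by rewrite R ?c0.
have -> : lamc c' M = g.[1] / h.[1] by rewrite R ?c1.
apply: (@two_valued _ g h arfB arfA) => // x hx.
by rewrite R // lamc_quadratic // hE.
Qed.

Lemma lamE c M : iso M -> \det (shear c M) != 0 -> lam M = lamc c M.
Proof.
move=> isoM d0; rewrite /lam; case: pselect => [e|[]]; last by exists c.
by apply: lam_indep => //; exact: projT2 (cid e).
Qed.

Lemma lam_quadratic M l : mild l -> iso M -> row_free M ->
  lam M ^+ 2 + arfB * lam M = arfA.
Proof.
move=> ml isoM rfM; have [c d0] := good_shear ml isoM rfM.
by rewrite (lamE isoM d0) lamc_quadratic.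
Qed.

Lemma iso_eqmx m m' (M : 'M_(m, 6)) (M' : 'M_(m', 6)) :
  (M :=: M')%MS -> iso M -> iso M'.
Proof. by move=> E isoM w; rewrite -E; apply: isoM. Qed.

Lemma eqmx_unit (M M' : 'M[k]_(3, 6)) : (M :=: M')%MS -> row_free M ->
  exists2 C, C \in unitmx & M' = C *m M.
Proof.
move=> E rM; have /submxP [C M'E] : (M' <= M)%MS by rewrite E.
exists C => //; rewrite -row_full_unit /row_full eqn_leq rank_leq_col.
apply: (@leq_trans (\rank M')); first by rewrite -E (eqP rM).
by rewrite M'E mxrankM_maxl.
Qed.

Lemma shear_mul c C M : shear c (C *m M) = C *m shear c M.
Proof.
have AE : Ax (C *m M) = C *m Ax M.
  by apply/matrixP => i j; rewrite !mxE; apply: eq_bigr => r _; rewrite mxE.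
have BE : By (C *m M) = C *m By M.
  by apply/matrixP => i j; rewrite !mxE; apply: eq_bigr => r _; rewrite mxE.
by rewrite /shear AE BE mulmxDr mulmxA.
Qed.

Lemma lam_eqmx M M' l : mild l -> (M :=: M')%MS -> iso M -> row_free M ->
  lam M = lam M'.
Proof.
move=> ml E isoM rM; have isoM' := iso_eqmx E isoM.
have [c d0] := good_shear ml isoM rM; have [C uC M'E] := eqmx_unit E rM.
have d0' : \det (shear c M') != 0.
  by rewrite M'E shear_mul det_mulmx mulf_neq0 // -unitfE -unitmxE.
rewrite (lamE isoM d0) (lamE isoM' d0') /lamc; apply: eq_bigr => i _.
have BE : By (C *m M) = C *m By M.
  by apply/matrixP => r j; rewrite !mxE; apply: eq_bigr => s _; rewrite mxE.
have uS : shear c M \in unitmx by rewrite unitmxE unitfE.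
congr (_ * (_ * _ + _)); rewrite M'E shear_mul BE.
have -> : invmx (C *m shear c M) = invmx (shear c M) *m invmx C.
  have uCS : C *m shear c M \in unitmx by rewrite unitmx_mul uC.
  apply: (can_inj (mulKmx uCS)).
  by rewrite mulmxV // -mulmxA (mulmxA (shear c M)) mulmxV // mul1mx mulmxV.
by rewrite mulmxA mulmxKV.
Qed.

(** Numerator and denominator are only required to be polynomial along polynomial curves of
    matrices, which is what the restriction to the lines of [iso_path] uses. *)
Definition locally_rational (F : 'M[k]_(3, 6) -> k) :=
  forall M0, iso M0 -> row_free M0 -> exists G H : 'M[k]_(3, 6) -> k,
  [/\ forall (N : k -> 'M[k]_(3, 6)),
        (forall i j, exists p, forall s, N s i j = p.[s]) ->
        (exists p, forall s, G (N s) = p.[s]) /\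
        (exists p, forall s, H (N s) = p.[s]),
      H M0 != 0 &
      forall M, iso M -> row_free M -> H M != 0 -> F M = G M / H M].

Lemma lam_rational l : mild l -> locally_rational lam.
Proof.
move=> ml M0 iso0 rf0; have [c d0] := good_shear ml iso0 rf0.
exists (lnum c), (fun M => \det (shear c M)); split=> // [N pN|M isoM rfM dM].
  apply: (@lnum_polyfun _ _ (fun=> c) N (subalg_poly k)) => // i.
  by exists (c i)%:P => s; rewrite hornerC.
by rewrite (lamE isoM dM) lamcE.
Qed.

(** On the line of isotropic planes given by [iso_path], F becomes a regular function on the
    projective line, hence a constant. *)
Lemma rational_const F l : mild l -> locally_rational F ->
  (forall M M', iso M -> row_free M -> (M :=: M')%MS -> F M = F M') ->
  forall M M', iso M -> iso M' -> row_free M -> row_free M' ->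
  \rank (M :&: M')%MS = 1%N -> F M = F M'.
Proof.
move=> ml Frat Feq M M' isoM isoM' rM rM' r1.
have [y [K [K' N]]] := iso_path ml isoM isoM' rM rM' r1.
pose P s t : 'M[k]_(3, 6) := col_mx y (s *: K + t *: K') : 'M_(1 + 2, 6).
have [NP N10 N01] := N; have {}NP s t : (s != 0) || (t != 0) ->
  row_free (P s t) /\ iso (P s t) by apply: NP.
have polyP (a b : k -> k) : (exists p, forall s, a s = p.[s]) ->
    (exists p, forall s, b s = p.[s]) -> forall i j, exists p, forall s, P (a s) (b s) i j = p.[s].
  move=> [p pE] [q qE] i j; case: (split_ordP (i : 'I_(1 + 2))) => i' ->.
    exists (y i' j)%:P => s; rewrite hornerC; exact: col_mxEu.
  exists (p * (K i' j)%:P + q * (K' i' j)%:P) => s.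
  rewrite hornerD !hornerM !hornerC -pE -qE.
  have -> : P (a s) (b s) (rshift 1 i') j = (a s *: K + b s *: K') i' j by exact: col_mxEd.
  by rewrite !mxE.
have idP : exists p : {poly k}, forall s, s = p.[s] by exists 'X => s; rewrite hornerX.
have oneP : exists p : {poly k}, forall s : k, 1 = p.[s] by exists 1 => s; rewrite hornerC.
have loc (a b : k -> k) : (exists p, forall s, a s = p.[s]) ->
    (exists p, forall s, b s = p.[s]) -> (forall s, (a s != 0) || (b s != 0)) ->
    forall x0, exists p q : {poly k}, p.[x0] != 0 /\
      forall x, p.[x] != 0 -> F (P (a x) (b x)) = q.[x] / p.[x].
  move=> pa pb ab x0; have [rf0 iso0] := NP _ _ (ab x0).
  have [G [H [GH H0 E]]] := Frat _ iso0 rf0.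
  have [[g gE] [h hE]] := GH _ (polyP _ _ pa pb).
  exists h, g; split=> [|x]; rewrite -hE // => hx.
  by have [rx ix] := NP _ _ (ab x); rewrite -gE E.
have n1 (s : k) : (s != 0) || ((1 : k) != 0) by rewrite oner_eq0 orbT.
have n2 (s : k) : ((1 : k) != 0) || (s != 0) by rewrite oner_eq0.
have := @regular_P1_const _ (fun s => F (P s 1)) (fun s => F (P 1 s))
  (loc id (fun=> 1) idP oneP n1) (loc (fun=> 1) id oneP idP n2).
have [r10 i10] := NP 1 0 (n2 0); have [r01 i01] := NP 0 1 (n1 0).
rewrite (Feq _ _ i10 r10 N10) (Feq _ _ i01 r01 N01) => -> // s s0.
have [rs iss] := NP s 1 (n1 s); apply: Feq => //.
have E1 : (y + (s *: K + 1 *: K')%R :=: P s 1)%MS by exact: addsmxE.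
have E2 : (y + (1 *: K + s^-1 *: K')%R :=: P 1 s^-1)%MS by exact: addsmxE.
apply: (eqmx_trans (eqmx_sym E1)); apply: eqmx_trans E2.
have -> : s *: K + 1 *: K' = s *: (1 *: K + s^-1 *: K').
  by rewrite scalerDr !scalerA mulr1 divff.
by apply: adds_eqmx => //; apply: eqmx_scale.
Qed.

Lemma shear_Dm c a b : shear c (Dm a b) = diag_mx (\row_i (a i + b i * c i)).
Proof.
rewrite /shear; have -> : Ax (Dm a b) = diag_mx (\row_i a i) by exact: row_mxKl.
have -> : By (Dm a b) = diag_mx (\row_i b i) by exact: row_mxKr.
rewrite mul_mx_diag; apply/matrixP => i j; rewrite !mxE.
by case: eqP => [->|_]; rewrite ?mulr1n ?mulr0n ?mul0r ?addr0.
Qed.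

(* The isotropic planes that are sums of lines in the planes of the (xi_i,    *)
(* eta_i), in the coordinates sheared by c.                                   *)
Definition Dz c (z : 'I_3 -> k) := Dm (fun i => vs c i + c i * z i) z.

Lemma dq_Dz c z i : z i ^+ 2 + n i * z i = u i * vs c i ->
  dq (vec i (vs c i + c i * z i) (z i)) = 0.
Proof.
move=> E; rewrite dq_vec.
transitivity (vs c i * (z i ^+ 2 + n i * z i + u i * vs c i)).
  by rewrite /vs; ring2 two0.
by rewrite E -mulr2n -mulr_natr two0 !mulr0.
Qed.

Lemma iso_Dz c z : (forall i, z i ^+ 2 + n i * z i = u i * vs c i) -> iso (Dz c z).
Proof. by move=> E; apply: iso_Dm => i; apply: dq_Dz. Qed.

Lemma shear_Dz c z : shear c (Dz c z) = diag_mx (\row_i vs c i).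
Proof.
rewrite shear_Dm; congr (diag_mx _); apply/rowP => i; rewrite !mxE.
by rewrite -addrA [c i * _]mulrC -mulr2n -mulr_natr two0 mulr0 addr0.
Qed.

Lemma row_free_Dz c z : (forall i, vs c i != 0) -> row_free (Dz c z).
Proof.
move=> v0; apply: mx_row_free => x xD; apply/rowP => i; rewrite mxE.
have : xc (x *m Dz c z) i + c i * yc (x *m Dz c z) i = 0.
  by rewrite xD /xc /yc !mxE mulr0 addr0.
rewrite xc_Dm yc_Dm => E; apply/eqP; have /eqP : x 0 i * vs c i = 0.
  by rewrite -[RHS]E; ring2 two0.
by rewrite mulf_eq0 (negPf (v0 i)) orbF.
Qed.

Lemma lam_Dz c z : (forall i, vs c i != 0) ->
  (forall i, z i ^+ 2 + n i * z i = u i * vs c i) ->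
  lam (Dz c z) = \sum_i \prod_(j | j != i) n j * (z i + c i * u i).
Proof.
move=> v0 E; have d0 : \det (shear c (Dz c z)) != 0.
  rewrite shear_Dz det_diag; apply/prodf_neq0 => i _; rewrite mxE; exact: v0.
rewrite (lamE (iso_Dz E) d0); apply: eq_bigr => i _; congr (_ * (_ + _)).
have BE : By (Dz c z) = diag_mx (\row_i z i) by exact: row_mxKr.
have uS : shear c (Dz c z) \in unitmx by rewrite unitmxE unitfE.
have -> : invmx (shear c (Dz c z)) *m By (Dz c z) = diag_mx (\row_i (z i / vs c i)).
  apply: (can_inj (mulKmx uS)); rewrite mulKVmx // shear_Dz BE mul_diag_mx.
  apply/matrixP => r s; rewrite !mxE; case: eqP => [->|_]; last by rewrite !mulr0n mulr0.
  by rewrite !mulr1n mulrC divfK.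
by rewrite !mxE eqxx mulr1n mulrC divfK.
Qed.

(** The plane of [meets_frame] is brought to normal form by rescaling its rows: since the vs_i are
    nonzero, an isotropic line has nonzero sheared xi-coordinate a'_i, which can be scaled to
    vs_i. *)
Lemma meets_Dz c (M : 'M[k]_(3, 6)) l : mild l -> (forall i, vs c i != 0) -> iso M -> row_free M ->
  exists z, (forall i, z i ^+ 2 + n i * z i = u i * vs c i) /\
    \rank (M :&: Dz c z)%MS = 1%N.
Proof.
move=> ml v0 isoM rM; have [a [b [ab qab r1]]] := meets_frame ml isoM rM.
pose a' i := a i + c i * b i.
have qE i : n i * a' i * b i + u i * a' i ^+ 2 + vs c i * b i ^+ 2 = 0.
  by rewrite -[RHS](qab i) dq_vec /a' /vs; ring2 two0.
have a0 i : a' i != 0.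
  apply/negP => /eqP a0; have /eqP := qE i; rewrite a0 !(mulr0, mul0r) expr0n mulr0 !add0r.
  rewrite mulf_eq0 (negPf (v0 i)) sqrf_eq0 => /eqP b0.
  by have := ab i; move: a0; rewrite /a' b0 mulr0 addr0 => ->; rewrite eqxx.
pose z i := vs c i * b i / a' i.
have zE i : z i ^+ 2 + n i * z i = u i * vs c i.
  apply: (mulIf (expf_neq0 2 (a0 i))).
  transitivity (vs c i * (vs c i * b i ^+ 2 + n i * a' i * b i)).
    by rewrite /z; field.
  have -> : vs c i * b i ^+ 2 + n i * a' i * b i = u i * a' i ^+ 2.
    apply: (eq_of_add0 two0); rewrite -[RHS](qE i); ring.
  by ring.
have DE : (Dz c z :=: Dm a b)%MS.
  have -> : Dz c z = diag_mx (\row_i (vs c i / a' i)) *m Dm a b.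
    pose D := diag_mx (\row_i (vs c i / a' i)); rewrite -/D.
    have -> : D *m Dm a b = row_mx (D *m diag_mx (\row_i a i))
        (D *m diag_mx (\row_i b i)) :> 'M_(3, 3 + 3) by exact: mul_mx_row.
    rewrite /Dz /Dm; apply: (congr2 (@row_mx _ 3 3 3)); apply/matrixP => r s;
      rewrite mul_diag_mx !mxE;
      case: eqP => [->|_]; rewrite ?mulr1n ?mulr0n ?mulr0 //.
      have -> : a s = a' s + c s * b s by rewrite /a'; ring2 two0.
      by rewrite mulrDr divfK // /z; congr (_ + _); field.
    by rewrite /z mulrAC.
  apply: eqmxMfull; rewrite row_full_unit unitmxE det_diag unitfE.
  by apply/prodf_neq0 => i _; rewrite mxE mulf_neq0 ?invr_eq0.
exists z; split=> //; apply: etrans r1.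
by rewrite (cap_eqmx (eqmx_refl M) DE).
Qed.

Lemma cap_Dz c z z' l : (forall i, vs c i != 0) -> z l = z' l ->
  (forall i, i != l -> z i != z' i) -> \rank (Dz c z :&: Dz c z')%MS = 1%N.
Proof.
move=> v0 zl zi; pose y : 'rV[k]_6 := delta_mx 0 l *m Dz c z.
have yE : y = delta_mx 0 l *m Dz c z'.
  apply: vecP => i; rewrite ?xc_Dm ?yc_Dm !mxE /=;
    by have [->|_] := eqVneq i l; rewrite ?zl // !mul0r.
have y0 : y != 0.
  apply/eqP => /(row_free_inj0 (@row_free_Dz c z v0)) /rowP /(_ l) /eqP.
  by rewrite !mxE !eqxx oner_eq0.
apply/eqP; rewrite eqn_leq; apply/andP; split; last first.
  rewrite lt0n mxrank_eq0; apply: contraNneq y0 => c0.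
  by rewrite -submx0 -c0 sub_capmx submxMl yE submxMl.
rewrite (@leq_trans (\rank y)) ?rank_leq_row // mxrankS //.
apply/rV_subP => w; rewrite sub_capmx => /andP[/submxP [a wa] /submxP [b wb]].
have X i : a 0 i * (vs c i + c i * z i) = b 0 i * (vs c i + c i * z' i).
  by have := congr1 (xc^~ i) (etrans (esym wa) wb); rewrite !xc_Dm.
have Y i : a 0 i * z i = b 0 i * z' i.
  by have := congr1 (yc^~ i) (etrans (esym wa) wb); rewrite !yc_Dm.
have ab i : a 0 i = b 0 i.
  by apply: (mulIf (v0 i)); move: (X i); rewrite !mulrDr [a 0 i * (c i * _)]mulrCA [b 0 i * (c i * _)]mulrCA Y => /addIr.
have a0 i : i != l -> a 0 i = 0.
  move=> il; apply/eqP; have /eqP := Y i; rewrite -ab -subr_eq0 -mulrBr mulf_eq0.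
  by rewrite subr_eq0 (negPf (zi _ il)) orbF.
have -> : w = a 0 l *: y; last exact: scalemx_sub.
rewrite wa /y scalemxAl; congr (_ *m _); apply/rowP => i; rewrite !mxE eqxx /=.
by have [->|il] := eqVneq i l; rewrite ?mulr1 // a0 // mulr0.
Qed.

End DiagonalForm.

Lemma meval_dhomog n (R : comNzRingType) d (g : {mpoly R[n]}) c v :
  g \is d.-homog -> g.@[fun i => c * v i] = c ^+ d * g.@[v].
Proof.
move=> /dhomogP hg; rewrite !mevalE mulr_sumr; apply: eq_big_seq => m mg.
have <- : mdeg m = d := hg m mg.
rewrite mulrCA; congr (_ * _); rewrite mdegE expr_sum -big_split.
by apply: eq_bigr => i _; rewrite exprMn.
Qed.

(** * Regular functions on the incidence variety *)

Section Representatives.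
Variable k : closedFieldType.

Definition repL (L : P1 k) (l : 'I_2 -> k) :=
  exists2 c, c != 0 & forall i, hcoord L i = c * l i.

Definition repP (P : G36 k) (M : 'M[k]_(3, 6)) :=
  row_free M /\ forall v, (v \in val P) = (v <= M)%MS.

Lemma hcoord_neq0 (L : P1 k) : hcoord L 0 != 0 \/ hcoord L 1 != 0.
Proof.
have dL : \dim (val L) = 1%N := eqP (valP L).
have [h0|] := eqVneq (hcoord L 0) 0; last by left.
have [h1|] := eqVneq (hcoord L 1) 0; last by right.
have : (vbasis (val L))`_0 != 0.
  have := basis_not0 (vbasisP (val L)); apply.
  by rewrite mem_nth // size_tuple dL.
case/negP; apply/eqP/rowP => i; rewrite mxE.
by case: i => [[|[|i]]] //= Hi; [rewrite -[RHS]h0|rewrite -[RHS]h1];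
  rewrite /hcoord; congr (_ _ _); apply: val_inj.
Qed.

Lemma exists_P1 (l : 'I_2 -> k) : (l 0 != 0) \/ (l 1 != 0) ->
  exists L : P1 k, repL L l.
Proof.
move=> l0; pose w := \row_i l i; have w0 : w != 0.
  apply/eqP => /rowP w0; case: l0 => /eqP; apply.
    by have := w0 0; rewrite !mxE.
  by have := w0 1; rewrite !mxE.
have dw : \dim <[w]> == 1%N by rewrite dim_vline w0.
exists (exist _ <[w]>%VS dw).
set L : P1 k := exist _ _ _.
have : (vbasis (val L))`_0 \in <[w]>%VS.
  by apply: (@vbasis_mem _ _ _ (val L)); rewrite mem_nth // size_tuple (eqP dw).
case/vlineP => c E; exists c.
  apply/eqP => c0; have [] := hcoord_neq0 L;
    by rewrite /hcoord E c0 scale0r mxE eqxx.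
by move=> i; rewrite /hcoord E !mxE.
Qed.

Definition seq_mx n (X : seq 'rV[k]_6) : 'M[k]_(n, 6) := \matrix_(i, j) X`_i 0 j.

Lemma basis_mx (U : {vspace 'rV[k]_6}) (X : seq 'rV[k]_6) n : size X = n ->
  basis_of U X ->
  row_free (seq_mx n X) /\ forall v, (v \in U) = (v <= seq_mx n X)%MS.
Proof.
move=> <- bX; set B := seq_mx _ _.
have mB (x : 'rV_(size X)) : x *m B = \sum_i x 0 i *: X`_i.
  rewrite mulmx_sum_row; apply: eq_bigr => i _; congr (_ *: _).
  by apply/rowP => j; rewrite !mxE.
split=> [|v].
  apply: mx_row_free => x; rewrite mB => x0; apply/rowP => i; rewrite mxE.
  exact: (@freeP _ _ _ (in_tuple X) (basis_free bX) (fun i => x 0 i)).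
apply/idP/submxP => [vU|[x ->]].
  exists (\row_i coord (in_tuple X) i v); rewrite mB.
  by rewrite {1}(coord_basis (X := in_tuple X) bX vU); apply: eq_bigr => i _; rewrite mxE.
rewrite mB; apply: rpred_sum => i _; rewrite rpredZ // (basis_mem bX) //.
exact: mem_nth.
Qed.

Definition Mb (P : G36 k) : 'M[k]_(3, 6) := seq_mx 3 (vbasis (val P)).

Lemma Mb_rep (P : G36 k) : repP P (Mb P).
Proof.
by apply: basis_mx (vbasisP _); rewrite size_tuple; exact: (eqP (valP P)).
Qed.

Lemma exists_G36 (M : 'M[k]_(3, 6)) : row_free M -> exists P : G36 k, repP P M.
Proof.
move=> rM; pose f : 'Hom('rV[k]_3, 'rV[k]_6) := linfun (mulmxr M).
have fE x : f x = x *m M by rewrite lfunE.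
have kf : lker f = 0%VS.
  by apply/eqP/lker0P => x y; rewrite !fE; exact: row_free_inj.
have dP : \dim (f @: fullv)%VS == 3%N.
  by rewrite limg_dim_eq ?kf ?capv0 // dimvf dim_matrix.
exists (exist (fun P : {vspace 'rV[k]_6} => is_true (\dim P == 3%N)) _ dP); split=> // v; apply/memv_imgP/submxP => [[x _ ->]|[x ->]].
  by exists x; rewrite fE.
by exists x; rewrite ?memvf // fE.
Qed.

Lemma repP_uniq (P Q : G36 k) M : repP P M -> repP Q M -> P = Q.
Proof.
by move=> [_ HP] [_ HQ]; apply/val_inj/vspaceP => v; rewrite HP HQ.
Qed.

Lemma repP_eqmx (P : G36 k) M M' : repP P M -> row_free M' -> (M :=: M')%MS -> repP P M'.
Proof. by move=> [_ HP] rM' E; split=> // v; rewrite HP E. Qed.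

Lemma repP_same (P : G36 k) M M' : repP P M -> repP P M' -> (M :=: M')%MS.
Proof. by move=> [_ H] [_ H']; apply/eqmxP/rV_eqP => v; rewrite -H -H'. Qed.

Lemma plucker_rep (P : G36 k) M : repP P M ->
  exists2 c, c != 0 & forall s, plucker P s = c * \det (colsub s M).
Proof.
move=> HP; have [C uC MbE] := eqmx_unit (repP_same HP (Mb_rep P)) HP.1.
exists (\det C) => [|s]; first by rewrite -unitfE -unitmxE.
rewrite -det_mulmx /plucker; congr (\det _); apply/matrixP => i j.
have /matrixP/(_ i (s j)) := MbE; rewrite !mxE => ->.
by apply: eq_bigr => r _; rewrite mxE.
Qed.

Lemma repL_uniq (L L' : P1 k) l : repL L l -> repL L' l -> L = L'.
Proof.
move=> [c c0 E] [c' c0' E']; apply/val_inj.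
have line (N : P1 k) : val N = <[(vbasis (val N))`_0]>%VS.
  have dN : \dim (val N) = 1%N := eqP (valP N).
  apply/esym/eqP; rewrite eqEdim; apply/andP; split.
    by apply: vbasis_mem; rewrite mem_nth // size_tuple dN.
  rewrite dim_vline (basis_not0 (vbasisP (val N))) ?dN //.
  by rewrite mem_nth // size_tuple dN.
have vE : (vbasis (val L))`_0 = (c / c') *: (vbasis (val L'))`_0.
  by apply/rowP => i; rewrite mxE -!/(hcoord _ _) E E' mulrA divfK.
rewrite (line L) (line L') vE; apply/eqP; rewrite eqEdim; apply/andP; split.
  by rewrite -memvE memvZ ?memv_line.
by rewrite !dim_vline scaler_eq0 mulf_eq0 invr_eq0 (negPf c0) (negPf c0').
Qed.

Definition geval (g : bipoly k) (l : 'I_2 -> k) (M : 'M[k]_(3, 6)) :=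
  (g.@[fun i => (l i)%:MP]).@[fun s : 'I_nplucker =>
    \det (colsub (enum_val s : {ffun 'I_3 -> 'I_6}) M)].

Lemma bieval_rep L P l M : repL L l -> repP P M -> exists c1 c2,
  [/\ c1 != 0, c2 != 0 & forall d e g, bihomog d e g ->
     bieval g (L, P) = c1 ^+ d * c2 ^+ e * geval g l M].
Proof.
move=> [c1 c10 HL] /plucker_rep [c2 c20 HP]; exists c1, c2; split=> // d e g [gd ge].
rewrite /bieval /geval /=.
have -> : (fun i => (hcoord L i)%:MP) = (fun i => c1%:MP * (l i)%:MP) :> ('I_2 -> {mpoly k[nplucker]}).
  by apply: funext => i; rewrite HL mpolyCM.
rewrite (meval_dhomog _ _ gd) mevalM -mulrA; congr (_ * _).
  by rewrite -rmorphXn mevalC.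
have -> : (fun s : 'I_nplucker => plucker P (enum_val s)) =
    (fun s : 'I_nplucker => c2 * \det (colsub (enum_val s : {ffun 'I_3 -> 'I_6}) M)) by apply/funext => s; rewrite HP.
apply: meval_dhomog; rewrite mevalE rpred_sum // => m _.
have -> : \prod_(i < 2) (l i)%:MP ^+ m i = (\prod_(i < 2) l i ^+ m i)%:MP :> {mpoly k[nplucker]}.
  by rewrite rmorph_prod; apply: eq_bigr => i _; rewrite rmorphXn.
by rewrite mulrC mul_mpolyC dhomogZ.
Qed.

Lemma geval_subalg (X : Type) (A : (X -> k) -> Prop) g (l : X -> 'I_2 -> k)
    (M : X -> 'M[k]_(3, 6)) : subalg A -> (forall i, A (fun x => l x i)) ->
  (forall i j, A (fun x => M x i j)) -> A (fun x => geval g (l x) (M x)).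
Proof.
move=> sA Al AM; rewrite /geval.
under eq_fun do rewrite (mevalE _ g) raddf_sum /=.
apply: subalg_sum => // m _.
under eq_fun do rewrite mevalM rmorph_prod /=.
apply: subalg_mul => //; last first.
  apply: subalg_prod => // i _; under eq_fun do rewrite rmorphXn /= mevalC.
  exact: subalg_exp.
under eq_fun do rewrite mevalE; apply: subalg_sum => // m' _.
apply: subalg_mul => //; first exact: subalg_cst.
apply: subalg_prod => // i _; apply: subalg_exp => //.
apply: subalg_det => // r s; under eq_fun do rewrite mxE; exact: AM.
Qed.

End Representatives.

Section RegularFunctions.
Variables (k : closedFieldType) (q1 q2 : {mpoly k[6]}) (U : set (P1 k)).

(* A regular function along a family of planes of the pencil, in terms of     *)
(* chosen homogeneous coordinates and bases.                                  *)
Lemma regular_local (f : Zover q1 q2 U -> k^o) : regular f ->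
  forall (z : Zover q1 q2 U) l M, repL (val z).1 l -> repP (val z).2 M ->
  exists G H : ('I_2 -> k) -> 'M[k]_(3, 6) -> k,
  [/\ forall (X : Type) (A : (X -> k) -> Prop) lx (Mx : X -> 'M_(3, 6)), subalg A ->
        (forall i, A (fun x => lx x i)) -> (forall i j, A (fun x => Mx x i j)) ->
        A (fun x => G (lx x) (Mx x)) /\ A (fun x => H (lx x) (Mx x)),
      H l M != 0 &
      forall (w : Zover q1 q2 U) l' M', repL (val w).1 l' -> repP (val w).2 M' ->
        H l' M' != 0 -> f w = G l' M' / H l' M'].
Proof.
move=> rf z l M zl zM; have [d [e [g [h [Hg Hh hz E]]]]] := rf z.
exists (geval g), (geval h); split=> [X A lx Mx sA Al AM||w l' M' wl wM hw].
- by split; apply: geval_subalg.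
- have [c1 [c2 [c10 c20 /(_ _ _ _ Hh)]]] := bieval_rep zl zM.
  by rewrite -surjective_pairing; apply: contra_eq_neq => ->; rewrite mulr0 .
have [c1 [c2 [c10 c20 B]]] := bieval_rep wl wM.
have Bg := B _ _ _ Hg; have Bh := B _ _ _ Hh.
rewrite -surjective_pairing in Bg; rewrite -surjective_pairing in Bh.
have cc : c1 ^+ d * c2 ^+ e != 0 by rewrite mulf_neq0 ?expf_neq0.
rewrite E; last by rewrite Bh mulf_neq0.
by rewrite Bg Bh invfM mulrACA divff // mul1r.
Qed.

End RegularFunctions.

(** A Cauchy-Binet formula obtained by multilinearity in the columns of the product. Summing over
    all maps, not only increasing ones, matches the indexing of [plucker]. *)
Lemma det_mulmx_colsub (R : comNzRingType) n p (N : 'M[R]_(n, p)) (E : 'M[R]_(p, n)) :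
  \det (N *m E) =
  \sum_(s : {ffun 'I_n -> 'I_p}) (\prod_i E (s i) i) * \det (colsub s N).
Proof.
rewrite -det_tr {1}/determinant.
under eq_bigr => s _.
  rewrite (eq_bigr (fun i => \sum_t N (s i) t * E t i)); last first.
    by move=> i _; rewrite !mxE.
  rewrite bigA_distr_bigA mulr_sumr.
  over.
rewrite exchange_big; apply: eq_bigr => f _ /=.
rewrite -[\det (colsub _ _)]det_tr /determinant mulr_sumr; apply: eq_bigr => s _.
rewrite big_split /= mulrA mulrC; congr (_ * (_ * _)).
by apply: eq_bigr => i _; rewrite !mxE.
Qed.

(** Cramer's rule. It turns the numerator of lam into determinants that are linear in the Pluecker
    coordinates. *)
Lemma adj_mulmx_diag (R : comNzRingType) n (A B : 'M[R]_n) i :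
  (\adj A *m B) i i = \det (\matrix_(r, s) if s == i then B r i else A r s).
Proof.
rewrite (expand_det_col _ i) !mxE; apply: eq_bigr => r _.
rewrite !mxE eqxx mulrC; congr (_ * _); rewrite /cofactor; congr (_ * \det _).
by apply/matrixP => a b; rewrite !mxE eq_sym (negPf (neq_lift _ _)).
Qed.

Lemma dhomogXU n (R : nzRingType) (i : 'I_n) : ('X_i : {mpoly R[n]}) \is 1.-homog.
Proof. by rewrite dhomogX; apply/eqP; exact: mdeg1. Qed.

Lemma meval_sum n (R : comNzRingType) (v : 'I_n -> R) (I : Type) (r : seq I)
    (P : pred I) (F : I -> {mpoly R[n]}) :
  (\sum_(i <- r | P i) F i).@[v] = \sum_(i <- r | P i) (F i).@[v].
Proof. exact: raddf_sum. Qed.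

(** * The affine charts of the pencil and regular functions over them *)

Section Charts.
Variable k : closedFieldType.
Variables (q1 q2 : {mpoly k[6]}) (j : bool).

(** Homogeneous coordinates of the point with chart coordinate T: (T, 1) for j true, (1, T) for j
    false. *)
Definition lc (T : k) (i : 'I_2) := if (i == 0) == j then T else 1.
Definition num_idx : 'I_2 := if j then 0 else 1.
Definition den_idx : 'I_2 := if j then 1 else 0.
Definition tau (L : P1 k) := hcoord L num_idx / hcoord L den_idx.

Lemma repL_lc (L : P1 k) : hcoord L den_idx != 0 -> repL L (lc (tau L)).
Proof.
move=> h0; exists (hcoord L den_idx) => // i.
rewrite /lc /tau; move: h0; rewrite /num_idx /den_idx.
case: i => [[|[|i]]] //= Hi; case: j => //= h0; rewrite ?mulr1 ?[_ * (_ / _)]mulrC ?divfK //;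
  by congr hcoord; apply: val_inj.
Qed.

Lemma exists_tau T : exists L : P1 k,
  [/\ hcoord L den_idx != 0, tau L = T & repL L (lc T)].
Proof.
have [L HL] : exists L : P1 k, repL L (lc T).
  by apply: exists_P1; rewrite /lc; case: j; [right|left]; rewrite oner_neq0.
have [c c0 E] := HL; exists L; split=> //; rewrite /tau /num_idx /den_idx !E /lc.
  by case: j; rewrite mulr1.
by case: j => /=; rewrite mulr1 mulrAC divff ?mul1r.
Qed.

Definition pluecker_sum (C : {ffun 'I_3 -> 'I_6} -> {poly k}) (T : k) (P : G36 k) :=
  \sum_s (C s).[T] * plucker P s.

Definition homogenize (C : {ffun 'I_3 -> 'I_6} -> {poly k}) D : bipoly k :=
  \sum_s \sum_(m < D.+1) ((C s)`_m *: 'X_(enum_rank s)) *: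
     ('X_num_idx ^+ m * 'X_den_idx ^+ (D - m)).

Lemma homogenize_bihomog C D : bihomog D 1 (homogenize C D).
Proof.
split=> [|m'].
  rewrite rpred_sum // => s _; rewrite rpred_sum // => m _; rewrite dhomogZ //.
  rewrite -[X in X.-homog](@subnKC m) -1?ltnS // dhomogM //.
    by rewrite -[X in X.-homog]mul1n dhomogMn // dhomogXU.
  by rewrite -[X in X.-homog]mul1n dhomogMn // dhomogXU.
rewrite raddf_sum rpred_sum // => s _; rewrite raddf_sum rpred_sum // => m _ /=.
rewrite !mpolyXn -mpolyXD mcoeffZ mcoeffX mulr_natr rpredMn //.
by rewrite dhomogZ // dhomogXU.
Qed.

Lemma bieval_homogenize (C : {ffun _ -> _} -> {poly k}) D L P : (forall s, (size (C s) <= D.+1)%N) ->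
  hcoord L den_idx != 0 ->
  bieval (homogenize C D) (L, P) = hcoord L den_idx ^+ D * pluecker_sum C (tau L) P.
Proof.
move=> sC h0; pose hc m := hcoord L num_idx ^+ m * hcoord L den_idx ^+ (D - m).
have inner : (homogenize C D).@[fun i => (hcoord L i)%:MP] =
    \sum_s \sum_(m < D.+1) ((C s)`_m * hc m) *: 'X_(enum_rank s).
  rewrite /homogenize meval_sum; apply: eq_bigr => s _.
  rewrite meval_sum; apply: eq_bigr => m _.
  rewrite mevalZ mevalM !rmorphXn /= !mevalXU -!rmorphXn -rmorphM mulrC mul_mpolyC.
  by rewrite scalerA mulrC.
rewrite /bieval inner meval_sum mulr_sumr; apply: eq_bigr => s _.
rewrite meval_sum (horner_coef_wide _ (sC s)) mulr_suml mulr_sumr.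
apply: eq_bigr => m _; rewrite mevalZ mevalXU enum_rankK /hc /tau exprMn exprVn.
have mD : (m <= D)%N by rewrite -ltnS.
have -> : hcoord L den_idx ^+ D = hcoord L den_idx ^+ (D - m) * hcoord L den_idx ^+ m.
  by rewrite -exprD subnK.
have hm0 : hcoord L den_idx ^+ m != 0 by rewrite expf_neq0.
by move: (_ ^+ m) hm0 => x x0 /=; field.
Qed.

Lemma regular_ratio (U : set (P1 k)) (F : Zover q1 q2 U -> k^o) :
  (forall L, U L -> hcoord L den_idx != 0) ->
  (forall w0 : Zover q1 q2 U, exists C C' : {ffun 'I_3 -> 'I_6} -> {poly k},
    pluecker_sum C' (tau (val w0).1) (val w0).2 != 0 /\
    forall w : Zover q1 q2 U, pluecker_sum C' (tau (val w).1) (val w).2 != 0 ->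
      F w = pluecker_sum C (tau (val w).1) (val w).2 /
            pluecker_sum C' (tau (val w).1) (val w).2) -> regular F.
Proof.
move=> Uh loc w0; have [C [C' [C0 E]]] := loc w0.
pose D := \max_s maxn (size (C s)) (size (C' s)).
have sD s : (maxn (size (C s)) (size (C' s)) <= D.+1)%N.
  by apply: leqW; exact: (@leq_bigmax _ (fun s => maxn (size (C s)) (size (C' s)))).
have sC s : (size (C s) <= D.+1)%N by apply: leq_trans (sD s); rewrite leq_maxl.
have sC' s : (size (C' s) <= D.+1)%N by apply: leq_trans (sD s); rewrite leq_maxr.
have hw (w : Zover q1 q2 U) : hcoord (val w).1 den_idx != 0.
  by apply: Uh; case: w => [w /= /set_mem [_]].
exists D, 1%N, (homogenize C D), (homogenize C' D); split.
- exact: homogenize_bihomog.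
- exact: homogenize_bihomog.
- by rewrite [val w0]surjective_pairing bieval_homogenize // mulf_neq0 // expf_neq0.
move=> w; rewrite [val w]surjective_pairing !bieval_homogenize // mulf_eq0 negb_or.
move=> /andP[hD Cw]; rewrite E //.
by rewrite invfM mulrACA divff // mul1r.
Qed.

Lemma plucker_neq0 (P : G36 k) : exists s, plucker P s != 0.
Proof.
have [rM _] := Mb_rep P; have [E ME] := row_freeP rM.
apply: contrapT => H; have := oner_neq0 k; rewrite -(det1 k 3) -ME det_mulmx_colsub.
rewrite big1 ?eqxx // => s _; suff -> : \det (colsub s (Mb P)) = 0 by rewrite mulr0.
apply: contrapT => /eqP ds; apply: H; exists s; apply: contra_neq ds => ps.
by rewrite -[RHS]ps /plucker; congr (\det _); apply/matrixP => a b; rewrite !mxE.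
Qed.

Lemma regular_tau (U : set (P1 k)) (p d : {poly k}) :
  (forall L, U L -> hcoord L den_idx != 0 /\ d.[tau L] != 0) ->
  regular (fun w : Zover q1 q2 U => p.[tau (val w).1] / d.[tau (val w).1] : k^o).
Proof.
move=> Uh; apply: regular_ratio => [L /Uh [] //|w0].
have [s ps] := plucker_neq0 (val w0).2.
(* A function of the base is written as a quotient of forms linear in the Pluecker coordinates by
   multiplying numerator and denominator by one coordinate that is nonzero at the given point. *)
exists (fun s' => if s' == s then p else 0), (fun s' => if s' == s then d else 0).
have ev (r : {poly k}) T P :
    pluecker_sum (fun s' => if s' == s then r else 0) T P = r.[T] * plucker P s.
  rewrite /pluecker_sum (bigD1 s) //= eqxx big1 ?addr0 // => t /negPf ->.
  by rewrite horner0 mul0r.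
have dw (w : Zover q1 q2 U) : d.[tau (val w).1] != 0.
  by have [] := Uh (val w).1; case: w => [w /= /set_mem [_]].
split=> [|w]; rewrite !ev; first by rewrite mulf_neq0.
by rewrite mulf_eq0 negb_or => /andP[_ psw]; rewrite invfM mulrACA divff // mulr1.
Qed.

End Charts.

(** * Quadratic extensions of algebras of functions *)

Section QuadraticExtension.
Variables (k : closedFieldType) (X : Type).
Implicit Types (S : (X -> k) -> Prop) (f z n w : X -> k).

Definition adjoin S z f := exists a b, [/\ S a, S b & forall x, f x = a x + b x * z x].

Lemma adjoin_sub S z f : subalg S -> S f -> adjoin S z f.
Proof.
move=> sS Sf; exists f, (fun=> 0); split=> // [|x]; first exact: subalg_cst.
by rewrite mul0r addr0.
Qed.

Lemma adjoin_gen S z : subalg S -> adjoin S z z.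
Proof.
move=> sS; exists (fun=> 0), (fun=> 1); split=> [||x]; try exact: subalg_cst.
by rewrite mul1r add0r.
Qed.

Lemma adjoin_subalg S z n w : subalg S -> S n -> S w ->
  (forall x, z x ^+ 2 + n x * z x = w x) -> subalg (adjoin S z).
Proof.
move=> sS Sn Sw E; split=> [c|f f' [a [b [Sa Sb fE]]] [a' [b' [Sa' Sb' fE']]]|
    f f' [a [b [Sa Sb fE]]] [a' [b' [Sa' Sb' fE']]]].
- by apply: adjoin_sub => //; apply: subalg_cst.
- exists (fun x => a x + a' x), (fun x => b x + b' x); split=> [||x].
  + exact: subalg_add.
  + exact: subalg_add.
  + by rewrite fE fE'; ring.
exists (fun x => a x * a' x + b x * b' x * w x).
exists (fun x => a x * b' x + b x * a' x + - (b x * b' x * n x)); split=> [||x].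
- by apply: subalg_add => //; do ?[apply: subalg_mul => //].
- apply: subalg_add => //; last by apply: subalg_opp => //; do ?[apply: subalg_mul => //].
  by apply: subalg_add => //; apply: subalg_mul.
- by rewrite fE fE' -E; ring.
Qed.

(* The norm from S[z] to S, the conjugation being induced by i.               *)
Lemma denominator_descent S (N : (X -> k) -> Prop) z n w (i : X -> X) f :
  2%N \in [pchar k] -> subalg S -> S n -> S w ->
  (forall x, z x ^+ 2 + n x * z x = w x) ->
  (forall x, z (i x) = z x + n x) -> (forall a x, S a -> a (i x) = a x) ->
  (forall a b, N a -> N b -> N (fun x => a x + b x)) ->
  (forall a b, adjoin S z a -> N b -> N (fun x => a x * b x)) ->
  (forall x, exists h, [/\ adjoin S z h, h x != 0 & N (fun y => h y * f y)]) ->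
  forall x, exists h, [/\ S h, h x != 0 & N (fun y => h y * f y)].
Proof.
move=> char2 sS Sn Sw E iz iS ND NM loc x.
have sSz := adjoin_subalg sS Sn Sw E.
(* The norm of h is h(x) h(i x), so h must be nonzero at both points. If neither of the denominators
   found at x and at i x is, their sum is. *)
have [h [Sh hx hix Nh]] : exists h,
    [/\ adjoin S z h, h x != 0, h (i x) != 0 & N (fun y => h y * f y)].
  have [h1 [S1 h1x N1]] := loc x; have [h2 [S2 h2x N2]] := loc (i x).
  have [E1|h1i] := eqVneq (h1 (i x)) 0; last by exists h1.
  have [E2|h2i] := eqVneq (h2 x) 0; last by exists h2.
  exists (fun y => h1 y + h2 y); split.
  - exact: subalg_add.
  - by rewrite E2 addr0.
  - by rewrite E1 add0r.
  - by under eq_fun do rewrite mulrDl; apply: ND.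
have [a [b [Sa Sb hE]]] := Sh.
have ziE y : z (i (i y)) = z y.
  by rewrite !iz (iS _ _ Sn) -addrA addrr_pchar2 // addr0.
have hiE y : h (i y) = a y + b y * (z y + n y) by rewrite hE iz !iS.
exists (fun y => a y ^+ 2 + a y * b y * n y + b y ^+ 2 * w y); split.
- apply: subalg_add => //; last by apply: subalg_mul => //; apply: subalg_exp.
  by apply: subalg_add => //; [apply: subalg_exp|do ?[apply: subalg_mul => //]].
- have two0 : 2%:R = 0 :> k by exact: pcharf0.
  suff -> : a x ^+ 2 + a x * b x * n x + b x ^+ 2 * w x = h (i x) * h x.
    by rewrite mulf_neq0.
  by rewrite hiE hE -E; ring2 two0.
have -> : (fun y => (a y ^+ 2 + a y * b y * n y + b y ^+ 2 * w y) * f y) =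
    (fun y => (a y + b y * n y + b y * z y) * (h y * f y)).
  apply: funext => y; have two0 : 2%:R = 0 :> k by exact: pcharf0.
  by rewrite hE -E; ring2 two0.
apply: NM => //; exists (fun y => a y + b y * n y), b; split=> //.
by apply: subalg_add => //; apply: subalg_mul.
Qed.

End QuadraticExtension.

(** * Functions on the isotropic planes over a chart *)

Section LocalStructure.
Variable k : closedFieldType.
Hypothesis char2 : 2%N \in [pchar k].
Let two0 : 2%:R = 0 :> k. Proof. exact: pcharf0. Qed.

Variables (q1 q2 : {mpoly k[6]}) (j : bool).
Variables (n u v : 'I_3 -> {poly k}) (g gi : 'M[{poly k}]_6) (kap : {poly k}).

Definition pev (p : 'I_3 -> {poly k}) (T : k) i := (p i).[T].
Definition mev m p (A : 'M[{poly k}]_(m, p)) (T : k) := map_mx (horner_eval T) A.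

Hypothesis ggi : g *m gi = 1%:M.
Hypothesis qE : forall T (w : 'rV[k]_6),
  lc j T 0 * q1.@[(w *m mev g T) 0] + lc j T 1 * q2.@[(w *m mev g T) 0] =
  dq (pev n T) (pev u T) (pev v T) w.
Hypothesis mildT : forall T, exists l, mild (pev n T) (pev u T) (pev v T) l.
Hypothesis B0 : \prod_i n i != 0.

Variables (U : set (P1 k)) (d : {poly k}).
Hypothesis d0 : d != 0.
Hypothesis UE : forall L, U L <-> hcoord L (den_idx j) != 0 /\ d.[tau j L] != 0.

Local Notation isoT T := (iso (pev n T) (pev u T) (pev v T)).
Local Notation lamT T := (lam (pev n T) (pev u T) (pev v T)).
Local Notation Zp := (Zover q1 q2 U).

Lemma mev_mul m p q (A : 'M_(m, p)) (C : 'M_(p, q)) T :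
  mev (A *m C) T = mev A T *m mev C T.
Proof. exact: map_mxM. Qed.

Lemma mev_ggi T : mev g T *m mev gi T = 1%:M.
Proof. by rewrite -mev_mul ggi /mev map_mx1. Qed.

Lemma mev_gig T : mev gi T *m mev g T = 1%:M.
Proof. exact: mulmx1C (mev_ggi T). Qed.

Lemma mev_row_free m (M : 'M_(m, 6)) T : row_free M -> row_free (M *m mev g T).
Proof.
move=> rM; apply: mx_row_free => x; rewrite mulmxA => E; apply: (row_free_inj0 rM).
by rewrite -[x *m M]mulmx1 -(mev_ggi T) mulmxA E mul0mx.
Qed.

Definition tz (w : Zp) := tau j (val w).1.

Lemma Zp_U (w : Zp) : U (val w).1.
Proof. by case: w => [w /= /set_mem [_]]. Qed.

Lemma tz_d (w : Zp) : d.[tz w] != 0.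
Proof. by have [/(_ (Zp_U w)) []] := UE (val w).1. Qed.

Lemma repL_tz (w : Zp) : repL (val w).1 (lc j (tz w)).
Proof. by apply: repL_lc; have [/(_ (Zp_U w)) []] := UE (val w).1. Qed.

Definition coordM (w : Zp) := Mb (val w).2 *m mev gi (tz w).

Lemma coordM_rep (w : Zp) : repP (val w).2 (coordM w *m mev g (tz w)).
Proof. by rewrite -mulmxA mev_gig mulmx1; apply: Mb_rep. Qed.

Lemma pencilE (L : P1 k) T (x : 'rV[k]_6) : repL L (lc j T) -> exists2 c, c != 0 &
  (pencil q1 q2 L).@[(x *m mev g T) 0] =
  c * dq (pev n T) (pev u T) (pev v T) x.
Proof.
by move=> [c c0 E]; exists c => //; rewrite -qE /pencil mevalD !mevalZ !E; ring.
Qed.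

Lemma coordM_iso (w : Zp) M : repP (val w).2 (M *m mev g (tz w)) -> isoT (tz w) M.
Proof.
move=> [_ HM] x /submxP [y xE].
have zx : x *m mev g (tz w) \in val (val w).2 by rewrite HM xE -mulmxA submxMl.
have [c c0 E] := pencilE x (repL_tz w).
have wZ : Z q1 q2 (val w) by case: {E c0 zx xE HM} w => [w /= /set_mem []].
have := wZ _ zx; rewrite E => /eqP; rewrite mulf_eq0 (negPf c0) /=.
by move/eqP.
Qed.

Lemma row_free_coordM (w : Zp) : row_free (coordM w).
Proof.
apply: mx_row_free => x xM; have [rM _] := coordM_rep w.
by apply: (row_free_inj0 rM); rewrite mulmxA xM mul0mx.
Qed.

Lemma exists_point T M : d.[T] != 0 -> isoT T M -> row_free M ->
  exists w : Zp, tz w = T /\ repP (val w).2 (M *m mev g T).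
Proof.
move=> dT isoM rM; have [L [hL tL LT]] := exists_tau j T.
have [P HP] := exists_G36 (mev_row_free T rM).
have wZ : (L, P) \in Zover q1 q2 U.
  apply/mem_set; split; last by apply/UE; rewrite tL.
  move=> x; rewrite /= HP.2 => /submxP [y xE].
  have [c _ E] := pencilE (y *m M) LT; rewrite xE mulmxA E isoM ?mulr0 //.
  exact: submxMl.
by exists (exist (fun z => is_true (z \in Zover q1 q2 U)) _ wZ).
Qed.

Lemma point_uniq (w w' : Zp) M : tz w = tz w' ->
  repP (val w).2 M -> repP (val w').2 M -> w = w'.
Proof.
move=> tE Hw Hw'; apply: val_inj; rewrite [LHS]surjective_pairing [RHS]surjective_pairing.
congr (_, _); last exact: repP_uniq Hw Hw'.
by apply: (@repL_uniq _ _ _ (lc j (tz w))); [|rewrite tE]; apply: repL_tz.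
Qed.

(** The function f read on planes in the diagonalizing coordinates. The value 0 occurs only by
    default where (T, M) does not come from a point of Z over U. *)
Definition at_pt (f : Zp -> k^o) T M : k :=
  if pselect (exists w : Zp, tz w = T /\ repP (val w).2 (M *m mev g T)) is left e
  then f (projT1 (cid e)) else 0.

Lemma at_ptE f (w : Zp) T M : tz w = T -> repP (val w).2 (M *m mev g T) ->
  at_pt f T M = f w.
Proof.
move=> tE HM; rewrite /at_pt; case: pselect => [e|[]]; last by exists w.
have [tE' HM'] := projT2 (cid e); congr f.
by apply: point_uniq HM' HM; rewrite tE tE'.
Qed.

Lemma at_pt_eqmx f T M M' : d.[T] != 0 -> isoT T M -> row_free M ->
  (M :=: M')%MS -> at_pt f T M = at_pt f T M'.
Proof.
move=> dT isoM rM E; have [w [tw wM]] := exists_point dT isoM rM.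
rewrite (at_ptE f tw wM) (@at_ptE _ w) //; apply: (repP_eqmx wM).
  by apply: mev_row_free; rewrite /row_free -E.
exact: eqmxMr.
Qed.

Lemma at_pt_rational f T : regular f -> d.[T] != 0 ->
  locally_rational (pev n T) (pev u T) (pev v T) (at_pt f T).
Proof.
move=> rf dT M0 iso0 rf0; have [w [tw wM]] := exists_point dT iso0 rf0.
have := regular_local rf (repL_tz w) wM; rewrite tw => -[G [H [GH H0 E]]].
exists (fun M => G (lc j T) (M *m mev g T)), (fun M => H (lc j T) (M *m mev g T)).
split=> // [N pN|M isoM rM HM].
  apply: (GH _ (fun f : k -> k => exists p : {poly k}, forall s, f s = p.[s])
    (fun=> lc j T) (fun s => N s *m mev g T)).
  - exact: subalg_poly.
  - by move=> i; exists (lc j T i)%:P => s; rewrite hornerC.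
  apply: (subalg_mulmx (subalg_poly k) (M := N) (N := fun=> mev g T)) => //.
  by move=> a b; exists (mev g T a b)%:P => s; rewrite hornerC.
have [w' [tw' w'M]] := exists_point dT isoM rM.
by rewrite (at_ptE f tw' w'M) (E w' (lc j T) (M *m mev g T)) // -tw'; exact: repL_tz.
Qed.

Lemma at_pt_const f T M M' : regular f -> d.[T] != 0 -> isoT T M -> isoT T M' ->
  row_free M -> row_free M' -> \rank (M :&: M')%MS = 1%N ->
  at_pt f T M = at_pt f T M'.
Proof.
move=> rf dT isoM isoM' rM rM' r1; have [l ml] := mildT T.
apply: (rational_const char2 ml (at_pt_rational rf dT)) => //.
by move=> N N' isoN rN; apply: at_pt_eqmx.
Qed.

Definition lamZ (w : Zp) : k^o := lamT (tz w) (coordM w) + kap.[tz w].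

Lemma lamZE (w : Zp) T M : tz w = T -> repP (val w).2 (M *m mev g T) ->
  lamZ w = lamT T M + kap.[T].
Proof.
move=> <- wM; rewrite /lamZ; congr (_ + _); have [l ml] := mildT (tz w).
have rM : row_free M.
  apply: mx_row_free => x xM; apply: (row_free_inj0 wM.1).
  by rewrite mulmxA xM mul0mx.
apply: (lam_eqmx char2 ml); last exact: row_free_coordM.
  have E := repP_same (coordM_rep w) wM.
  have K m (A : 'M[k]_(m, 6)) : A *m mev g (tz w) *m mev gi (tz w) = A.
    by rewrite -mulmxA mev_ggi mulmx1.
  by rewrite -[coordM w]K -[M]K; apply: eqmxMr.
exact: coordM_iso (coordM_rep w).
Qed.

(** The last two terms of [PA] are the effect of the translation z -> z + kap on the Arf
    equation. *)
Definition PB : {poly k} := \prod_i n i.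
Definition PA : {poly k} :=
  \sum_i u i * v i * (\prod_(t | t != i) n t) ^+ 2 + kap ^+ 2 + PB * kap.

Lemma PB_ev T : PB.[T] = arfB (pev n T).
Proof. exact: horner_prod. Qed.

Lemma lamZ_quadratic w : lamZ w ^+ 2 + PB.[tz w] * lamZ w = PA.[tz w].
Proof.
have [l ml] := mildT (tz w).
have := lam_quadratic char2 ml (coordM_iso (coordM_rep w)) (row_free_coordM w).
rewrite -PB_ev => Q; rewrite /PA !hornerD horner_exp hornerM horner_sum.
have -> : \sum_i (u i * v i * (\prod_(t | t != i) n t) ^+ 2).[tz w] =
    arfA (pev n (tz w)) (pev u (tz w)) (pev v (tz w)).
  by apply: eq_bigr => i _; rewrite 2!hornerM horner_exp horner_prod.
by rewrite -Q /lamZ; ring2 two0.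
Qed.

Definition vsP (c : 'I_3 -> k) i : {poly k} :=
  v i + n i * (c i)%:P + u i * (c i)%:P ^+ 2.

Lemma vsP_ev c i T : (vsP c i).[T] = vs (pev n T) (pev u T) (pev v T) c i.
Proof. by rewrite /vsP /vs !hornerE. Qed.

Lemma pluckerE (P : G36 k) s : plucker P s = \det (colsub s (Mb P)).
Proof. by rewrite /plucker; congr (\det _); apply/matrixP => a b; rewrite !mxE. Qed.

Lemma det_pluecker_sum (E : 'M[{poly k}]_(6, 3)) T (P : G36 k) :
  \det (Mb P *m mev E T) =
  pluecker_sum (fun s : {ffun 'I_3 -> 'I_6} => \prod_i E (s i) i) T P.
Proof.
rewrite det_mulmx_colsub; apply: eq_bigr => s _; rewrite -pluckerE; congr (_ * _).
by rewrite horner_prod; apply: eq_bigr => i _; rewrite mxE.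
Qed.

Lemma pluecker_sumD C C' T (P : G36 k) :
  pluecker_sum (fun s => C s + C' s) T P = pluecker_sum C T P + pluecker_sum C' T P.
Proof. by rewrite -big_split; apply: eq_bigr => s _; rewrite hornerD mulrDl. Qed.

Lemma pluecker_sumZ p C T (P : G36 k) :
  pluecker_sum (fun s => p * C s) T P = p.[T] * pluecker_sum C T P.
Proof. by rewrite mulr_sumr; apply: eq_bigr => s _; rewrite hornerM mulrA. Qed.

Lemma pluecker_sum_sum (I : finType) (C : I -> _) T (P : G36 k) :
  pluecker_sum (fun s => \sum_i C i s) T P = \sum_i pluecker_sum (C i) T P.
Proof.
rewrite exchange_big; apply: eq_bigr => s _.
by rewrite horner_sum mulr_suml.
Qed.

Definition shear_mx (c : 'I_3 -> k) : 'M[{poly k}]_(6, 3) :=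
  col_mx 1%:M (diag_mx (\row_i (c i)%:P)) : 'M_(3 + 3, 3).

Definition swap_mx (c : 'I_3 -> k) (t : 'I_3) : 'M[{poly k}]_(6, 3) :=
  \matrix_(a, b) if b == t then (col_mx 0 1%:M : 'M[{poly k}]_(3 + 3, 3)) a b
                 else shear_mx c a b.

Lemma mulmx_shear_mx c (M : 'M[k]_(3, 6)) T : M *m mev (shear_mx c) T = shear c M.
Proof.
have -> : mev (shear_mx c) T =
    col_mx 1%:M (diag_mx (\row_i c i)) :> 'M[k]_(3 + 3, 3).
  rewrite [LHS](_ : _ = map_mx (horner_eval T) (col_mx 1%:M (diag_mx (\row_i (c i)%:P)))) //.
  rewrite map_col_mx map_mx1 map_diag_mx; congr (col_mx _ (diag_mx _)).
  by apply/rowP => i; rewrite !mxE; exact: hornerC.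
transitivity ((row_mx (Ax M) (By M) : 'M_(3, 3 + 3)) *m
    col_mx 1%:M (diag_mx (\row_i c i))); first by rewrite -Ax_By.
by rewrite mul_row_col mulmx1.
Qed.

Lemma mulmx_swap_mx c t (M : 'M[k]_(3, 6)) T : M *m mev (swap_mx c t) T =
  \matrix_(r, s) if s == t then By M r t else shear c M r s.
Proof.
rewrite -(mulmx_shear_mx c M T); apply/matrixP => r s; rewrite !mxE.
case: eqP => [->|/eqP/negPf st].
  transitivity ((M *m (col_mx 0 1%:M : 'M[k]_(3 + 3, 3))) r t).
    rewrite mxE; apply: eq_bigr => a _; rewrite [mev _ _ _ _]mxE [swap_mx _ _ _ _]mxE eqxx.
    congr (_ * _); rewrite /horner_eval.
    case: (split_ordP (a : 'I_(3 + 3))) => b ->.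
      rewrite col_mxEu [RHS](_ : _ = (0 : 'M[k]_3) b t); last exact: col_mxEu.
      by rewrite !mxE horner0.
    rewrite col_mxEd [RHS](_ : _ = (1%:M : 'M[k]_3) b t); last exact: col_mxEd.
    by rewrite !mxE; case: (b == t); rewrite ?hornerC ?horner0.
  transitivity (((row_mx (Ax M) (By M) : 'M_(3, 3 + 3)) *m col_mx 0 1%:M) r t).
    by rewrite -Ax_By.
  by rewrite mul_row_col mulmx0 add0r mulmx1 mxE.
by apply: eq_bigr => a _; rewrite !mxE st.
Qed.

(** For a fixed shear, lam is a quotient of sums of determinants of the basis matrix times
    polynomial matrices ([shear_mx] for the denominator, [swap_mx] for the Cramer numerators). By
    [det_pluecker_sum] these are linear in the Pluecker coordinates. *)
Lemma lamZ_regular : regular lamZ.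
Proof.
apply: (@regular_ratio _ _ _ j) => [L /UE [] //|w0].
have [l ml] := mildT (tz w0).
have iso0 := coordM_iso (coordM_rep w0).
have [c c0] := good_shear char2 ml iso0 (row_free_coordM w0).
pose C' (s : {ffun 'I_3 -> 'I_6}) := \prod_i (gi *m shear_mx c) (s i) i.
pose Cs t (s : {ffun 'I_3 -> 'I_6}) := \prod_i (gi *m swap_mx c t) (s i) i.
pose C s := \sum_i \prod_(t | t != i) n t *
  (vsP c i * Cs i s + (c i)%:P * u i * C' s) + kap * C' s.
have dE (w : Zp) : pluecker_sum C' (tz w) (val w).2 = \det (shear c (coordM w)).
  by rewrite -det_pluecker_sum mev_mul mulmxA mulmx_shear_mx.
have sE t (w : Zp) : pluecker_sum (Cs t) (tz w) (val w).2 =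
    (\adj (shear c (coordM w)) *m By (coordM w)) t t.
  by rewrite -det_pluecker_sum mev_mul mulmxA mulmx_swap_mx adj_mulmx_diag.
exists C, C'; rewrite -/(tz w0) dE; split=> // w; rewrite -/(tz w) dE => cw.
have isow := coordM_iso (coordM_rep w).
have -> : pluecker_sum C (tz w) (val w).2 =
    lnum (pev n (tz w)) (pev u (tz w)) (pev v (tz w)) c (coordM w) +
    kap.[tz w] * \det (shear c (coordM w)).
  rewrite -dE /lnum.
  under eq_bigr => i _ do rewrite -sE -dE.
  rewrite /C pluecker_sumD pluecker_sumZ pluecker_sum_sum; congr (_ + _).
  apply: eq_bigr => i _; rewrite pluecker_sumZ pluecker_sumD !pluecker_sumZ.
  by rewrite horner_prod vsP_ev hornerM hornerC.
by rewrite mulrDl mulfK // -lamcE // -lamE.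
Qed.

Lemma quadratic_root (b c : k) : exists z, z ^+ 2 + b * z = c.
Proof.
have [r1 [r2 R]] := quadratic_roots b c; exists r1.
by apply/eqP; rewrite -subr_eq0 R subrr mul0r.
Qed.

(** As a polynomial in c_i, the sheared coefficient has coefficients v_i, n_i, u_i, which do not all
    vanish by mildness. *)
Lemma mild_shear l T : mild (pev n T) (pev u T) (pev v T) l ->
  exists c, forall i, (vsP c i).[T] != 0.
Proof.
move=> ml; suff ex i : exists c, (v i).[T] + (n i).[T] * c + (u i).[T] * c ^+ 2 != 0.
  have /(_ _)/cid-/all_sig [c cE] := ex; exists c => i.
  by rewrite vsP_ev; exact: cE.
pose p := (v i).[T]%:P + (n i).[T] *: 'X + (u i).[T] *: 'X^2.
have [|c pc] := @poly_nonroot _ p; last first.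
  exists c; apply: contraNneq pc => E; rewrite /p !hornerD hornerC !hornerZ hornerX hornerXn.
  by rewrite E.
have coef m : p`_m = [:: (v i).[T]; (n i).[T]; (u i).[T]]`_m.
  rewrite !coefE; case: m => [|[|[|m]]] /=; rewrite ?nth_nil; ring.
apply/eqP => p0; have := ml; rewrite /mild /pev => -[ni nl].
have [vi ni0 ui] : [/\ (v i).[T] = 0, (n i).[T] = 0 & (u i).[T] = 0].
  by split; [have := coef 0%N|have := coef 1%N|have := coef 2%N]; rewrite p0 coef0.
have [il|il] := eqVneq i l; last by have := ni _ il; rewrite ni0 eqxx.
by move: nl; rewrite -il vi ni0 ui eqxx.
Qed.

(* A function of three quadratic irrationalities invariant under conjugating  *)
(* any two of them.                                                           *)
Lemma even_invariant (n1 n2 n3 z1 z2 z3 p0 p1 p2 p3 p4 p5 p6 p7 : k) :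
  n1 != 0 -> n2 != 0 -> n3 != 0 ->
  let F a b c := (p0 + p1 * a + (p2 + p3 * a) * b) +
    ((p4 + p5 * a) + (p6 + p7 * a) * b) * c in
  let P (e f h : bool) := F (z1 + n1 *+ e) (z2 + n2 *+ f) (z3 + n3 *+ h) in
  (forall e f h, P (~~ e) (~~ f) h = P e f h) ->
  (forall e f h, P (~~ e) f (~~ h) = P e f h) ->
  (forall e f h, P e (~~ f) (~~ h) = P e f h) ->
  [/\ p3 = 0, p5 = 0, p6 = 0 & p7 = 0] /\ n1 * p1 = n3 * p4 /\ n2 * p2 = n3 * p4.
Proof.
move=> n10 n20 n30 F P H12 H13 H23.
have sum4 (x y z w : k) : x = y -> z = w -> x + y + (z + w) = 0.
  by move=> -> ->; ring2 two0.
have D12 c (h : bool) : c = z3 + n3 *+ h -> p3 + p7 * c = 0.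
  move=> cE; apply: (mulfI n10); apply: (mulfI n20); rewrite !mulr0.
  rewrite -(sum4 _ _ _ _ (H12 false false h) (H12 false true h)) /P /F -cE.
  by rewrite /= !mulr1n !mulr0n !addr0; ring2 two0.
have p70 : p7 = 0.
  apply: (mulfI n30); rewrite mulr0.
  have E1 := D12 z3 false; have E2 := D12 (z3 + n3) true.
  rewrite -(sum4 _ _ _ _ (E1 _) (E2 _)) ?mulr0n ?mulr1n ?addr0 //.
  by ring2 two0.
have p30 : p3 = 0 by have := D12 z3 false; rewrite p70 mul0r !addr0; apply.
have p50 : p5 = 0.
  apply: (mulfI n10); apply: (mulfI n30); rewrite !mulr0.
  rewrite -(sum4 _ _ _ _ (H13 false false false) (H13 false false true)) /P /F.
  by rewrite /= !mulr1n !mulr0n !addr0 p70; ring2 two0.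
have p60 : p6 = 0.
  apply: (mulfI n20); apply: (mulfI n30); rewrite !mulr0.
  rewrite -(sum4 _ _ _ _ (H23 false false false) (H23 false false true)) /P /F.
  by rewrite /= !mulr1n !mulr0n !addr0 p70; ring2 two0.
have sum2 (x y : k) : x = y -> x + y = 0 by move=> ->; ring2 two0.
split=> //; split; apply: (eq_of_add0 two0).
  rewrite -(sum2 _ _ (H13 false false false)) /P /F p30 p50 p60 p70.
  by rewrite /= !mulr1n !mulr0n !addr0; ring2 two0.
rewrite -(sum2 _ _ (H23 false false false)) /P /F p30 p50 p60 p70.
by rewrite /= !mulr1n !mulr0n !addr0; ring2 two0.
Qed.

Lemma horner_mul_neq0 (p q : {poly k}) T : (p * q).[T] != 0 -> p.[T] != 0 /\ q.[T] != 0.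
Proof. by rewrite hornerM mulf_eq0 negb_or => /andP. Qed.

(** * Regular functions on a multisection by explicit planes *)

Section Multisection.
Variables (c : 'I_3 -> k) (o : {poly k}) (f : Zp -> k^o).
Hypothesis rf : regular f.
Hypothesis od : forall T, o.[T] != 0 -> d.[T] != 0.
Hypothesis ov : forall T, o.[T] != 0 -> forall i, (vsP c i).[T] != 0.

(* The planes Dz c z, for z_i a root of z_i^2 + n_i z_i = u_i vs_i.           *)
Definition msec := {x : k * ('I_3 -> k) | o.[x.1] != 0 /\
  forall i, x.2 i ^+ 2 + (n i).[x.1] * x.2 i = (u i).[x.1] * (vsP c i).[x.1]}.

Implicit Types x : msec.

Definition ms_t x : k := (sval x).1.
Definition ms_z i x : k := (sval x).2 i.
Definition ms_n i x : k := (n i).[ms_t x].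
Definition ms_w i x : k := (u i).[ms_t x] * (vsP c i).[ms_t x].
Definition ms_mx x := Dz (pev n (ms_t x)) (pev u (ms_t x)) (pev v (ms_t x)) c (sval x).2.
Definition ms_f x := at_pt f (ms_t x) (ms_mx x).

Lemma ms_eq i x : ms_z i x ^+ 2 + ms_n i x * ms_z i x = ms_w i x.
Proof. by case: x => [x [ox E]]; apply: E. Qed.

Lemma ms_o x : o.[ms_t x] != 0.
Proof. by case: x => [x []]. Qed.

Lemma ms_root x i : (sval x).2 i ^+ 2 + pev n (ms_t x) i * (sval x).2 i =
  pev u (ms_t x) i * vs (pev n (ms_t x)) (pev u (ms_t x)) (pev v (ms_t x)) c i.
Proof. by rewrite -vsP_ev; exact: ms_eq. Qed.

Lemma ms_iso x : isoT (ms_t x) (ms_mx x).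
Proof. by apply: iso_Dz => // i; apply: ms_root. Qed.

Lemma ms_free x : row_free (ms_mx x).
Proof. by apply: row_free_Dz => // i; rewrite -vsP_ev; apply: ov (ms_o x) i. Qed.

Lemma msec_over T : o.[T] != 0 -> exists x, ms_t x = T.
Proof.
move=> oT; have ex i := quadratic_root (n i).[T] ((u i).[T] * (vsP c i).[T]).
have /(_ _)/cid-/all_sig [z zE] := ex.
have H : o.[(T, z).1] != 0 /\ forall i, (T, z).2 i ^+ 2 + (n i).[(T, z).1] * (T, z).2 i =
  (u i).[(T, z).1] * (vsP c i).[(T, z).1] by [].
by exists (exist _ (T, z) H).
Qed.

Definition flip_z (t : 'I_3) x i := ms_z i x + (if i == t then ms_n i x else 0).

Lemma flip_subproof t x : o.[ms_t x] != 0 /\ forall i,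
  flip_z t x i ^+ 2 + (n i).[ms_t x] * flip_z t x i = (u i).[ms_t x] * (vsP c i).[ms_t x].
Proof.
split=> [|i]; first exact: ms_o.
have := ms_eq i x; rewrite /ms_w /flip_z => <-; rewrite -/(ms_n i x).
by case: ifP => _; ring2 two0.
Qed.

Definition flip t x : msec := exist _ (ms_t x, flip_z t x) (flip_subproof t x).

Lemma flip_t t x : ms_t (flip t x) = ms_t x. Proof. by []. Qed.

Lemma flip_eq t x : ms_z t (flip t x) = ms_z t x + ms_n t x.
Proof. by rewrite {1}/ms_z /= /flip_z eqxx. Qed.

Lemma flip_neq t i x : i != t -> ms_z i (flip t x) = ms_z i x.
Proof. by move=> /negPf it; rewrite {1}/ms_z /= /flip_z it addr0. Qed.

Definition S0 (a : msec -> k) := exists p : {poly k}, forall x, a x = p.[ms_t x].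
Definition S1 := adjoin S0 (ms_z i1).
Definition S2 := adjoin S1 (ms_z i2).
Definition S3 := adjoin S2 (ms_z i3).

Lemma subalg_S0 : subalg S0.
Proof.
split=> [a|a b [p pE] [r rE]|a b [p pE] [r rE]].
- by exists a%:P => x; rewrite hornerC.
- by exists (p + r) => x; rewrite hornerD pE rE.
- by exists (p * r) => x; rewrite hornerM pE rE.
Qed.

Lemma S0_n i : S0 (ms_n i). Proof. by exists (n i). Qed.

Lemma S0_w i : S0 (ms_w i).
Proof. by exists (u i * vsP c i) => x; rewrite hornerM. Qed.

Let S0S1 a : S0 a -> S1 a. Proof. by apply: adjoin_sub; apply: subalg_S0. Qed.

Lemma subalg_S1 : subalg S1.
Proof. by apply: adjoin_subalg (ms_eq i1); [exact: subalg_S0|exact: S0_n|exact: S0_w]. Qed.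

Let S1S2 a : S1 a -> S2 a. Proof. by apply: adjoin_sub; apply: subalg_S1. Qed.

Lemma subalg_S2 : subalg S2.
Proof.
apply: adjoin_subalg (ms_eq i2); first exact: subalg_S1.
- exact/S0S1/S0_n.
- exact/S0S1/S0_w.
Qed.

Let S2S3 a : S2 a -> S3 a. Proof. by apply: adjoin_sub; apply: subalg_S2. Qed.

Lemma subalg_S3 : subalg S3.
Proof.
apply: adjoin_subalg (ms_eq i3); first exact: subalg_S2.
- exact/S1S2/S0S1/S0_n.
- exact/S1S2/S0S1/S0_w.
Qed.

Lemma S3_z i : S3 (ms_z i).
Proof.
apply: (@ord3_ind i1 i2 i3 (fun i => S3 (ms_z i))) => //.
- by apply/S2S3/S1S2; apply: adjoin_gen; apply: subalg_S0.
- by apply/S2S3; apply: adjoin_gen; apply: subalg_S1.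
- by apply: adjoin_gen; apply: subalg_S2.
Qed.

Lemma S3_poly (p : {poly k}) : S3 (fun x => p.[ms_t x]).
Proof. by apply/S2S3/S1S2/S0S1; exists p. Qed.

Lemma S3_mx i i' : S3 (fun x => (ms_mx x *m mev g (ms_t x)) i i').
Proof.
have s3 := subalg_S3.
apply: (subalg_mulmx s3 (M := ms_mx) (N := fun x => mev g (ms_t x))) => a b; last first.
  have -> : (fun x => mev g (ms_t x) a b) = (fun x => (g a b).[ms_t x]).
    by apply: funext => x; rewrite mxE.
  exact: S3_poly.
have diag (F : msec -> 'I_3 -> k) (r s : 'I_3) : (forall t, S3 (F^~ t)) ->
    S3 (fun x => diag_mx (\row_t F x t) r s).
  move=> SF; under eq_fun do rewrite !mxE; case: (r == s).
    by under eq_fun do rewrite mulr1n; exact: SF.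
  by under eq_fun do rewrite mulr0n; apply: subalg_cst.
case: (split_ordP (b : 'I_(3 + 3))) => b' ->.
  have -> : (fun x => ms_mx x a (lshift 3 b')) = (fun x => diag_mx
      (\row_t ((vsP c t).[ms_t x] + c t * ms_z t x)) a b').
    apply: funext => x; apply: etrans (row_mxEl _ _ _ _) _.
    by congr (diag_mx _ _ _); apply/rowP => t; rewrite !mxE vsP_ev.
  apply: diag => t; apply: subalg_add => //; first exact: S3_poly.
  by apply: subalg_mul => //; [exact: subalg_cst|exact: S3_z].
have -> : (fun x => ms_mx x a (rshift 3 b')) = (fun x => diag_mx (\row_t ms_z t x) a b').
  by apply: funext => x; apply: etrans (row_mxEr _ _ _ _) _.
by apply: diag => t; apply: S3_z.
Qed.

Lemma ms_local x : exists h, [/\ S3 h, h x != 0 & S3 (fun y => h y * ms_f y)].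
Proof.
have pt y := exists_point (od (ms_o y)) (@ms_iso y) (ms_free y).
have [w [tw wM]] := pt x.
have [G [H [GH H0 E]]] := regular_local rf (repL_tz w) wM.
have [||SG SH] := GH _ S3 (fun y => lc j (ms_t y)) (fun y => ms_mx y *m mev g (ms_t y)) subalg_S3.
- move=> i; rewrite /lc; case: (_ == _); last exact: subalg_cst subalg_S3 _.
  have -> : ms_t = (fun y => 'X.[ms_t y]) by apply: funext => y; rewrite hornerX.
  exact: S3_poly.
- exact: S3_mx.
(* The local expression says nothing about f where this h vanishes, so its square is taken as
   denominator; both sides are then 0 there. *)
pose h y := H (lc j (ms_t y)) (ms_mx y *m mev g (ms_t y)).
exists (fun y => h y * h y); split.
- exact: (@subalg_mul _ _ S3 subalg_S3 h h SH SH).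
- by have hx : h x != 0 by [rewrite /h -{1}tw]; rewrite mulf_neq0.
have -> : (fun y => h y * h y * ms_f y) =
    (fun y => h y * G (lc j (ms_t y)) (ms_mx y *m mev g (ms_t y))).
  apply: funext => y; have [->|hy] := eqVneq (h y) 0; first by rewrite !mul0r.
  have [w' [tw' wM']] := pt y.
  have L' : repL (val w').1 (lc j (ms_t y)) by rewrite -tw'; exact: repL_tz.
  rewrite /ms_f (at_ptE f tw' wM') (E _ _ _ L' wM') // -mulrA; congr (_ * _).
  by rewrite mulrC divfK.
exact: (@subalg_mul _ _ S3 subalg_S3 h _ SH SG).
Qed.

(** Three norms remove z_3, z_2 and z_1 in turn from the denominator, leaving a polynomial in t. *)
Lemma ms_global x : exists h : {poly k}, h.[ms_t x] != 0 /\
  S3 (fun y => h.[ms_t y] * ms_f y).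
Proof.
have N3 a b : S3 a -> S3 b -> S3 (fun y => a y + b y) by exact: (@subalg_add _ _ S3 subalg_S3).
have M3 a b : S3 a -> S3 b -> S3 (fun y => a y * b y) by exact: (@subalg_mul _ _ S3 subalg_S3).
have i0 t a y : S0 a -> a (flip t y) = a y by case=> p pE; rewrite !pE.
have i1' t a y : t != i1 -> S1 a -> a (flip t y) = a y.
  move=> ti [b [b' [Sb Sb' aE]]]; rewrite !aE (i0 t b) // (i0 t b') //.
  by rewrite flip_neq // eq_sym.
have i2' a y : S2 a -> a (flip i3 y) = a y.
  by move=> [b [b' [Sb Sb' aE]]]; rewrite !aE (i1' i3 b) // (i1' i3 b') // flip_neq.
have l2 := denominator_descent char2 subalg_S2 (S1S2 (S0S1 (S0_n i3)))
  (S1S2 (S0S1 (S0_w i3))) (ms_eq i3) (flip_eq i3) i2' N3 M3 ms_local.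
have l1 := denominator_descent char2 subalg_S1 (S0S1 (S0_n i2)) (S0S1 (S0_w i2))
  (ms_eq i2) (flip_eq i2) (fun a y => @i1' i2 a y isT) N3
  (fun a b Sa => M3 a b (S2S3 Sa)) l2.
have [h [[p pE] hx Nh]] := denominator_descent char2 subalg_S0 (S0_n i1) (S0_w i1)
  (ms_eq i1) (flip_eq i1) (i0 i1) N3 (fun a b Sa => M3 a b (S2S3 (S1S2 Sa))) l1 x.
exists p; rewrite -pE; split=> //.
by have <- : (fun y => h y * ms_f y) = (fun y => p.[ms_t y] * ms_f y)
  by apply: funext => y; rewrite pE.
Qed.

Lemma ms_f_even l x y : ms_t x = ms_t y -> ms_z l x = ms_z l y ->
  (forall i, i != l -> ms_z i x != ms_z i y) -> ms_f x = ms_f y.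
Proof.
move=> txy zl zi; rewrite /ms_f.
move: (ms_free y) (@ms_iso y); rewrite /ms_mx -txy => fy iy.
apply: at_pt_const => //; [exact/od/ms_o|exact: ms_iso|exact: ms_free|].
by apply: cap_Dz zl zi => // i; rewrite -vsP_ev; apply: ov (ms_o x) i.
Qed.

(** After clearing denominators f is a combination over k[t] of the eight products of the z_i.
    Conjugating two of them stays within a family of planes ([ms_f_even]), so for general T
    [even_invariant] removes the products of several z_i and makes n_i r_i independent of i. *)
Lemma ms_f_linear T0 : o.[T0] != 0 -> exists (h p : {poly k}) (r : 'I_3 -> {poly k}),
  [/\ h.[T0] != 0,
      forall x, h.[ms_t x] * ms_f x = p.[ms_t x] + \sum_i (r i).[ms_t x] * ms_z i x &
      forall i l, n i * r i = n l * r l].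
Proof.
move=> oT0; have [x0 tx0] := msec_over oT0.
have [h [hx0]] := ms_global x0.
case=> a [b [Sa Sb fE]].
case: Sa => a0 [a1 [Sa0 Sa1 aE]]; case: Sb => b0 [b1 [Sb0 Sb1 bE]].
case: Sa0 => a00 [a01 [[p0 p0E] [p1 p1E] a0E]]; case: Sa1 => a10 [a11 [[p2 p2E] [p3 p3E] a1E]].
case: Sb0 => b00 [b01 [[p4 p4E] [p5 p5E] b0E]]; case: Sb1 => b10 [b11 [[p6 p6E] [p7 p7E] b1E]].
rewrite tx0 in hx0.
have {}fE x : h.[ms_t x] * ms_f x =
    (p0.[ms_t x] + p1.[ms_t x] * ms_z i1 x +
     (p2.[ms_t x] + p3.[ms_t x] * ms_z i1 x) * ms_z i2 x) +
    ((p4.[ms_t x] + p5.[ms_t x] * ms_z i1 x) +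
     (p6.[ms_t x] + p7.[ms_t x] * ms_z i1 x) * ms_z i2 x) * ms_z i3 x.
  by rewrite fE aE bE a0E a1E b0E b1E p0E p1E p2E p3E p4E p5E p6E p7E.
have rel T : (o * PB).[T] != 0 ->
  [/\ p3.[T] = 0, p5.[T] = 0, p6.[T] = 0 & p7.[T] = 0] /\
  (n i1).[T] * p1.[T] = (n i3).[T] * p4.[T] /\
  (n i2).[T] * p2.[T] = (n i3).[T] * p4.[T].
  move=> /horner_mul_neq0 [oT BT]; have [x tx] := msec_over oT.
  have nT i : (n i).[T] != 0.
    by apply: contraNneq BT => ni0; rewrite /PB (bigD1 i) //= hornerM ni0 mul0r.
  pose fl (b : bool) t y := if b then flip t y else y.
  have flt e t y : ms_t (fl e t y) = ms_t y by case: e.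
  have flz e t i y : ms_z i (fl e t y) = ms_z i y + (if i == t then ms_n i y *+ e else 0).
    case: e => /=; last by rewrite mulr0n if_same addr0.
    by have [->|it] := eqVneq i t; rewrite ?flip_eq // flip_neq // addr0.
  pose Y e f' h' := fl e i1 (fl f' i2 (fl h' i3 x)).
  have Yt e f' h' : ms_t (Y e f' h') = T by rewrite /Y !flt.
  have Y1 e f' h' : ms_z i1 (Y e f' h') = ms_z i1 x + (n i1).[T] *+ e.
    by rewrite /Y !flz /= !addr0 /ms_n !flt tx.
  have Y2 e f' h' : ms_z i2 (Y e f' h') = ms_z i2 x + (n i2).[T] *+ f'.
    by rewrite /Y !flz /= !addr0 /ms_n !flt tx.
  have Y3 e f' h' : ms_z i3 (Y e f' h') = ms_z i3 x + (n i3).[T] *+ h'.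
    by rewrite /Y !flz /= !addr0 /ms_n tx.
  have neq (x1 x2 : k) (e : bool) : x2 != 0 -> x1 + x2 *+ ~~ e != x1 + x2 *+ e.
    move=> x20; rewrite (inj_eq (addrI x1)); case: e; rewrite /= mulr1n mulr0n //.
    by rewrite eq_sym.
  pose F s1 s2 s3 := (p0.[T] + p1.[T] * s1 + (p2.[T] + p3.[T] * s1) * s2) +
    ((p4.[T] + p5.[T] * s1) + (p6.[T] + p7.[T] * s1) * s2) * s3.
  have fY e f' h' : h.[T] * ms_f (Y e f' h') = F (ms_z i1 x + (n i1).[T] *+ e)
      (ms_z i2 x + (n i2).[T] *+ f') (ms_z i3 x + (n i3).[T] *+ h').
    by have := fE (Y e f' h'); rewrite Yt Y1 Y2 Y3.
  apply: (@even_invariant _ _ _ (ms_z i1 x) (ms_z i2 x) (ms_z i3 x)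
    p0.[T] p1.[T] p2.[T] p3.[T] p4.[T] p5.[T] p6.[T] p7.[T]
    (nT i1) (nT i2) (nT i3)) => e f' h';
    rewrite -[LHS]fY -[RHS]fY; congr (_ * _).
  - apply: (@ms_f_even i3); rewrite ?Yt ?Y3 // => i; move: i.
    by apply: (@ord3_ind i1 i2 i3) => //; rewrite ?Y1 ?Y2 neq.
  - apply: (@ms_f_even i2); rewrite ?Yt ?Y2 // => i; move: i.
    by apply: (@ord3_ind i1 i3 i2) => //; rewrite ?Y1 ?Y3 neq.
  - apply: (@ms_f_even i1); rewrite ?Yt ?Y1 // => i; move: i.
    by apply: (@ord3_ind i2 i3 i1) => //; rewrite ?Y2 ?Y3 neq.
have oB : o * PB != 0.
  rewrite mulf_neq0 //; apply: contraNneq oT0 => ->; by rewrite horner0.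
have z3 : p3 = 0 by apply: (poly_eq_except oB) => T /rel [[-> _ _ _] _]; rewrite horner0.
have z5 : p5 = 0 by apply: (poly_eq_except oB) => T /rel [[_ -> _ _] _]; rewrite horner0.
have z6 : p6 = 0 by apply: (poly_eq_except oB) => T /rel [[_ _ -> _] _]; rewrite horner0.
have z7 : p7 = 0 by apply: (poly_eq_except oB) => T /rel [[_ _ _ ->] _]; rewrite horner0.
have e13 : n i1 * p1 = n i3 * p4.
  by apply: (poly_eq_except oB) => T /rel [_ [E _]]; rewrite !hornerM.
have e23 : n i2 * p2 = n i3 * p4.
  by apply: (poly_eq_except oB) => T /rel [_ [_ E]]; rewrite !hornerM.
have [r [r1 r2 r3]] := @ord3_choose {poly k} i1 i2 i3 p1 p2 p4 isT isT isT.
exists h, p0, r; split=> // [x|i l].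
  rewrite (@sum_ord3_distinct _ _ i1 i2 i3) // r1 r2 r3 fE z3 z5 z6 z7 !horner0.
  by ring.
have E i' : n i' * r i' = n i3 * r i3.
  by move: i'; apply: (@ord3_ind i1 i2 i3) => //; rewrite ?r1 ?r2 ?r3.
by rewrite (E i) (E l).
Qed.

(** An arbitrary plane meets some plane of the multisection in exactly a point, so both f and lam
    may be computed on the latter. *)
Lemma meets_msec (w : Zp) : o.[tz w] != 0 -> exists x, [/\ ms_t x = tz w, f w = ms_f x &
  lamZ w = \sum_i (\prod_(t | t != i) n t).[tz w] * (ms_z i x + c i * (u i).[tz w])
           + kap.[tz w]].
Proof.
move=> ow; have [l ml] := mildT (tz w).
have isow := coordM_iso (coordM_rep w); have rw := row_free_coordM w.
have v0 i : vs (pev n (tz w)) (pev u (tz w)) (pev v (tz w)) c i != 0.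
  by rewrite -vsP_ev; apply: ov.
have [z [zE r1]] := meets_Dz char2 ml v0 isow rw.
have H : o.[(tz w, z).1] != 0 /\ forall i, (tz w, z).2 i ^+ 2 +
    (n i).[(tz w, z).1] * (tz w, z).2 i = (u i).[(tz w, z).1] * (vsP c i).[(tz w, z).1].
  by split=> // i; rewrite vsP_ev; exact: zE.
exists (exist _ (tz w, z) H : msec); split=> //.
  rewrite -(at_ptE f (erefl _) (coordM_rep w)); apply: at_pt_const => //.
  - exact: tz_d.
  - exact: iso_Dz.
  - exact: row_free_Dz.
rewrite /lamZ; congr (_ + _).
have -> : lamT (tz w) (coordM w) = lamT (tz w) (Dz (pev n (tz w)) (pev u (tz w)) (pev v (tz w)) c z).
  apply: (rational_const char2 ml (lam_rational char2 ml)) => //.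
  - by move=> M M' iM rM E; apply: (lam_eqmx char2 ml E).
  - exact: iso_Dz.
  - exact: row_free_Dz.
by rewrite lam_Dz //; apply: eq_bigr => i _; rewrite horner_prod.
Qed.

End Multisection.

Lemma local_generation (f : Zp -> k^o) T0 : regular f -> d.[T0] != 0 ->
  exists h p q : {poly k}, h.[T0] != 0 /\
    forall w : Zp, h.[tz w] * f w = p.[tz w] + q.[tz w] * lamZ w.
Proof.
move=> rf dT0; have [l ml] := mildT T0; have [c cv] := mild_shear ml.
pose pl i := \prod_(t | t != i) n t.
have plT0 : (pl l).[T0] != 0.
  by rewrite horner_prod; apply/prodf_neq0 => i il; apply: ml.1 _ il.
have [o [oT0 ovd ov]] : exists o : {poly k}, [/\ o.[T0] != 0,
    forall T, o.[T] != 0 -> d.[T] != 0 &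
    forall T, o.[T] != 0 -> forall i, (vsP c i).[T] != 0].
  exists (d * \prod_i vsP c i); split=> [|T /horner_mul_neq0 [] //|T].
    by rewrite hornerM mulf_neq0 // horner_prod; apply/prodf_neq0 => i _; exact: cv.
  move=> /horner_mul_neq0 [_ vT] i.
  by apply: contraNneq vT => E; rewrite (bigD1 i) //= hornerM E mul0r.
have [h [p [r [hT0 fE rE]]]] := ms_f_linear rf ovd ov oT0.
(* Since n_i r_i does not depend on i, the r_i are proportional to the products pl_i of the other
   n_t. So the sum of the r_i z_i is, up to the factor pl_l, a multiple of the part of lam that is
   linear in the z_i. *)
have plr i : pl l * r i = r l * pl i.
  have [->|il] := eqVneq i l; first by rewrite mulrC.
  have [m [il' ml' mi]] : exists m, [/\ i != l, m != l & i != m].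
    have [a [b [al bl ab]]] := ord3_others l.
    have [ia|ia] := eqVneq i a; first by exists b; rewrite ia.
    by exists a.
  have mi' : m != i by rewrite eq_sym.
  have li : l != i by rewrite eq_sym.
  have lm : l != m by rewrite eq_sym.
  rewrite /pl (@prod_ord3_others _ _ l m i) // (@prod_ord3_others _ _ i m l) //.
  by rewrite -mulrA (rE i l); ring.
exists (h * pl l * o), (o * (pl l * p - r l * (\sum_i pl i * ((c i)%:P * u i) + kap))),
  (o * r l); split.
  by rewrite 2!hornerM !mulf_neq0.
move=> w; rewrite !hornerM !(hornerD, hornerN, hornerM).
have [->|ow] := eqVneq o.[tz w] 0; first by rewrite !(mulr0, mul0r) addr0.
have [x [tx -> ->]] := meets_msec rf ov ow; have := fE x; rewrite tx => fx.
transitivity (o.[tz w] * ((pl l).[tz w] * (h.[tz w] * ms_f f x))); first by ring.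
rewrite fx -!mulrA -mulrDr; congr (_ * _); rewrite horner_sum mulrDr mulr_sumr.
have -> : \sum_i (pl l).[tz w] * ((r i).[tz w] * ms_z i x) =
    (r l).[tz w] * \sum_i (pl i).[tz w] * ms_z i x.
  by rewrite mulr_sumr; apply: eq_bigr => i _; rewrite !mulrA -!hornerM plr.
have -> : \sum_i (pl i).[tz w] * (ms_z i x + c i * (u i).[tz w]) =
    \sum_i (pl i).[tz w] * ms_z i x + \sum_i (pl i * ((c i)%:P * u i)).[tz w].
  by rewrite -big_split; apply: eq_bigr => i _; rewrite !hornerM hornerC /= mulrDr.
by ring.
Qed.

(** The denominators form an ideal of k[t] that, by [local_generation], has an element nonzero at
    each point where d is; so it contains a power of d. *)
Theorem regular_generation (f : Zp -> k^o) : regular f -> exists m (p q : {poly k}),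
  forall w : Zp, d.[tz w] ^+ m * f w = p.[tz w] + q.[tz w] * lamZ w.
Proof.
move=> rf; pose I (h : {poly k}) := exists p q : {poly k}, forall w : Zp,
  h.[tz w] * f w = p.[tz w] + q.[tz w] * lamZ w.
have [|||m [p [q E]]] := @ideal_locally_unit _ I d d0.
- move=> h1 h2 [p [q hE]] [p' [q' hE']]; exists (p - p'), (q - q') => w.
  by rewrite !hornerE mulrBl hE hE'; ring.
- move=> h1 h2 [p [q hE]]; exists (h2 * p), (h2 * q) => w.
  by rewrite !hornerE -mulrA hE; ring.
- move=> T dT; have [h [p [q [hT hE]]]] := local_generation rf dT.
  by exists h => //; exists p, q.
by exists m, p, q => w; rewrite -E horner_exp.
Qed.

(** Conjugating a single z_i passes to the other family of planes and changes lam by z_i -> z_i +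
    n_i, that is, by B. *)
Lemma exists_lam T : d.[T] != 0 -> PB.[T] != 0 ->
  exists w w' : Zp, [/\ tz w = T, tz w' = T & lamZ w = lamZ w' + PB.[T]].
Proof.
move=> dT BT; have [l ml] := mildT T; have [c cv] := mild_shear ml.
pose o := d * \prod_i vsP c i.
have ovd S : o.[S] != 0 -> d.[S] != 0 by move=> /horner_mul_neq0 [].
have ov S : o.[S] != 0 -> forall i, (vsP c i).[S] != 0.
  move=> /horner_mul_neq0 [_ vS] i.
  by apply: contraNneq vS => E; rewrite (bigD1 i) //= hornerM E mul0r.
have oT : o.[T] != 0.
  by rewrite hornerM mulf_neq0 // horner_prod; apply/prodf_neq0 => i _; exact: cv.
have [x tx] := @msec_over c o T oT.
have pt (y : msec c o) : ms_t y = T -> exists w : Zp, tz w = T /\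
    lamZ w = \sum_i (\prod_(t | t != i) n t).[T] * (ms_z i y + c i * (u i).[T]) + kap.[T].
  move=> ty.
  have [w [tw wM]] := exists_point (ovd _ (ms_o y)) (@ms_iso _ _ y) (ms_free ov y).
  exists w; split; first by rewrite tw.
  rewrite (lamZE tw wM) /ms_mx lam_Dz //; last exact: ms_root.
    rewrite -ty; congr (_ + _); apply: eq_bigr => i _; by rewrite horner_prod.
  by move=> i; rewrite -vsP_ev; apply: ov; exact: ms_o.
have [w [tw lw]] := pt _ tx.
have [|w' [tw' lw']] := pt (flip i1 x); first by rewrite flip_t.
exists w, w'; split=> //; rewrite lw lw' addrAC; congr (_ + _).
rewrite (bigD1 i1) // [in RHS](bigD1 i1) //= flip_eq /ms_n tx.
have -> : PB.[T] = (\prod_(t | t != i1) n t).[T] * (n i1).[T].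
  by rewrite /PB (bigD1 i1) //= hornerM mulrC.
rewrite [X in _ = _ + X + _](eq_bigr (fun i => (\prod_(t | t != i) n t).[T] *
  (ms_z i x + c i * (u i).[T]))); last by move=> i ii1; rewrite flip_neq.
by ring2 two0.
Qed.

Lemma lamZ_free (p q : {poly k}) :
  (forall w : Zp, p.[tz w] + q.[tz w] * lamZ w = 0) -> p = 0 /\ q = 0.
Proof.
move=> E; have qT T : (d * PB).[T] != 0 -> q.[T] = 0 /\ p.[T] = 0.
  move=> /horner_mul_neq0 [dT BT]; have [w [w' [tw tw' lE]]] := exists_lam dT BT.
  have := E w; have := E w'; rewrite tw tw' lE => E1 E2.
  have q0 : q.[T] = 0.
    apply: (mulIf BT); rewrite mul0r -[RHS]E2 -[RHS]subr0 -[X in _ - X]E1; ring.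
  by split=> //; move: E1; rewrite q0 mul0r addr0.
have dB := mulf_neq0 d0 B0.
by split; apply: (poly_eq_except dB) => T /qT []; rewrite horner0.
Qed.

End LocalStructure.

(** * The affine curve z^2 + B z = A *)

Section Ideals.
Variables (A : comPzRingType) (m : set A).

Lemma ideal_mul_in x y : m x -> m y -> ideal_mul m m (x * y).
Proof.
move=> mx my; exists [:: (x, y)]; split; last by rewrite big_seq1.
by move=> p; rewrite inE => /eqP ->.
Qed.

Lemma ideal_mulD x y : ideal_mul m m x -> ideal_mul m m y -> ideal_mul m m (x + y).
Proof.
move=> [s [ms ->]] [s' [ms' ->]]; exists (s ++ s'); split; last by rewrite big_cat.
by move=> p; rewrite mem_cat => /orP[/ms|/ms'].
Qed.

Lemma ideal_mulMl a x : is_ideal m -> ideal_mul m m x -> ideal_mul m m (a * x).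
Proof.
move=> [_ _ mM] [s [ms ->]]; exists [seq (a * p.1, p.2) | p <- s]; split.
  by move=> p /mapP [q /ms [mq1 mq2] ->]; split=> //; apply: mM.
by rewrite big_map mulr_sumr; apply: eq_bigr => p _; rewrite mulrA.
Qed.

Lemma ideal_sub x y : is_ideal m -> m x -> m y -> m (x - y).
Proof. by move=> [_ mD mM] mx my; apply: mD => //; rewrite -mulN1r; apply: mM. Qed.

Lemma is_ideal_adjoin x : is_ideal m -> is_ideal [set y | exists a r, m a /\ y = a + r * x].
Proof.
move=> [m0 mD mM]; split=> [|_ _ [a [r [ma ->]]] [a' [r' [ma' ->]]]|b _ [a [r [ma ->]]]].
- by exists 0, 0; rewrite mul0r addr0.
- by exists (a + a'), (r + r'); split; [exact: mD|ring].
- by exists (b * a), (b * r); split; [exact: mM|ring].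
Qed.

Lemma maximal_ideal_comax x : maximal_ideal m -> m x \/ exists a r, m a /\ 1 = a + r * x.
Proof.
move=> [mI m1 mmax]; have [m0 mD mM] := mI.
case: (mmax _ (is_ideal_adjoin x mI)) => [a ma|<-|E].
- by exists a, 0; rewrite mul0r addr0.
- by left; exists 0, 1; rewrite mul1r add0r.
- by right; have : [set: A] 1 by []; rewrite -E.
Qed.

Lemma maximal_ideal_prime x y : maximal_ideal m -> m (x * y) -> m x \/ m y.
Proof.
move=> mm mxy; have [mI _ _] := mm; have [m0 mD mM] := mI.
case: (maximal_ideal_comax x mm) => [mx|[a [r [ma E]]]]; [by left|right].
by rewrite -[y]mul1r E mulrDl -mulrA; apply: mD; [rewrite mulrC|]; apply: mM.
Qed.

Lemma maximal_ideal_prod (I : Type) (s : seq I) (F : I -> A) : maximal_ideal m ->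
  m (\prod_(i <- s) F i) -> exists i, m (F i).
Proof.
move=> mm; elim: s => [|i s IH]; first by rewrite big_nil; case: mm.
by rewrite big_cons => /(maximal_ideal_prime mm) [mi|/IH //]; exists i.
Qed.

End Ideals.

Lemma poly_taylor2 (R : comNzRingType) (p : {poly R}) (a : R) :
  exists r, p = p.[a]%:P + p^`().[a]%:P * ('X - a%:P) + r * ('X - a%:P) ^+ 2.
Proof.
have /factor_theorem [q qE] : root (p - p.[a]%:P) a by rewrite /root !hornerE subrr.
have /factor_theorem [r rE] : root (q - q.[a]%:P) a by rewrite /root !hornerE subrr.
have {}qE : p = p.[a]%:P + q * ('X - a%:P) by rewrite -qE addrC subrK.
have {}rE : q = q.[a]%:P + r * ('X - a%:P) by rewrite -rE addrC subrK.
exists r; have -> : p^`().[a] = q.[a].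
  rewrite {1}qE derivD derivC add0r derivM derivXsubC mulr1 hornerD hornerM.
  by rewrite hornerXsubC subrr mulr0 add0r.
by rewrite {1}qE {1}rE; ring.
Qed.

Lemma deriv_line (R : nzRingType) (a b : R) : (a%:P + b%:P * 'X)^`() = b%:P.
Proof. by rewrite derivD derivC add0r derivM derivC mul0r add0r derivX mulr1. Qed.

Lemma quadric_taylor (V : comPzRingType) (t z t0 z1 B0 B1 b A1 a : V) : 2%:R = 0 :> V ->
  B0 * (z - z1) + (A1 + B1 * z1) * (t - t0) - (-1 * ((z - z1) * (z - z1))
    + (a - b * z) * ((t - t0) * (t - t0)) + - B1 * ((t - t0) * (z - z1))) =
  z ^+ 2 + (B0 + B1 * (t - t0) + b * ((t - t0) * (t - t0))) * z
  - (z1 * z1 + B0 * z1 + A1 * (t - t0) + a * ((t - t0) * (t - t0))).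
Proof.
move=> two0; have opp (x : V) : - x = x.
  by apply/eqP; rewrite eq_sym -subr_eq0 opprK -mulr2n -mulr_natr two0 mulr0.
by rewrite !opp; ring2 two0.
Qed.

Section QuadraticCurve.
Variable k : closedFieldType.
Hypothesis char2 : 2%N \in [pchar k].
Let two0 : 2%:R = 0 :> k. Proof. exact: pcharf0. Qed.
Let two0P : 2%:R = 0 :> {poly k}.
Proof. by rewrite -[2%:R]polyC_natr two0. Qed.

Variables B A : {poly k}.

(** The Jacobian criterion: the two expressions are, in characteristic 2, the derivatives of z^2 + B
    z - A in z and in t. *)
Definition smooth_quadratic := forall T z, z ^+ 2 + B.[T] * z = A.[T] ->
  B.[T] != 0 \/ A^`().[T] + B^`().[T] * z != 0.

Hypothesis smooth : smooth_quadratic.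

(** An Eisenstein argument at the zero T0 of B: comparing orders, p and then q are divisible by t -
    T0, and the quotients satisfy the same equation, so one descends on the size of q. *)
Lemma norm_eq0 T0 p q : root B T0 ->
  p ^+ 2 + p * q * B + q ^+ 2 * A = 0 -> p = 0 /\ q = 0.
Proof.
move=> rB; have BT0 : B.[T0] = 0 := eqP rB.
have [z zE] := quadratic_root B.[T0] A.[T0].
(* The constant term after moving the point over T0 to z = 0. By smoothness it has a simple zero at
   T0. *)
pose A' := A + (z ^+ 2)%:P + B * z%:P.
have A'0 : root A' T0.
  rewrite /root /A' !hornerE -zE BT0; apply/eqP; ring2 two0.
have [] := smooth zE; first by rewrite BT0 eqxx.
have -> : A^`().[T0] + B^`().[T0] * z = A'^`().[T0].
  by rewrite /A' !derivD !derivM !derivC mulr0 !addr0 hornerD hornerM hornerC.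
move=> dA' E; pose p' := p + q * z%:P.
have {}E : p' ^+ 2 + p' * q * B + q ^+ 2 * A' = 0.
  rewrite -[RHS]E /p' /A' polyC_exp; move: (z%:P) => Z; ring2 two0P.
have [a aE] := factor_theorem _ _ A'0; have [b bE] := factor_theorem _ _ rB.
have a0 : a.[T0] != 0.
  by move: dA'; rewrite aE derivM derivXsubC !hornerE subrr mulr0 add0r.
suff [p0 q0] : p' = 0 /\ q = 0.
  by split=> //; move: p0; rewrite /p' q0 mul0r addr0.
have [m] : exists m, (size q < m)%N by exists (size q).+1.
move: p' E => {}p; elim: m p q {A'0 dA'} => [//|m IH] p q E sq.
have X0 : 'X - T0%:P != 0 by rewrite polyXsubC_eq0.
have rp : root p T0.
  have := congr1 (horner^~ T0) E; rewrite /root aE bE !hornerE /= subrr !mulr0 !addr0.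
  by move/eqP; rewrite mulf_eq0 orbb.
have [p1 p1E] := factor_theorem _ _ rp.
have E1 : ('X - T0%:P) * p1 ^+ 2 + ('X - T0%:P) * p1 * q * b + q ^+ 2 * a = 0.
  by apply: (mulIf X0); rewrite mul0r -[RHS]E p1E aE bE; ring.
have rq : root q T0.
  have := congr1 (horner^~ T0) E1; rewrite /root !hornerE /= subrr !mul0r !add0r.
  by move/eqP; rewrite !mulf_eq0 (negPf a0) orbF orbb.
have [q1 q1E] := factor_theorem _ _ rq.
have E2 : p1 ^+ 2 + p1 * q1 * B + q1 ^+ 2 * A' = 0.
  by apply: (mulIf X0); rewrite mul0r -[RHS]E1 q1E aE bE; ring.
have [q0|q0] := eqVneq q 0.
  split=> //; apply/eqP; rewrite -sqrf_eq0 -[X in X == _]addr0 -[X in _ + X](mul0r A').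
  by rewrite -{2}E q0; apply/eqP; ring.
have [] := IH p1 q1 E2 _; last by rewrite p1E q1E => -> ->; rewrite !mul0r.
have q10 : q1 != 0 by apply: contraNneq q0 => E0; rewrite q1E E0 mul0r.
by move: sq; rewrite q1E size_Mmonic ?monicXsubC // size_XsubC addn2.
Qed.

Hypothesis norm0 : forall p q, p ^+ 2 + p * q * B + q ^+ 2 * A = 0 -> p = 0 /\ q = 0.

Local Notation F := (quadratic_eq B A).

Lemma quadratic_eq_size : size F = 3%N.
Proof.
rewrite /quadratic_eq -addrA size_polyDl ?size_polyXn // ltnS.
rewrite (leq_trans (size_polyD _ _)) // geq_max size_polyN.
rewrite (leq_trans (size_polyC_leq1 _)) // andbT.
by rewrite (leq_trans (size_polyMleq _ _)) // size_polyX addn2 /= ltnS size_polyC_leq1.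
Qed.

Lemma quadratic_eq_monic : F \is monic.
Proof.
by rewrite monicE lead_coefE quadratic_eq_size /quadratic_eq !coefE /=
  !(mul0r, addr0, subr0, mulr0).
Qed.

Lemma quadratic_divmod (P : {poly {poly k}}) : exists Q (p q : {poly k}),
  P = Q * F + (p%:P + q%:P * 'X).
Proof.
have F1 := quadratic_eq_monic.
have := Pdiv.RingMonic.rdivp_eq F1 P; set r := Pdiv.Ring.rmodp _ _ => PE.
have sr : (size r < 3)%N.
  by rewrite -quadratic_eq_size; apply: Pdiv.Ring.ltn_rmodpN0; rewrite monic_neq0.
exists (Pdiv.Ring.rdivp P F), r`_0, r`_1; rewrite {1}PE; congr (_ + _).
apply/polyP => i; rewrite !coefE; case: i => [|[|i]] /=; rewrite ?(mulr0, mulr1, addr0, add0r) //.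
by apply/nth_default/(leq_trans (ltnSE sr)).
Qed.

(** Multiplying (p + q z)(p' + q' z) = 0 by the conjugate of the first factor shows that its norm
    kills p' and q'. *)
Lemma quadratic_domain p q p' q' :
  p * p' + q * q' * A = 0 -> p * q' + p' * q - q * q' * B = 0 ->
  (p = 0 /\ q = 0) \/ (p' = 0 /\ q' = 0).
Proof.
move=> e0 e1; pose N := p ^+ 2 - p * q * B - q ^+ 2 * A.
have Np : p' * N = 0.
  transitivity ((p - q * B) * (p * p' + q * q' * A) - q * A * (p * q' + p' * q - q * q' * B)).
    by rewrite /N; ring.
  by rewrite e0 e1 !mulr0 subr0.
have Nq : q' * N = 0.
  transitivity (p * (p * q' + p' * q - q * q' * B) - q * (p * p' + q * q' * A)).
    by rewrite /N; ring.
  by rewrite e0 e1 !mulr0 subr0.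
have [N0|N0] := eqVneq N 0.
  by left; apply: norm0; rewrite -[RHS]N0 /N; ring2 two0P.
right; split; apply/eqP.
  by move/eqP: Np; rewrite mulf_eq0 (negPf N0) orbF.
by move/eqP: Nq; rewrite mulf_eq0 (negPf N0) orbF.
Qed.

Variables (R : comPzRingType) (phi : {rmorphism {poly {poly k}} -> R}).
Hypothesis phi_surj : forall f, exists p, phi p = f.
Hypothesis phi_ker : forall p, phi p = 0 <-> exists r, p = r * quadratic_eq B A.

Local Notation t := (phi ('X%:P)).

Lemma quadratic_eq_small (p : {poly {poly k}}) : (size p < 3)%N -> phi p = 0 -> p = 0.
Proof.
move=> sp /phi_ker [r pE]; have [r0|r0] := eqVneq r 0; first by rewrite pE r0 mul0r.
move: sp; rewrite pE size_Mmonic ?quadratic_eq_monic // quadratic_eq_size.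
by rewrite addn3 /= ltnS ltnS ltnNge size_poly_gt0 r0.
Qed.

Lemma quadratic_normal_form f : exists p q : {poly k}, f = phi (p%:P + q%:P * 'X).
Proof.
have [P <-] := phi_surj f; have [Q [p [q ->]]] := quadratic_divmod P.
exists p, q; rewrite rmorphD; have -> : phi (Q * F) = 0 by apply/phi_ker; exists Q.
by rewrite add0r.
Qed.

Lemma phi_F : phi F = 0.
Proof. by apply/phi_ker; exists 1; rewrite mul1r. Qed.

Lemma integral_quadratic : integral_ring R.
Proof.
split=> [one0|x y xy0].
  have /phi_ker [r /eqP] : phi 1 = 0 by rewrite rmorph1.
  have : (1 : {poly {poly k}}) = 0.
    by apply: quadratic_eq_small; rewrite ?size_poly1 // rmorph1.
  by move=> E; have := oner_neq0 {poly {poly k}}; rewrite E eqxx.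
have [p [q xE]] := quadratic_normal_form x; have [p' [q' yE]] := quadratic_normal_form y.
have prod0 : (p * p' + q * q' * A)%:P + (p * q' + p' * q - q * q' * B)%:P * 'X = 0
    :> {poly {poly k}}.
  apply: quadratic_eq_small.
    rewrite (leq_ltn_trans (size_polyD _ _)) // gtn_max; apply/andP; split.
      by rewrite (leq_ltn_trans (size_polyC_leq1 _)).
    rewrite (leq_ltn_trans (size_polyMleq _ _)) // size_polyX addn2 /= ltnS.
    exact: size_polyC_leq1.
  rewrite -[RHS]xy0 xE yE -rmorphM; apply/eqP; rewrite -subr_eq0 -rmorphB.
  apply/eqP/phi_ker; exists (- (q * q')%:P).
  by rewrite /quadratic_eq !polyCD !polyCN !polyCM; ring.
have e0 : p * p' + q * q' * A = 0.
  by have := congr1 (fun P : {poly {poly k}} => P`_0) prod0; rewrite !coefE /= mulr0 addr0.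
have e1 : p * q' + p' * q - q * q' * B = 0.
  by have := congr1 (fun P : {poly {poly k}} => P`_1) prod0; rewrite !coefE /= mulr1 add0r.
have [[p0 q0]|[p0 q0]] := quadratic_domain e0 e1; [left|right].
  by rewrite xE p0 q0 mul0r addr0 rmorph0.
by rewrite yE p0 q0 mul0r addr0 rmorph0.
Qed.

(** * Maximal ideals and cotangent spaces of the plane curve *)

Section CotangentSpace.
Variable m : set R.
Hypothesis mm : maximal_ideal m.
Let mI : is_ideal m. Proof. by case: mm. Qed.

Lemma maximal_cst (c : k) : m (phi c%:P%:P) -> c = 0.
Proof.
move=> mc; apply/eqP; apply: contra_notT (_ : ~ m 1) => [c0|]; last by case: mm.
have [_ _ mM] := mI; have := mM (phi (c^-1)%:P%:P) _ mc.
by rewrite -rmorphM -!polyCM mulVf // rmorph1.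
Qed.

(* The conjugate of [p + q z] is [p - q (z + B)]. *)
Lemma maximal_norm p q : m (phi (p%:P + q%:P * 'X)) ->
  m (phi (p ^+ 2 - p * q * B - q ^+ 2 * A)%:P).
Proof.
move=> mf; have [_ _ mM] := mI; have := mM (phi (p%:P - q%:P * ('X + B%:P))) _ mf.
rewrite -rmorphM; congr m; apply/eqP; rewrite -subr_eq0 -rmorphB; apply/eqP/phi_ker.
exists (- (q ^+ 2)%:P); rewrite /quadratic_eq !(polyCB, polyCM, polyC_exp).
by move: (p%:P) (q%:P) (A%:P) (B%:P) => *; ring.
Qed.

(** Either t lies in m, or m contains some 1 - r t; the norm of the latter has value 1 at t = 0, so
    it is a nonzero polynomial in t. *)
Lemma maximal_polynomial : exists2 p : {poly k}, p != 0 & m (phi p%:P).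
Proof.
have [mt|[a [r [ma E]]]] := maximal_ideal_comax t mm; first by exists 'X; rewrite ?polyX_eq0.
have [p [q rE]] := quadratic_normal_form r.
exists ((1 - p * 'X) ^+ 2 - (1 - p * 'X) * (- q * 'X) * B - (- q * 'X) ^+ 2 * A).
  apply/eqP => /(congr1 (horner^~ 0)) /eqP; rewrite !hornerE /= !(mulr0, mul0r, oppr0, subr0, addr0, expr0n, mulr1, expr1n).
  by rewrite oner_eq0.
apply: maximal_norm; move: ma; congr m.
rewrite -[LHS](addrK (r * t)) -E rE -rmorphM -(rmorph1 phi) -rmorphB; congr (phi _).
by rewrite !(polyCB, polyCM, polyCN); move: (p%:P) (q%:P) ('X%:P) => *; ring.
Qed.

(** A Nullstellensatz for this curve: the polynomial in m splits, so t - T0 is in m because m is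
    prime; modulo t - T0 the equation of the curve splits in z as well. *)
Lemma maximal_point : exists T0 z1, [/\ z1 ^+ 2 + B.[T0] * z1 = A.[T0],
  m (phi ('X - T0%:P)%:P) & m (phi ('X - z1%:P%:P))].
Proof.
have [_ mD mM] := mI; have [p p0 mp] := maximal_polynomial.
have [T0 mT] : exists T0, m (phi ('X - T0%:P)%:P).
  have [s pE] := closed_field_poly_normal p.
  move: mp; rewrite pE -mul_polyC polyCM rmorphM.
  case/(maximal_ideal_prime mm) => [/maximal_cst/eqP|].
    by rewrite lead_coef_eq0 (negPf p0).
  rewrite rmorph_prod rmorph_prod; exact: maximal_ideal_prod.
exists T0; have [z zE] := quadratic_root B.[T0] A.[T0].
have /factor_theorem [b bE] : root (B - B.[T0]%:P) T0 by rewrite /root !hornerE subrr.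
have /factor_theorem [a aE] : root (A - A.[T0]%:P) T0 by rewrite /root !hornerE subrr.
have : m (phi (('X - z%:P%:P) * ('X - (- (B.[T0] + z))%:P%:P))).
  have -> : ('X - z%:P%:P) * ('X - (- (B.[T0] + z))%:P%:P) =
      F - (b%:P * 'X - a%:P) * ('X - T0%:P)%:P :> {poly {poly k}}.
    transitivity (F - ((B - B.[T0]%:P)%:P * 'X - (A - A.[T0]%:P)%:P)); last first.
      by rewrite bE aE !polyCM; ring.
    rewrite /quadratic_eq -zE !(polyCB, polyCD, polyCN, polyCM, polyC_exp).
    by move: (z%:P%:P) (B.[T0]%:P%:P) (A%:P) (B%:P) => *; ring.
  rewrite rmorphB phi_F sub0r rmorphM -mulNr; exact: mM.
rewrite rmorphM => /(maximal_ideal_prime mm) [mz|mz]; first by exists z.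
exists (- (B.[T0] + z)); split=> //; rewrite -zE; ring.
Qed.

Section Point.
Variables T0 z1 : k.
Hypothesis zE : z1 ^+ 2 + B.[T0] * z1 = A.[T0].
Hypothesis mT : m (phi ('X - T0%:P)%:P).
Hypothesis mz : m (phi ('X - z1%:P%:P)).
Local Notation tau := (phi ('X - T0%:P)%:P).
Local Notation Lam := (phi ('X - z1%:P%:P)).
Let Fz := B.[T0].
Let Ft := A^`().[T0] + B^`().[T0] * z1.

(* Restriction to the tangent line at the point (T0, z1). *)
Definition tangent_restr : {poly {poly k}} -> {poly k} :=
  horner_eval (z1%:P + Ft%:P * 'X) \o map_poly (comp_poly (T0%:P + Fz%:P * 'X)).

HB.instance Definition _ := GRing.RMorphism.on tangent_restr.

Definition tangent_val p := (tangent_restr p).[0].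
Definition tangent_der p := (tangent_restr p)^`().[0].

Lemma tangent_restrC p : tangent_restr p%:P = p \Po (T0%:P + Fz%:P * 'X).
Proof. by rewrite /tangent_restr /= map_polyC /horner_eval hornerC. Qed.

Lemma tangent_restrX : tangent_restr 'X = z1%:P + Ft%:P * 'X.
Proof. by rewrite /tangent_restr /= map_polyX /horner_eval hornerX. Qed.

Lemma tangent_derM p q :
  tangent_der (p * q) = tangent_der p * tangent_val q + tangent_val p * tangent_der q.
Proof. by rewrite /tangent_der /tangent_val rmorphM derivM hornerD !hornerM. Qed.

Lemma tangent_derC p : tangent_der p%:P = Fz * p^`().[T0].
Proof.
rewrite /tangent_der tangent_restrC deriv_comp hornerM horner_comp deriv_line.
by rewrite hornerC hornerD hornerM !hornerC hornerX mulr0 addr0 mulrC.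
Qed.

Lemma tangent_valC p : tangent_val p%:P = p.[T0].
Proof. by rewrite /tangent_val tangent_restrC horner_comp hornerD hornerM !hornerC hornerX mulr0 addr0. Qed.

Lemma tangent_derX : tangent_der 'X = Ft.
Proof.
rewrite /tangent_der tangent_restrX.
by rewrite deriv_line hornerC.
Qed.

Lemma tangent_valX : tangent_val 'X = z1.
Proof. by rewrite /tangent_val tangent_restrX hornerD hornerM !hornerC hornerX mulr0 addr0. Qed.

Lemma tangent_valD p q : tangent_val (p + q) = tangent_val p + tangent_val q.
Proof. by rewrite /tangent_val rmorphD hornerD. Qed.

Lemma tangent_derD p q : tangent_der (p + q) = tangent_der p + tangent_der q.
Proof. by rewrite /tangent_der rmorphD derivD hornerD. Qed.

Lemma tangent_valM p q : tangent_val (p * q) = tangent_val p * tangent_val q.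
Proof. by rewrite /tangent_val rmorphM hornerM. Qed.

Lemma tangent_valF : tangent_val F = 0.
Proof.
rewrite /quadratic_eq -polyCN expr2 !(tangent_valD, tangent_valM, tangent_valC, tangent_valX).
by rewrite hornerN -zE; ring.
Qed.

Lemma tangent_derF : tangent_der F = 0.
Proof.
rewrite /quadratic_eq -polyCN expr2.
rewrite !(tangent_derD, tangent_derM, tangent_derC, tangent_derX, tangent_valC, tangent_valX).
by rewrite derivN hornerN /Ft /Fz; ring2 two0.
Qed.

Lemma tangent_ker p : phi p = 0 -> tangent_val p = 0 /\ tangent_der p = 0.
Proof.
move=> /phi_ker [r ->]; rewrite tangent_valM tangent_derM tangent_valF tangent_derF.
by rewrite !mulr0 addr0.
Qed.

Lemma tangent_decomp p : exists Q r, p =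
  Q * ('X - z1%:P%:P) + r%:P * ('X - T0%:P)%:P + (tangent_val p)%:P%:P.
Proof.
have /factor_theorem [Q QE] : root (p - p.[z1%:P]%:P) z1%:P by rewrite /root !hornerE subrr.
have /factor_theorem [r rE] : root (p.[z1%:P] - p.[z1%:P].[T0]%:P) T0 by rewrite /root !hornerE subrr.
have E : p = Q * ('X - z1%:P%:P) + (r%:P * ('X - T0%:P)%:P + p.[z1%:P].[T0]%:P%:P).
  by rewrite -QE -polyCM -rE -polyCD !subrK.
have tE : tangent_val p = p.[z1%:P].[T0].
  rewrite {1}E !(tangent_valD, tangent_valM) -!polyCN !(tangent_valC, tangent_valD) tangent_valX.
  by rewrite hornerD !hornerC hornerX; ring.
by exists Q, r; rewrite -addrA tE.
Qed.

Lemma maximal_tangent p : m (phi p) <-> tangent_val p = 0.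
Proof.
have [_ mD mM] := mI; have [Q [r pE]] := tangent_decomp p.
have mQ : m (phi (Q * ('X - z1%:P%:P) + r%:P * ('X - T0%:P)%:P)).
  by rewrite rmorphD !rmorphM; apply: mD; apply: mM.
split=> [mp|v0]; last by rewrite pE v0 !polyC0 addr0.
apply: maximal_cst; move: (ideal_sub mI mp mQ); rewrite -rmorphB; congr (m (phi _)).
by rewrite {1}pE addrC addKr.
Qed.

(** The derivative along the tangent line obeys Leibniz's rule and kills the equation, so it is well
    defined on the quotient ring and vanishes on m^2. *)
Lemma tangent_der_sq p : ideal_mul m m (phi p) -> tangent_der p = 0.
Proof.
move=> [s [ms pE]].
suff [q [qE dq0]] : exists q, phi q = phi p /\ tangent_der q = 0.
  have [_] := @tangent_ker (p - q) ltac:(by rewrite rmorphB qE subrr).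
  by rewrite tangent_derD {2}/tangent_der rmorphN derivN hornerN -/(tangent_der q) dq0 subr0.
rewrite pE; elim: s ms {pE} => [|[x y] s IH] ms.
  by exists 0; rewrite rmorph0 big_nil -polyC0 tangent_derC deriv0 horner0 mulr0.
have [|q [qE dq]] := IH; first by move=> u us; apply: ms; rewrite inE us orbT.
have [mx my] := ms (x, y) (mem_head _ _).
have [px pxE] := phi_surj x; have [py pyE] := phi_surj y.
exists (px * py + q); rewrite big_cons rmorphD rmorphM qE pxE pyE; split=> //.
rewrite tangent_derD tangent_derM dq.
have -> : tangent_val px = 0 by apply/maximal_tangent; rewrite pxE.
have -> : tangent_val py = 0 by apply/maximal_tangent; rewrite pyE.
by rewrite mul0r mulr0 !addr0.
Qed.

(** The Taylor expansion of the equation at the point: its linear part is congruent to 0 modulo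
    m^2. *)
Lemma tangent_relation : ideal_mul m m (phi Fz%:P%:P * Lam + phi Ft%:P%:P * tau).
Proof.
have [b bE] := poly_taylor2 B T0; have [a aE] := poly_taylor2 A T0.
pose L := 'X - z1%:P%:P : {poly {poly k}}; pose S := ('X - T0%:P)%:P : {poly {poly k}}.
have -> : phi Fz%:P%:P * phi L + phi Ft%:P%:P * phi S =
   phi (-1) * (phi L * phi L) + phi (a%:P - b%:P * 'X) * (phi S * phi S)
   + phi (- B^`().[T0]%:P%:P) * (phi S * phi L).
  rewrite -!rmorphM -!rmorphD; apply/eqP; rewrite -subr_eq0 -rmorphB; apply/eqP/phi_ker.
  exists 1; rewrite mul1r /quadratic_eq {1}aE {2}bE -zE /Ft /Fz.
  rewrite /= !(polyCB, polyCD, polyCM, polyC_exp) /L /S polyCB.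
  by apply: quadric_taylor; rewrite -[2%:R]polyC_natr two0P.
by apply: ideal_mulD; [apply: ideal_mulD|]; apply: ideal_mulMl => //; apply: ideal_mul_in.
Qed.

(** If the z-derivative [Fz] is nonzero, t - T0 generates m modulo m^2, the other generator being
    eliminated by [tangent_relation]; otherwise z - z1 does, [Ft] being nonzero. The tangent
    derivative shows that the generator is not 0 modulo m^2. *)
Lemma cotangent_point : cotangent_dim m 1.
Proof.
have [_ mD mM] := mI.
suff [G [mG dG gen]] : exists G, [/\ m (phi G), tangent_der G != 0 &
    forall y, m y -> exists a, ideal_mul m m (y - a * phi G)].
  exists (fun=> phi G); split=> // [y /gen [a ya]|a].
    by exists (fun=> a); rewrite big_ord_recl big_ord0 addr0.
  rewrite big_ord_recl big_ord0 addr0 => ya i; rewrite ord1.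
  have [pa paE] := phi_surj (a ord0); move: ya; rewrite -paE -rmorphM => /tangent_der_sq.
  rewrite tangent_derM; have /maximal_tangent -> := mG; rewrite mulr0 add0r => /eqP.
  by rewrite mulf_eq0 (negPf dG) orbF => /eqP /maximal_tangent.
have gen2 y : m y -> exists Q r, y = Q * Lam + r * tau.
  have [p <-] := phi_surj y => /maximal_tangent v0.
  have [Q [r ->]] := tangent_decomp p; exists (phi Q), (phi r%:P).
  by rewrite v0 !polyC0 addr0 rmorphD !rmorphM.
have [F0|F0] := eqVneq Fz 0.
  have Ft0 : Ft != 0 by have [] := smooth zE; rewrite // /Fz in F0 *; rewrite F0 eqxx.
  exists ('X - z1%:P%:P); split=> //.
    by rewrite -polyCN -polyCN tangent_derD tangent_derX tangent_derC derivC horner0 mulr0 addr0.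
  move=> y /gen2 [Q [r ->]]; exists Q; rewrite addrC addKr.
  have := ideal_mulMl (r * phi (Ft^-1)%:P%:P) mI tangent_relation.
  rewrite F0 !polyC0 rmorph0 mul0r add0r mulrA -(mulrA r) -rmorphM -!polyCM mulVf //.
  by rewrite rmorph1 mulr1.
exists ('X - T0%:P)%:P; split=> //.
  by rewrite tangent_derC derivXsubC hornerC mulr1.
move=> y /gen2 [Q [r ->]]; exists (r - Q * phi (Fz^-1 * Ft)%:P%:P).
have := ideal_mulMl (Q * phi (Fz^-1)%:P%:P) mI tangent_relation; congr (ideal_mul m m _).
have E : phi (Fz^-1)%:P%:P * phi Fz%:P%:P = 1 by rewrite -rmorphM -!polyCM mulVf // rmorph1.
rewrite !polyCM rmorphM.
transitivity (Q * (phi (Fz^-1)%:P%:P * phi Fz%:P%:P) * Lam + Q * phi (Fz^-1)%:P%:P * phi Ft%:P%:P * tau).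
  by ring.
by rewrite E; ring.
Qed.

End Point.

Theorem cotangent_quadratic : cotangent_dim m 1.
Proof. by have [T0 [z1 [zE mT mz]]] := maximal_point; apply: cotangent_point zE mT mz. Qed.

End CotangentSpace.

End QuadraticCurve.

Lemma pushO_eq (k : closedFieldType) q1 q2 (U : set (P1 k)) (f g : pushO q1 q2 U) :
  (forall w, f w = g w) -> f = g.
Proof. by move=> E; apply: val_inj; apply/funext; exact: E. Qed.

Lemma poly_reverse (k : fieldType) (p : {poly k}) N : (size p <= N.+1)%N ->
  exists2 r : {poly k}, (size r <= N.+1)%N & forall t, t != 0 -> r.[t] = t ^+ N * p.[t^-1].
Proof.
move=> sp; exists (\poly_(i < N.+1) p`_(N - i)); first exact: size_poly.
move=> t t0; rewrite horner_poly (horner_coef_wide _ sp) mulr_sumr (reindex_inj rev_ord_inj).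
apply: eq_bigr => i _ /=; have iN : (i <= N)%N by rewrite -ltnS.
rewrite subSS subKn // mulrCA; congr (_ * _).
by rewrite exprVn expfB_cond ?negb_or // ?(negPf t0).
Qed.

(** * Gluing the two charts *)

Section ChartGenerator.
Variables (k : closedFieldType) (q1 q2 : {mpoly k[6]}).

(** Over the part of the chart where d is nonzero, 1 and lam form a basis of the regular functions
    after inverting d. Leaving d general covers both the whole chart (d = 1) and the overlap (d =
    t). *)
Definition chart_gen (j : bool) (B A : {poly k}) (lam : P1 k * G36 k -> k) :=
  forall U (d : {poly k}), d != 0 ->
  (forall L, U L <-> hcoord L (den_idx j) != 0 /\ d.[tau j L] != 0) ->
  [/\ regular (fun w : Zover q1 q2 U => lam (val w) : k^o),
      forall w : Zover q1 q2 U,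
        lam (val w) ^+ 2 + B.[tau j (val w).1] * lam (val w) = A.[tau j (val w).1],
      forall f : Zover q1 q2 U -> k^o, regular f -> exists m (p q : {poly k}),
        forall w, d.[tau j (val w).1] ^+ m * f w =
          p.[tau j (val w).1] + q.[tau j (val w).1] * lam (val w) &
      forall p q : {poly k}, (forall w : Zover q1 q2 U,
        p.[tau j (val w).1] + q.[tau j (val w).1] * lam (val w) = 0) -> p = 0 /\ q = 0].

Section AffineChart.
Variables (j : bool) (B A : {poly k}) (lam : P1 k * G36 k -> k) (U : set (P1 k)).
Hypothesis C : chart_gen j B A lam.
Hypothesis UE : forall L, U L <-> hcoord L (den_idx j) != 0.

Let UE1 L : U L <-> hcoord L (den_idx j) != 0 /\ (1 : {poly k}).[tau j L] != 0.
Proof. by rewrite UE hornerC oner_neq0; split=> [|[]]. Qed.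

Let R := pushO q1 q2 U.

Lemma reg_lam : regular (fun w : Zover q1 q2 U => lam (val w) : k^o).
Proof. by have [] := C (oner_neq0 _) UE1. Qed.

Lemma reg_poly (p : {poly k}) : regular (fun w : Zover q1 q2 U => p.[tau j (val w).1] : k^o).
Proof.
have := @regular_tau _ q1 q2 j U p 1 (fun L => proj1 (UE1 L)); congr regular.
by apply/funext => w; rewrite hornerC divr1.
Qed.

Definition chart_val (P : {poly {poly k}}) (w : Zover q1 q2 U) : k^o :=
  (map_poly (horner_eval (tau j (val w).1)) P).[lam (val w)].

Lemma chart_val_regular P : chart_val P \in @regularb _ q1 q2 U.
Proof.
elim/poly_ind: P => [|P p IH].
  have -> : chart_val 0 = 0 by apply/funext => w; rewrite /chart_val rmorph0 horner0.
  exact: rpred0.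
have -> : chart_val (P * 'X + p%:P) =
  chart_val P * (fun w : Zover q1 q2 U => lam (val w) : k^o) +
  (fun w : Zover q1 q2 U => p.[tau j (val w).1] : k^o).
  apply/funext => w; rewrite /chart_val rmorphD rmorphM /= map_polyX map_polyC /=.
  by rewrite !hornerE.
by apply: rpredD; [apply: rpredM => //|]; apply/asboolP; [apply: reg_lam|apply: reg_poly].
Qed.

Definition chart_map P : R := PushO (chart_val_regular P).

Lemma chart_map_zmod : zmod_morphism chart_map.
Proof.
move=> P Q; apply: pushO_eq => w.
transitivity (chart_val P w - chart_val Q w) => //.
by rewrite /= /chart_val rmorphB hornerD hornerN.
Qed.

Lemma chart_map_monoid : monoid_morphism chart_map.
Proof.
split=> [|P Q]; apply: pushO_eq => w.
  by rewrite /= /chart_val rmorph1 hornerC.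
transitivity (chart_val P w * chart_val Q w) => //.
by rewrite /= /chart_val rmorphM hornerM.
Qed.

HB.instance Definition _ := GRing.isZmodMorphism.Build {poly {poly k}} R chart_map chart_map_zmod.
HB.instance Definition _ := GRing.isMonoidMorphism.Build {poly {poly k}} R chart_map chart_map_monoid.

Lemma chart_mapC p w : chart_map p%:P w = p.[tau j (val w).1].
Proof. by rewrite /= /chart_val map_polyC /= hornerC. Qed.

Lemma chart_map_line p q w : chart_map (p%:P + q%:P * 'X) w =
  p.[tau j (val w).1] + q.[tau j (val w).1] * lam (val w).
Proof.
by rewrite /= /chart_val rmorphD rmorphM /= map_polyX !map_polyC /= hornerD hornerM !hornerC hornerX.
Qed.

Lemma chart_map_line_surj f : exists p q, chart_map (p%:P + q%:P * 'X) = f.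
Proof.
have [_ _ gen _] := C (oner_neq0 _) UE1; have /asboolP rf := valP f.
have [m [p [q E]]] := gen _ rf; exists p, q; apply: pushO_eq => w.
by rewrite chart_map_line -E hornerC expr1n mul1r.
Qed.

Lemma chart_map_surj f : exists P, chart_map P = f.
Proof. by have [p [q E]] := chart_map_line_surj f; exists (p%:P + q%:P * 'X). Qed.

Lemma chart_map_ker P : chart_map P = 0 <-> exists Q, P = Q * quadratic_eq B A.
Proof.
have [_ quad _ free] := C (oner_neq0 _) UE1.
have F0 : chart_map (quadratic_eq B A) = 0.
  apply: pushO_eq => w; rewrite /= /chart_val /quadratic_eq expr2 rmorphB rmorphD !rmorphM /=.
  rewrite map_polyX !map_polyC /= hornerD hornerN hornerD !hornerM hornerX !hornerC.
  by rewrite -expr2 quad subrr.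
split=> [P0|[Q ->]]; last by rewrite rmorphM /= F0 mulr0.
have [Q [p [q PE]]] := quadratic_divmod B A P; exists Q.
have E : chart_map (p%:P + q%:P * 'X) = 0.
  by rewrite -[RHS]P0 [in RHS]PE [in RHS]rmorphD [in RHS]rmorphM /= F0 mulr0 add0r.
have [|p0 q0] := free p q; first by move=> w; rewrite -chart_map_line E.
by rewrite PE p0 q0 mul0r !addr0.
Qed.

End AffineChart.

(** * Comparison of the charts, genus and non-singularity *)

Section Gluing.
Hypothesis char2 : 2%N \in [pchar k].
Let two0 : 2%:R = 0 :> k. Proof. exact: pcharf0. Qed.
Let two0P : 2%:R = 0 :> {poly k}.
Proof. by rewrite -[2%:R]polyC_natr two0. Qed.

Variables (B1 A1 B0 A0 : {poly k}) (lam1 lam0 : P1 k * G36 k -> k) (T0 : k).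
Hypothesis C1 : chart_gen true B1 A1 lam1.
Hypothesis C0 : chart_gen false B0 A0 lam0.
Hypothesis smooth1 : smooth_quadratic B1 A1.
Hypothesis smooth0 : smooth_quadratic B0 A0.
Hypothesis rB1 : root B1 T0.
Hypothesis revB : forall t, t != 0 -> B1.[t] = t ^+ 3 * B0.[t^-1].
Hypothesis revA : forall t, t != 0 -> A1.[t] = t ^+ 6 * A0.[t^-1].

Let X0 : 'X != 0 :> {poly k}. Proof. by rewrite polyX_eq0. Qed.

Let U0 := @U_t0 k.
Let U1 := @U_t1 k.
Let U01 := U0 `&` U1.
Let UE0 L : U0 L <-> hcoord L (den_idx false) != 0. Proof. by []. Qed.
Let UE1 L : U1 L <-> hcoord L (den_idx true) != 0. Proof. by []. Qed.

Let UE01 (j : bool) L : U01 L <-> hcoord L (den_idx j) != 0 /\ ('X : {poly k}).[tau j L] != 0.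
Proof.
rewrite hornerX /tau mulf_eq0 invr_eq0 negb_or.
by case: j; split=> [[a b]|[a /andP [b c]]]; split=> //; apply/andP.
Qed.

Lemma tau_inv (w : Zover q1 q2 U01) : tau false (val w).1 = (tau true (val w).1)^-1.
Proof. by rewrite /tau invf_div. Qed.

Lemma tau_neq0 (w : Zover q1 q2 U01) : tau true (val w).1 != 0.
Proof.
have /set_mem [_ /=] := valP w => /(UE01 true) [_]; by rewrite hornerX.
Qed.

Lemma norm1_eq0 p q : p ^+ 2 + p * q * B1 + q ^+ 2 * A1 = 0 -> p = 0 /\ q = 0.
Proof. exact: norm_eq0 rB1. Qed.

Lemma poly_inv_eq0 (p : {poly k}) : (forall t, t != 0 -> p.[t^-1] = 0) -> p = 0.
Proof.
move=> E; apply: (poly_eq_except X0).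
by move=> t; rewrite hornerX horner0 => t0; rewrite -[t]invrK E ?invr_eq0.
Qed.

(** [B0] may have no zero in its chart, so the statement is transported from the other chart. *)
Lemma norm0_eq0 p q : p ^+ 2 + p * q * B0 + q ^+ 2 * A0 = 0 -> p = 0 /\ q = 0.
Proof.
move=> E; pose N := (size p + size q)%N.
(* Reversal in degree N + 3 for p and N for q, since z has weight 3. *)
have [|r _ rE] := @poly_reverse k p (N + 3).
  by rewrite /N -addnS -addnA leq_addr.
have [|r' _ r'E] := @poly_reverse k q N.
  by rewrite leqW ?leq_addl.
have [r0 r'0] : r = 0 /\ r' = 0.
  apply: norm1_eq0; apply: (poly_eq_except X0).
  move=> t; rewrite hornerX horner0 => t0; rewrite !hornerE /= rE // r'E // revB // revA //.
  transitivity ((t ^+ N) ^+ 2 * t ^+ 6 * (p ^+ 2 + p * q * B0 + q ^+ 2 * A0).[t^-1]).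
    by rewrite !hornerE /= exprD; move: (t ^+ N) (t^-1) => *; ring.
  by rewrite E horner0 mulr0.
by split; apply: poly_inv_eq0 => t t0;
  [have := rE t t0|have := r'E t t0]; rewrite ?r0 ?r'0 horner0 => /esym /eqP;
  rewrite mulf_eq0 expf_eq0 (negPf t0) andbF /= => /eqP.
Qed.

Lemma integral_U01 : integral_ring (pushO q1 q2 U01).
Proof.
have [_ quad gen free] := C1 X0 (UE01 true).
split=> [E|f f' ff'].
  have [|/eqP] := free 1 0; last by rewrite oner_eq0.
  move=> w; rewrite hornerC horner0 mul0r addr0.
  exact: (congr1 (fun f : pushO q1 q2 U01 => f w) E).
have /asboolP rf := valP f; have [m [p [q fE]]] := gen _ rf.
have /asboolP rf' := valP f'; have [m' [p' [q' fE']]] := gen _ rf'.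
have [] := free (p * p' + q * q' * A1) (p * q' + p' * q - q * q' * B1).
  move=> w; have /= E := congr1 (fun f : pushO q1 q2 U01 => f w) ff'.
  have := congr2 *%R (fE w) (fE' w); rewrite mulrACA [f w * f' w]E mulr0 => /esym <-.
  rewrite !hornerE /= -quad; ring.
move=> e0 e1; have tX (w : Zover q1 q2 U01) n : ('X : {poly k}).[tau true (val w).1] ^+ n != 0.
  by rewrite hornerX expf_neq0 // tau_neq0.
have [[p0 q0]|[p0 q0]] := quadratic_domain char2 norm1_eq0 e0 e1; [left|right];
  apply: pushO_eq => w; [apply: (mulfI (tX w m)); rewrite fE|apply: (mulfI (tX w m')); rewrite fE'];
  by rewrite p0 q0 !horner0 mul0r addr0 mulr0.
Qed.

Lemma lam1_regular : (fun w : Zover q1 q2 U01 => lam1 (val w) : k^o) \in @regularb _ q1 q2 U01.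
Proof. by apply/asboolP; have [] := C1 X0 (UE01 true). Qed.

Lemma lam0_regular : (fun w : Zover q1 q2 U01 => lam0 (val w) : k^o) \in @regularb _ q1 q2 U01.
Proof. by apply/asboolP; have [] := C0 X0 (UE01 false). Qed.

Lemma spoly_regular (p : {poly k}) :
  (fun w : Zover q1 q2 U01 => p.[tau false (val w).1] : k^o) \in @regularb _ q1 q2 U01.
Proof.
have /asboolP rX : regular (fun w : Zover q1 q2 U0 => p.[tau false (val w).1] : k^o) :=
  reg_poly UE0 p.
exact: (regular_res (@subIsetl _ U0 U1) (PushO rX)).
Qed.

Definition l1 : pushO q1 q2 U01 := PushO lam1_regular.
Definition l0 : pushO q1 q2 U01 := PushO lam0_regular.
Definition spoly p : pushO q1 q2 U01 := PushO (spoly_regular p).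

(** With s = 1/t, lam_0 and s^3 lam_1 both satisfy z^2 + B_0 z = A_0. In an integral ring two such
    roots differ by 0 or B_0. *)
Lemma comparison : exists h : {poly k}, forall w : Zover q1 q2 U01,
  lam0 (val w) = (tau false (val w).1) ^+ 3 * lam1 (val w) + h.[tau false (val w).1].
Proof.
have [_ quad1 _ _] := C1 X0 (UE01 true); have [_ quad0 _ _] := C0 X0 (UE01 false).
have [_ dom] := integral_U01.
case: (dom (l0 - spoly ('X ^+ 3) * l1) (l0 - spoly ('X ^+ 3) * l1 + spoly B0)) => [|E|E].
- apply: pushO_eq => w; set s := tau false (val w).1.
  transitivity ((lam0 (val w) - ('X ^+ 3).[s] * lam1 (val w)) *
    (lam0 (val w) - ('X ^+ 3).[s] * lam1 (val w) + B0.[s])); first by [].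
  have := quad1 w; have := quad0 w; have t0 := tau_neq0 w.
  have ts : tau true (val w).1 = s^-1 by rewrite /s tau_inv invrK.
  have s0 : s != 0 by rewrite /s tau_inv invr_eq0.
  rewrite revB // revA // ts invrK -/s hornerXn.
  clear ts; move: (lam0 _) (lam1 _) s s0 B0.[_] A0.[_] => l l' s' s0 b a <- E.
  transitivity (s' ^+ 6 * (l' ^+ 2 + s'^-1 ^+ 3 * b * l' - s'^-1 ^+ 6 * (l ^+ 2 + b * l))
    + 2%:R * (l ^+ 2 + b * l - s' ^+ 3 * b * l' - l * s' ^+ 3 * l')).
    by field.
  by rewrite E subrr mulr0 two0 mul0r addr0.
- exists 0 => w; rewrite horner0 addr0.
  have {E} : lam0 (val w) - ('X ^+ 3).[tau false (val w).1] * lam1 (val w) = 0.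
    exact: (congr1 (fun f : pushO q1 q2 U01 => f w) E).
  by move/eqP; rewrite subr_eq0 hornerXn => /eqP.
- exists (- B0) => w.
  have {E} : lam0 (val w) - ('X ^+ 3).[tau false (val w).1] * lam1 (val w)
      + B0.[tau false (val w).1] = 0.
    exact: (congr1 (fun f : pushO q1 q2 U01 => f w) E).
  by move/eqP; rewrite addr_eq0 subr_eq hornerXn hornerN addrC => /eqP.
Qed.

(** On the overlap the coefficient of lam_1 is a Laurent polynomial in t. The chart of t supplies
    the exponents at least 0 and, by [comparison], the other chart those at most -3; the exponents
    -1 and -2 remain. The part without lam_1 contributes nothing. *)
Lemma glued_genus : curve_genus q1 q2 2.
Proof.
have [h hE] := comparison; have [_ _ gen free] := C1 X0 (UE01 true).
exists (fun i : 'I_2 => spoly ('X ^+ i.+1) * l1); split=> [f|a].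
  have /asboolP rf := valP f; have [m [p [q fE]]] := gen _ rf.
  pose M := (m + size p)%N.
  (* Now f = s^(M+3) (p' + q' lam_1) with s = 1/t. The coefficients of q' up to degree M belong to
     the chart of 1/t, those of degrees M + 1 and M + 2 are the coordinates on s^2 lam_1 and s
     lam_1, and the rest belong to the chart of t. *)
  pose q' := 'X^(M.+3 - m) * q; pose p' := 'X^(M.+3 - m) * p.
  have mM : (m <= M.+3)%N by rewrite -!addnS leq_addr.
  pose d := drop_poly M.+1 q'; have qE := poly_take_drop M.+1 q'.
  have dE := poly_take_drop 2 d; have pE := poly_take_drop M.+3 p'.
  have [|rp _ rpE] := @poly_reverse k (take_poly M.+3 p') M.+3.
    exact: leq_trans (size_take_poly _ _) _.
  have [|rq _ rqE] := @poly_reverse k (take_poly M.+1 q') M; first exact: size_take_poly.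
  exists (fun i => if i == ord0 then d`_1 else d`_0).
  exists (chart_map C0 UE0 ((rp - rq * h)%:P + rq%:P * 'X)).
  exists (- chart_map C1 UE1 ((drop_poly M.+3 p')%:P + (drop_poly 2 d)%:P * 'X)).
  apply: pushO_eq => w. set x := tau true (val w).1; set s := tau false (val w).1.
  have x0 : x != 0 by exact: tau_neq0.
  have sE : s = x^-1 by exact: tau_inv.
  have s0 : s != 0 by rewrite sE invr_eq0.
  have -> : (f - \sum_(i < 2) (if i == ord0 then d`_1 else d`_0) *: (spoly ('X ^+ i.+1) * l1)) w
      = f w - (d`_1 * (s * lam1 (val w)) + d`_0 * (s ^+ 2 * lam1 (val w))).
    transitivity (f w - (d`_1 * (('X ^+ 1).[s] * lam1 (val w)) + d`_0 * (('X ^+ 2).[s] * lam1 (val w)))).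
      by rewrite big_ord_recl big_ord1.
    by rewrite !hornerXn expr1.
  have -> : (res (@subIsetl _ U0 U1) (chart_map C0 UE0 ((rp - rq * h)%:P + rq%:P * 'X))
     - res (@subIsetr _ U0 U1) (- chart_map C1 UE1 ((drop_poly M.+3 p')%:P + (drop_poly 2 d)%:P * 'X))) w
     = (rp - rq * h).[s] + rq.[s] * lam0 (val w) -
       - ((drop_poly M.+3 p').[x] + (drop_poly 2 d).[x] * lam1 (val w)).
    rewrite -(chart_map_line C0 UE0 _ _ (Zover_incl (@subIsetl _ U0 U1) w)).
    by rewrite -(chart_map_line C1 UE1 _ _ (Zover_incl (@subIsetr _ U0 U1) w)).
  have {}fE : f w = s ^+ M.+3 * (p'.[x] + q'.[x] * lam1 (val w)).
    transitivity (s ^+ M.+3 * (x ^+ (M.+3 - m) * (p.[x] + q.[x] * lam1 (val w)))); last first.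
      by rewrite !hornerM !hornerXn mulrDr !mulrA.
    rewrite -fE hornerX (mulrA (x ^+ _)) -exprD subnK // mulrA -exprMn sE mulVf //.
    by rewrite expr1n mul1r.
  have dx : d.[x] = d`_0 + d`_1 * x + (drop_poly 2 d).[x] * x ^+ 2.
    rewrite -{1}dE hornerD hornerM hornerXn (horner_coef_wide x (size_take_poly 2 d)).
    by rewrite big_ord_recl big_ord1 !coef_take_poly /= mulr1.
  have qx : q'.[x] = (take_poly M.+1 q').[x] + d.[x] * x ^+ M.+1.
    by rewrite -[in LHS]qE hornerD hornerM hornerXn.
  have px : p'.[x] = (take_poly M.+3 p').[x] + (drop_poly M.+3 p').[x] * x ^+ M.+3.
    by rewrite -[in LHS]pE hornerD hornerM hornerXn.
  have xE : s^-1 = x by rewrite sE invrK.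
  rewrite fE hE qx px dx !hornerD !hornerN !hornerM rpE // rqE // xE -/s.
  have xsM n : x ^+ n = (s ^+ n)^-1 by rewrite -xE exprVn.
  rewrite !xsM -xE; have := expf_neq0 M s0; rewrite !exprS; move: (s ^+ M) => y y0.
  by field; rewrite s0 y0.
move=> [f0 [f1 E]].
have [p0 [q0 f0E]] := chart_map_line_surj C0 UE0 f0.
have [p1 [q1' f1E]] := chart_map_line_surj C1 UE1 f1.
pose N := (size p0 + size (q0 * h)%R + size q0)%N.
have [|r sr rE] := @poly_reverse k q0 N; first by rewrite leqW ?leq_addl.
have [|r' _ r'E] := @poly_reverse k (p0 + q0 * h) N.+3.
  rewrite (leq_trans (size_polyD _ _)) // geq_max /N -!addnS; apply/andP; split.
    by rewrite -addnA leq_addr.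
  by rewrite -addnA addnCA leq_addr.
move: N sr rE r'E => N sr rE r'E.
(* The relation is multiplied by t^(N+3). The first chart then contributes to the coefficient of
   lam_1 in degrees at least N + 3, the second in degrees at most N, so the degrees N + 1 and N + 2
   isolate a_1 and a_0. *)
have [|_ Q0] := free ('X^(N.+3) * p1 - r')
    ('X^(N.+3) * q1' - r + (a 0)%:P * 'X^(N.+2) + (a 1)%:P * 'X^(N.+1)).
  move=> w; set x := tau true (val w).1; set s := tau false (val w).1.
  have x0 : x != 0 by exact: tau_neq0.
  have sE : s = x^-1 by exact: tau_inv.
  have {}E : a 0 * (s * lam1 (val w)) + a 1 * (s ^+ 2 * lam1 (val w)) =
      p0.[s] + q0.[s] * lam0 (val w) - (p1.[x] + q1'.[x] * lam1 (val w)).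
    transitivity ((\sum_(i < 2) a i *: (spoly ('X ^+ i.+1) * l1)) w).
      transitivity (a 0 * (('X ^+ 1).[s] * lam1 (val w)) + a 1 * (('X ^+ 2).[s] * lam1 (val w))).
        by rewrite !hornerXn expr1.
      have -> : 1 = lift ord0 ord0 :> 'I_2 by exact: val_inj.
      by rewrite big_ord_recl big_ord1.
    rewrite E -f0E -f1E.
    rewrite -(chart_map_line C0 UE0 _ _ (Zover_incl (@subIsetl _ U0 U1) w)).
    by rewrite -(chart_map_line C1 UE1 _ _ (Zover_incl (@subIsetr _ U0 U1) w)).
  rewrite !(hornerD, hornerN, hornerXn, hornerC, hornerM) rE // r'E // hornerD hornerM.
  move: E; rewrite hE -/s -sE.
  have -> : s = x^-1 by [].
  rewrite -(addn3 N) -(addn2 N) -(addn1 N) !exprD; have := expf_neq0 N x0.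
  move: (x ^+ N) (p0.[_]) (q0.[_]) (h.[_]) (lam1 _) p1.[x] q1'.[x] => y P0 Q0 H l P1' Q1 y0 E.
  transitivity (y * x ^+ 3 * (a 0 * (x^-1 * l) + a 1 * (x^-1 ^+ 2 * l) -
     (P0 + Q0 * (x^-1 ^+ 3 * l + H) - (P1' + Q1 * l)))); last by rewrite E subrr mulr0.
  by field.
have coef0 n : ('X^(N.+3) * q1' - r + (a 0)%:P * 'X^(N.+2) + (a 1)%:P * 'X^(N.+1))`_n = 0.
  by rewrite Q0 coef0.
have r0 n : (N < n)%N -> r`_n = 0 by move=> Nn; apply/nth_default/(leq_trans sr).
move=> i; case: (unliftP ord0 i) => [i' ->|->].
  have := coef0 N.+1; rewrite !(coefD, coefN, coefXnM, coefCM, coefXn) r0 //.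
  rewrite ltnS leqnSn eqxx (ltn_eqF (ltnSn _)) oppr0 mulr0 !add0r mulr1.
  by rewrite (ord1 i') => <-; congr (a _); apply: val_inj.
have := coef0 N.+2; rewrite !(coefD, coefN, coefXnM, coefCM, coefXn) r0 //.
by rewrite ltnSn eqxx (gtn_eqF (ltnSn _)) oppr0 mulr0 addr0 !add0r mulr1.
Qed.

Lemma glued_nonsingular : curve_nonsingular q1 q2.
Proof.
have surj1 := chart_map_surj C1 UE1; have ker1 := chart_map_ker C1 UE1.
have surj0 := chart_map_surj C0 UE0; have ker0 := chart_map_ker C0 UE0.
split; [split|move=> m mm|move=> m mm].
- exact: (integral_quadratic char2 norm0_eq0 surj0 ker0).
- exact: (integral_quadratic char2 norm1_eq0 surj1 ker1).
- exact: integral_U01.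
- exact: (cotangent_quadratic char2 smooth0 surj0 ker0).
- exact: (cotangent_quadratic char2 smooth1 surj1 ker1).
Qed.

Lemma glued_given_by : curve_given_by q1 q2 (quadratic_eq B1 A1).
Proof.
exists (chart_map C1 UE1); split; last exact: chart_map_ker.
  exact: (chart_mapC C1 UE1).
exact: chart_map_surj.
Qed.

End Gluing.
End ChartGenerator.

Lemma mpoly_chain_rule (k : comNzRingType) n (p : {mpoly k[n]}) (f : 'I_n -> {poly k}) :
  exists P : {poly k}, forall T, P.[T] = p.@[fun i => (f i).[T]] /\
    P^`().[T] = \sum_i (f i)^`().[T] * (p^`M(i)).@[fun i => (f i).[T]].
Proof.
pose E (q : {mpoly k[n]}) := exists P : {poly k}, forall T,
  P.[T] = q.@[fun i => (f i).[T]] /\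
  P^`().[T] = \sum_i (f i)^`().[T] * (q^`M(i)).@[fun i => (f i).[T]].
have EC c : E c%:MP.
  exists c%:P => T; rewrite hornerC mevalC derivC horner0 big1 // => i _.
  by rewrite mderivC meval0 mulr0.
have ED q q' : E q -> E q' -> E (q + q').
  move=> [P HP] [P' HP']; exists (P + P') => T; have [e1 e2] := HP T; have [e1' e2'] := HP' T.
  rewrite hornerD e1 e1' mevalD derivD hornerD e2 e2' -big_split; split=> //.
  by apply: eq_bigr => i _; rewrite mderivD mevalD mulrDr.
have EM q q' : E q -> E q' -> E (q * q').
  move=> [P HP] [P' HP']; exists (P * P') => T; have [e1 e2] := HP T; have [e1' e2'] := HP' T.
  rewrite hornerM e1 e1' mevalM derivM hornerD !hornerM e1 e1' e2 e2'; split=> //.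
  rewrite [in RHS](eq_bigr (fun i => (f i)^`().[T] * q^`M(i).@[fun i => (f i).[T]] *
    q'.@[fun i => (f i).[T]] + q.@[fun i => (f i).[T]] *
    ((f i)^`().[T] * q'^`M(i).@[fun i => (f i).[T]]))).
    by rewrite big_split /= -mulr_suml -mulr_sumr.
  by move=> i _; rewrite mderivM mevalD !mevalM /=; ring.
have EX i : E 'X_i.
  exists (f i) => T; rewrite mevalXU; split=> //; rewrite (bigD1 i) //= big1 => [|i' ii'].
    by rewrite mderivX mnm1E eqxx -{1}[U_(i)%MM]add0m addmK mpolyX0 mevalZ meval1 addr0 !mulr1.
  by rewrite mderivX mnm1E eq_sym (negPf ii') mevalZ mul0r mulr0.
rewrite -/(E p) [p]mpolyE; apply: (big_ind E) => [||m _]; [by rewrite -mpolyC0|exact: ED|].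
rewrite -mul_mpolyC; apply: (EM) => //; rewrite mpolyXE_id.
apply: (big_ind E) => [||i _]; [by rewrite -mpolyC1|exact: EM|].
by elim: (m i) => [|e IH]; rewrite ?expr0 ?exprS -?mpolyC1 //; apply: (EM).
Qed.

(** * Singular points of the pencil *)

Section SmoothPencil.
Variable k : closedFieldType.
Hypothesis char2 : 2%N \in [pchar k].
Let two0 : 2%:R = 0 :> k. Proof. exact: pcharf0. Qed.

Variables (q1 q2 : {mpoly k[6]}) (j : bool).
Variables (n u v : 'I_3 -> {poly k}) (g gi : 'M[{poly k}]_6) (kap : {poly k}).
Hypothesis ggi : g *m gi = 1%:M.
Hypothesis qE : forall T (w : 'rV[k]_6),
  lc j T 0 * q1.@[(w *m mev g T) 0] + lc j T 1 * q2.@[(w *m mev g T) 0] =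
  dq (pev n T) (pev u T) (pev v T) w.
Hypothesis nT : forall T, exists l, forall i, i != l -> (n i).[T] != 0.
Hypothesis NS : nonsingular_ci q1 q2.

Let qnum := if j then q1 else q2.

(** The vector lies in the radical of the polar form of the member over T, and the form vanishes at
    it. So along v0 + s y the form is a multiple of s^2, and its derivative at s = 0 is 0. *)
Lemma pencil_gradient T l a b : (n l).[T] = 0 -> (u l).[T] * a ^+ 2 + (v l).[T] * b ^+ 2 = 0 ->
  forall i, lc j T 0 * q1^`M(i).@[(vec l a b *m mev g T) 0] +
            lc j T 1 * q2^`M(i).@[(vec l a b *m mev g T) 0] = 0.
Proof.
move=> nl uv; set v0 := vec l a b *m mev g T.
pose D i := lc j T 0 * q1^`M(i).@[v0 0] + lc j T 1 * q2^`M(i).@[v0 0].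
suff D0 (y : 'rV[k]_6) : \sum_i y 0 i * D i = 0.
  move=> i; have := D0 (delta_mx 0 i); rewrite (bigD1 i) //= big1 ?addr0 => [|t ti].
    by rewrite mxE !eqxx mul1r.
  by rewrite mxE (negPf ti) andbF mul0r.
pose e := y *m mev gi T; have yE : y = e *m mev g T.
  by rewrite -mulmxA -map_mxM (mulmx1C ggi) map_mx1 mulmx1.
pose f i : {poly k} := (v0 0 i)%:P + (y 0 i)%:P * 'X.
have [P1 P1E] := mpoly_chain_rule q1 f; have [P2 P2E] := mpoly_chain_rule q2 f.
have fE s i : (f i).[s] = ((vec l a b + s *: e) *m mev g T) 0 i.
  rewrite mulmxDl -scalemxAl -yE !mxE -/v0 hornerD hornerM !hornerC hornerX mulrC.
  by rewrite /v0 mxE.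
have PE : (lc j T 0)%:P * P1 + (lc j T 1)%:P * P2 =
    (dq (pev n T) (pev u T) (pev v T) e)%:P * ('X * 'X).
  apply: poly_ext => s; rewrite hornerD !hornerM !hornerC hornerX.
  rewrite (proj1 (P1E s)) (proj1 (P2E s)) !(meval_eq _ (fE s)) qE dqD // dqZ polZr //.
  rewrite dq_vec pol_vec /pev nl !mul0r add0r uv mulr0 addr0 add0r.
  by rewrite mulrC -expr2.
have := congr1 (fun p => p^`().[0]) PE.
rewrite !(derivD, derivM, derivC, derivX) !(hornerD, hornerM, hornerC, hornerX, horner0, mul0r, mulr0, addr0, add0r).
rewrite (proj2 (P1E 0)) (proj2 (P2E 0)) !mulr_sumr -big_split /=.
move=> S0; rewrite -[RHS]S0; apply: eq_bigr => i _.
rewrite /f deriv_line hornerC !(@meval_eq _ _ _ (v0 0)); first by rewrite /D; ring.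
  by move=> t; rewrite hornerD hornerM !hornerC hornerX mulr0 addr0.
by move=> t; rewrite hornerD hornerM !hornerC hornerX mulr0 addr0.
Qed.

(** The diagonal identity is differentiated in T. By [pencil_gradient] the motion of the vector
    contributes nothing, so the expression is the value at v0 of the quadric with coefficient T. If
    it were 0, both quadrics would vanish at v0 with dependent gradients. *)
Lemma pencil_transversal T l a b : (n l).[T] = 0 ->
  (u l).[T] * a ^+ 2 + (v l).[T] * b ^+ 2 = 0 -> a != 0 \/ b != 0 ->
  (n l)^`().[T] * a * b + (u l)^`().[T] * a ^+ 2 + (v l)^`().[T] * b ^+ 2 != 0.
Proof.
move=> nl uv ab; apply/eqP => der0; set v0 := vec l a b *m mev g T.
have v00 : v0 != 0.
  apply/eqP => v00; have w0 : vec l a b = 0.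
    by rewrite -[LHS]mulmx1 -(mev_ggi ggi T) mulmxA -/v0 v00 mul0mx.
  have := xc_vec l a b l; have := yc_vec l a b l; rewrite w0 /xc /yc !mxE eqxx => b0 a0.
  by case: ab; rewrite -?a0 -?b0 eqxx.
have grad := pencil_gradient nl uv.
pose f i : {poly k} := (map_mx polyC (vec l a b) *m g) 0 i.
have [P1 P1E] := mpoly_chain_rule q1 f; have [P2 P2E] := mpoly_chain_rule q2 f.
have fE s i : (f i).[s] = (vec l a b *m mev g s) 0 i.
  by rewrite /f !mxE horner_sum; apply: eq_bigr => t _; rewrite hornerM !mxE hornerC.
pose L i : {poly k} := if (i == 0 :> 'I_2) == j then 'X else 1%:P.
have LE s i : (L i).[s] = lc j s i.
  by rewrite /L /lc; case: ifP; rewrite ?hornerX ?hornerC.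
have PE : L 0 * P1 + L 1 * P2 = n l * (a * b)%:P + u l * (a ^+ 2)%:P + v l * (b ^+ 2)%:P.
  apply: poly_ext => s; rewrite !hornerD !hornerM !hornerC !LE.
  rewrite (proj1 (P1E s)) (proj1 (P2E s)) !(meval_eq _ (fE s)) qE dq_vec /pev.
  ring.
have vE i : (f i).[T] = v0 0 i by exact: fE.
have num0 : qnum.@[v0 0] = 0.
  have := congr1 (fun p => p^`().[T]) PE.
  rewrite /= !(derivD, derivM, derivC) !(hornerD, hornerM, hornerC, horner0) !LE.
  rewrite (proj2 (P1E T)) (proj2 (P2E T)) (proj1 (P1E T)) (proj1 (P2E T)) !(meval_eq _ vE).
  rewrite !mulr0 !addr0 mulrA der0 => S0.
  have : \sum_i (f i)^`().[T] * (lc j T 0 * q1^`M(i).@[v0 0] + lc j T 1 * q2^`M(i).@[v0 0]) = 0.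
    by rewrite big1 // => i _; rewrite grad mulr0.
  rewrite (eq_bigr (fun i => lc j T 0 * ((f i)^`().[T] * q1^`M(i).@[fun i => (f i).[T]]) +
    lc j T 1 * ((f i)^`().[T] * q2^`M(i).@[fun i => (f i).[T]]))); last first.
    by move=> i _; rewrite !(meval_eq _ vE); ring.
  rewrite big_split /= -!mulr_sumr => S1.
  rewrite -[RHS]S0 -[LHS]addr0 -[X in _ + X]S1 /L /qnum.
  by case: (j); rewrite /= derivX derivC; rewrite ?(hornerC, horner0); ring.
have tot : lc j T 0 * q1.@[v0 0] + lc j T 1 * q2.@[v0 0] = 0.
  by rewrite qE dq_vec /pev nl !mul0r add0r.
have [q10 q20] : q1.@[v0 0] = 0 /\ q2.@[v0 0] = 0.
  by move: num0 tot; rewrite /qnum /lc; case: (j) => /= ->; rewrite mulr0 mul1r ?add0r ?addr0 => ->.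
have := NS v00 q10 q20; set J := \matrix_(_, _) _ => rJ.
have fJ : row_free J by rewrite /row_free rJ.
pose c : 'rV[k]_2 := \row_i lc j T i.
have c0 : c = 0.
  apply: (row_free_inj0 fJ); apply/rowP => i; rewrite !mxE big_ord_recl big_ord1 !mxE /=.
  exact: grad.
have := congr1 (fun c : 'rV_2 => c 0 (if j then 1 else 0)) c0.
rewrite !mxE /lc; case: (j) => /= /eqP; by rewrite oner_eq0.
Qed.

Lemma nonsingular_mild T : exists l, mild (pev n T) (pev u T) (pev v T) l.
Proof.
have [l nl] := nT T; exists l; split=> //; apply/negPn/negP; rewrite !negb_or !negbK.
case/and3P; rewrite /pev => /eqP n0 /eqP u0 /eqP v0.
have tr a b : a != 0 \/ b != 0 ->
    (n l)^`().[T] * a * b + (u l)^`().[T] * a ^+ 2 + (v l)^`().[T] * b ^+ 2 != 0.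
  by apply: pencil_transversal => //; rewrite u0 v0 !mul0r addr0.
have [u'0|u'0] := eqVneq (u l)^`().[T] 0.
  by have := tr 1 0; rewrite u'0 mulr0 expr0n mul0r mulr0 !addr0 eqxx oner_neq0 => -/(_ (or_introl isT)).
(* If n_l, u_l, v_l all vanished at T, each (a, b) would satisfy the hypothesis of
   [pencil_transversal], but the binary form of the derivatives has a nontrivial zero. *)
have [a aE] := quadratic_root ((n l)^`().[T] / (u l)^`().[T]) ((v l)^`().[T] / (u l)^`().[T]).
have := tr a 1 (or_intror (oner_neq0 _)).
have -> : (n l)^`().[T] * a * 1 + (u l)^`().[T] * a ^+ 2 + (v l)^`().[T] * 1 ^+ 2 =
   (u l)^`().[T] * (a ^+ 2 + (n l)^`().[T] / (u l)^`().[T] * a) + (v l)^`().[T].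
  by field.
rewrite aE mulrC divfK // -mulr2n -mulr_natr two0 mulr0 eqxx; done.
Qed.

Lemma deriv_mul_sqr (p q : {poly k}) T : (p * q ^+ 2)^`().[T] = p^`().[T] * q.[T] ^+ 2.
Proof. by rewrite expr2 !derivM !(hornerD, hornerM); ring2 two0. Qed.

Lemma nonsingular_smooth : smooth_quadratic (PB n) (PA n u v kap).
Proof.
move=> T z zE; have [BT|BT] := eqVneq (PB n).[T] 0; [right|by left].
have [l [nl ml]] := nonsingular_mild T; rewrite /pev in nl ml.
pose m i := \prod_(t | t != i) n t.
have PBm : PB n = n l * m l by rewrite /PB (bigD1 l).
have ml0 : (m l).[T] != 0 by rewrite horner_prod; apply/prodf_neq0.
have nl0 : (n l).[T] = 0.
  by move/eqP: BT; rewrite PBm hornerM mulf_eq0 (negPf ml0) orbF => /eqP.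
have mi0 i : i != l -> (m i).[T] = 0.
  by move=> il; rewrite horner_prod (bigD1 l) 1?eq_sym //= nl0 mul0r.
have PAE : PA n u v kap = \sum_i u i * v i * m i ^+ 2 + kap ^+ 2 + PB n * kap by [].
have AT : (PA n u v kap).[T] = (u l).[T] * (v l).[T] * (m l).[T] ^+ 2 + kap.[T] ^+ 2.
  rewrite PAE !hornerD [(PB n * kap).[T]]hornerM BT mul0r addr0 horner_sum (bigD1 l) //= big1 ?addr0.
    by rewrite !hornerM !expr2.
  by move=> i il; rewrite expr2 !hornerM (mi0 i il) !mulr0.
have A'T : (PA n u v kap)^`().[T] =
    (u l * v l)^`().[T] * (m l).[T] ^+ 2 + (PB n)^`().[T] * kap.[T].
  rewrite PAE !derivD -[kap ^+ 2]mul1r !hornerD deriv_mul_sqr derivM hornerD !hornerM BT.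
  rewrite -[1]/(1%:P) derivC horner0 !mul0r !addr0; congr (_ + _).
  rewrite raddf_sum horner_sum (bigD1 l) //= big1 ?addr0 ?deriv_mul_sqr //.
  by move=> i il; rewrite deriv_mul_sqr (mi0 i il) expr0n mulr0.
(* Over this zero of B the equation is a perfect square, with the single root a b m_l + kap. The
   t-derivative of the equation there is m_l^2 times the expression of [pencil_transversal] at (a,
   b). *)
pose a := sqrt (v l).[T]; pose b := sqrt (u l).[T].
have aE : a ^+ 2 = (v l).[T] by exact: sqr_sqrt.
have bE : b ^+ 2 = (u l).[T] by exact: sqr_sqrt.
have zab : z = a * b * (m l).[T] + kap.[T].
  apply: (eq_of_add0 two0); apply/eqP; rewrite -sqrf_eq0; apply/eqP.
  transitivity ((z ^+ 2 + (PB n).[T] * z) + (a ^+ 2 * b ^+ 2 * (m l).[T] ^+ 2 + kap.[T] ^+ 2)).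
    by rewrite BT; ring2 two0.
  by rewrite zE AT aE bE; ring2 two0.
have ab : a != 0 \/ b != 0.
  move: ml; rewrite nl0 eqxx /= -aE -bE !expf_eq0 /= => /orP[]; by [right|left].
have tr := @pencil_transversal T l a b nl0 _ ab.
rewrite A'T zab PBm !derivM !(hornerD, hornerM) nl0.
have -> : ((u l)^`().[T] * (v l).[T] + (u l).[T] * (v l)^`().[T]) * (m l).[T] ^+ 2 +
    ((n l)^`().[T] * (m l).[T] + 0 * (m l)^`().[T]) * kap.[T] +
    ((n l)^`().[T] * (m l).[T] + 0 * (m l)^`().[T]) * (a * b * (m l).[T] + kap.[T]) =
   (m l).[T] ^+ 2 * ((n l)^`().[T] * a * b + (u l)^`().[T] * a ^+ 2 + (v l)^`().[T] * b ^+ 2).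
  by rewrite -aE -bE; ring2 two0.
rewrite mulf_neq0 ?expf_neq0 //; apply: tr; rewrite -aE -bE; ring2 two0.
Qed.

End SmoothPencil.

(** * Diagonal forms of the pencils *)

Section Identities.
Variable V : comPzRingType.
Hypothesis two0 : 2%:R = 0 :> V.

Implicit Types s nu p r x y al be ga de a e c d : V.

(** The value at (e, e') of the binary form s X Y + nu (c X^2 + d Y^2): a square coefficient after a
    change of basis. *)
Definition sq (s nu e e' c d : V) := s * e * e' + nu * (c * e ^+ 2 + d * e' ^+ 2).

Lemma binary_form s nu al be ga de c d x y : al * de + be * ga = 1 ->
  s * ((be * x + al * y) * (de * x + ga * y)) +
    nu * (c * (be * x + al * y) ^+ 2 + d * (de * x + ga * y) ^+ 2) =
  s * x * y + sq s nu be de c d * x ^+ 2 + sq s nu al ga c d * y ^+ 2.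
Proof.
move=> H; rewrite -[s * x * y]mulr1 -H /sq; ring2 two0.
Qed.

(** The b_i are the coefficients of a product of two linear forms, (ga X + al Y)(de' X' + be' Y'),
    whose factors are the new coordinates x and y'. *)
Lemma cross_term al be ga de x y al' be' ga' de' x' y' :
  al * de + be * ga = 1 -> al' * de' + be' * ga' = 1 ->
  be' * ga * ((be * x + al * y) * (de' * x' + ga' * y')) +
  al * de' * ((be' * x' + al' * y') * (de * x + ga * y)) +
  ga * de' * ((be * x + al * y) * (be' * x' + al' * y')) +
  al * be' * ((de * x + ga * y) * (de' * x' + ga' * y')) = x * y'.
Proof.
move=> H H'; have xE : ga * (be * x + al * y) + al * (de * x + ga * y) = x.
  rewrite -[RHS]mul1r -H; ring2 two0.
have yE : de' * (be' * x' + al' * y') + be' * (de' * x' + ga' * y') = y'.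
  rewrite -[RHS]mul1r -H'; ring2 two0.
rewrite -[in RHS]xE -[in RHS]yE; ring.
Qed.

(** The left side is the A of the diagonal form of case (c); the Bezout coefficients p and r used to
    diagonalize disappear from it. *)
Lemma discriminant_c s nu p r a1 e1 a2 e2 a3 e3 : s ^+ 2 * r + nu ^+ 2 * p = 1 ->
  a1 * (e1 * s ^+ 2 * r ^+ 2 + e2 * nu ^+ 2 * p ^+ 2 + e3 * p ^+ 2 * s ^+ 2) * (1 * s ^+ 3) ^+ 2
  + a2 * (e1 * nu ^+ 2 * r ^+ 2 + e2 * s ^+ 2 * r ^+ 2 + e3 * nu ^+ 2 * p ^+ 2) * (1 * s ^+ 3) ^+ 2
  + (a3 + a1 * p ^+ 2 * s ^+ 4 + a2 * p ^+ 2 * s ^+ 2 * nu ^+ 2)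
    * (e1 * nu ^+ 4 + e2 * s ^+ 2 * nu ^+ 2 + e3 * s ^+ 4) * (1 * 1) ^+ 2
  = s ^+ 4 * (a1 * e1 + a2 * e2 + a3 * e3) + s ^+ 2 * nu ^+ 2 * (a2 * e1 + a3 * e2)
    + nu ^+ 4 * (a3 * e1).
Proof.
move=> H; have H2 : (s ^+ 2 * r + nu ^+ 2 * p) ^+ 2 = 1 by rewrite H expr1n.
transitivity (s ^+ 4 * ((a1 * e1 + a2 * e2) * (s ^+ 2 * r + nu ^+ 2 * p) ^+ 2 + a3 * e3)
  + s ^+ 2 * nu ^+ 2 * (a2 * e1 * (s ^+ 2 * r + nu ^+ 2 * p) ^+ 2 + a3 * e2)
  + nu ^+ 4 * (a3 * e1)); first ring2 two0.
rewrite H2; ring.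
Qed.

(* In arf_c and arf_b, kap is the translation of z that turns the equation    *)
(* given by the diagonal form into the one of the theorem.                    *)
Lemma arf_c s nu al1 be1 ga1 de1 al2 be2 ga2 de2 al3 be3 ga3 de3 c1 c2 c3 d1 d2 d3 :
  al1 * de1 + be1 * ga1 = 1 -> al2 * de2 + be2 * ga2 = 1 -> al3 * de3 + be3 * ga3 = 1 ->
  let a1 := sq s nu be1 de1 c1 d1 in let e1 := sq s nu al1 ga1 c1 d1 in
  let a2 := sq s nu be2 de2 c2 d2 in let e2 := sq s nu al2 ga2 c2 d2 in
  let a3 := sq s nu be3 de3 c3 d3 in let e3 := sq s nu al3 ga3 c3 d3 in
  let kap := s ^+ 2 * (nu * (al1 * be1 * c1 + ga1 * de1 * d1 + al2 * be2 * c2 + ga2 * de2 * d2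
     + al3 * be3 * c3 + ga3 * de3 * d3) + s * (be1 * ga1 + be2 * ga2 + be3 * ga3)) in
  let b1 := be3 * ga2 in let b2 := al2 * de3 in let b3 := ga2 * de3 in let b4 := al2 * be3 in
  let b5 := be2 * ga1 in let b6 := al1 * de2 in let b7 := ga1 * de2 in let b8 := al1 * be2 in
  s ^+ 4 * (a1 * e1 + a2 * e2 + a3 * e3) + s ^+ 2 * nu ^+ 2 * (a2 * e1 + a3 * e2)
    + nu ^+ 4 * (a3 * e1) + kap ^+ 2 + s ^+ 3 * kap =
  s ^+ 4 * nu ^+ 2 * (c1 * d1 + c2 * d2 + c3 * d3 + b1 * b2 + b5 * b6)
  + s ^+ 3 * nu ^+ 3 * (b6 * b8 * c1 + (b2 * b4 + b5 * b8) * c2 + b1 * b4 * c3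
     + b5 * b7 * d1 + (b1 * b3 + b6 * b7) * d2 + b2 * b3 * d3)
  + s ^+ 2 * nu ^+ 4 * (b8 ^+ 2 * c1 * c2 + b6 ^+ 2 * c1 * d2
                  + b5 ^+ 2 * c2 * d1 + b7 ^+ 2 * d1 * d2
                  + b4 ^+ 2 * c2 * c3 + b2 ^+ 2 * c2 * d3
                  + b1 ^+ 2 * c3 * d2 + b3 ^+ 2 * d2 * d3
                  + b1 * b3 * b5 * b8 + b2 * b4 * b6 * b7)
  + s * nu ^+ 5 * ((b1 * b3 * b8 ^+ 2 + b2 * b4 * b6 ^+ 2) * c1
                  + (b1 * b3 * b5 ^+ 2 + b2 * b4 * b7 ^+ 2) * d1
                  + (b1 ^+ 2 * b5 * b8 + b4 ^+ 2 * b6 * b7) * c3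
                  + (b3 ^+ 2 * b5 * b8 + b2 ^+ 2 * b6 * b7) * d3)
  + nu ^+ 6 * ((b1 * b8 + b4 * b6) ^+ 2 * c1 * c3
                + (b2 * b6 + b3 * b8) ^+ 2 * c1 * d3
                + (b1 * b5 + b4 * b7) ^+ 2 * c3 * d1
                + (b2 * b7 + b3 * b5) ^+ 2 * d1 * d3).
Proof.
move=> H1 H2 H3; rewrite /sq /=.
have D1 : al1 * de1 = 1 + be1 * ga1 by rewrite -H1; ring2 two0.
have D2 : al2 * de2 = 1 + be2 * ga2 by rewrite -H2; ring2 two0.
have D3 : al3 * de3 = 1 + be3 * ga3 by rewrite -H3; ring2 two0.
apply: (eq_of_add0 two0); have [h4 h6 h8 h10] := even_nat0 two0.
ring: D1 D2 D3 h4 h6 h8 h10 two0.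
Qed.

Lemma discriminant_b (s s1 nu p r c d a2 e2 a3 e3 : V) : s * r + nu * p = 1 ->
  nu * c * (nu * d) * (1 * s ^+ 2) ^+ 2
  + a2 * (e2 * r ^+ 2 + e3 * p ^+ 2) * (s1 * s ^+ 2) ^+ 2
  + (a3 + a2 * p ^+ 2 * s ^+ 2) * (e2 * nu ^+ 2 + e3 * s ^+ 2) * (s1 * 1) ^+ 2
  = s ^+ 4 * nu ^+ 2 * (c * d) +
    s1 ^+ 2 * (s ^+ 2 * (a2 * e2 + a3 * e3) + nu ^+ 2 * (a3 * e2)).
Proof.
move=> H; have H2 : (s * r + nu * p) ^+ 2 = 1 by rewrite H expr1n.
transitivity (s ^+ 4 * nu ^+ 2 * (c * d) +
  s1 ^+ 2 * (s ^+ 2 * (a2 * e2 * (s * r + nu * p) ^+ 2 + a3 * e3) + nu ^+ 2 * (a3 * e2))).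
  ring2 two0.
rewrite H2; ring.
Qed.

Lemma arf_b s s1 nu al2 be2 ga2 de2 al3 be3 ga3 de3 C2 C3 D2 D3 :
  al2 * de2 + be2 * ga2 = 1 -> al3 * de3 + be3 * ga3 = 1 ->
  let c2 := C2 ^+ 2 in let c3 := C3 ^+ 2 in let d2 := D2 ^+ 2 in let d3 := D3 ^+ 2 in
  let a2 := sq s nu be2 de2 c2 d2 in let e2 := sq s nu al2 ga2 c2 d2 in
  let a3 := sq s nu be3 de3 c3 d3 in let e3 := sq s nu al3 ga3 c3 d3 in
  let b1 := be3 * ga2 in let b2 := al2 * de3 in let b3 := ga2 * de3 in let b4 := al2 * be3 in
  let b0 := b1 * (C3 * D2) + b2 * (C2 * D3) + b3 * (D2 * D3) + b4 * (C2 * C3) in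
  let kap := s1 * (nu ^+ 2 * b0 + s * nu * (al2 * be2 * c2 + ga2 * de2 * d2
     + al3 * be3 * c3 + ga3 * de3 * d3) + s ^+ 2 * (be2 * ga2 + be3 * ga3)) in
  s1 ^+ 2 * (s ^+ 2 * (a2 * e2 + a3 * e3) + nu ^+ 2 * (a3 * e2)) + kap ^+ 2 + s1 * s ^+ 2 * kap =
  s1 ^+ 2 * s ^+ 2 * nu ^+ 2 * (b1 * b2 + c2 * d2 + c3 * d3 + b1 * (C3 * D2) + b2 * (C2 * D3)
     + b3 * (D2 * D3) + b4 * (C2 * C3))
  + s1 ^+ 2 * s * nu ^+ 3 * (b3 * (b1 * d2 + b2 * d3) + b4 * (b2 * c2 + b1 * c3)).
Proof.
move=> H2 H3; rewrite /sq /=.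
have E2 : al2 * de2 = 1 + be2 * ga2 by rewrite -H2; ring2 two0.
have E3 : al3 * de3 = 1 + be3 * ga3 by rewrite -H3; ring2 two0.
apply: (eq_of_add0 two0); have [h4 h6 h8 h10] := even_nat0 two0.
ring: E2 E3 h4 h6 h8 h10 two0.
Qed.

(* The coordinates X1, X2, x3, Y1, Y2, Y3 of the pencil in terms of           *)
(* coordinates in which its bilinear part is diagonal.                        *)
Lemma bilinear_c s nu p r x1 x2 x3 y1 y2 y3 :
  s ^+ 2 * r + nu ^+ 2 * p = 1 ->
  let X1 := x1 + p * s ^+ 2 * x3 in let X2 := x2 + p * s * nu * x3 in
  let Y1 := s * r * y1 + nu * r * y2 + nu ^+ 2 * y3 in
  let Y2 := nu * p * y1 + s * r * y2 + s * nu * y3 in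
  let Y3 := p * s * y1 + nu * p * y2 + s ^+ 2 * y3 in
  s * X1 * Y1 + s * X2 * Y2 + s * x3 * Y3 + nu * (X1 * Y2) + nu * (X2 * Y3) =
  x1 * y1 + x2 * y2 + s ^+ 3 * x3 * y3.
Proof.
move=> H X1 X2 Y1 Y2 Y3.
transitivity ((s ^+ 2 * r + nu ^+ 2 * p) * (X1 * y1 + X2 * y2) + s * x3 * Y3).
  rewrite /Y1 /Y2 /Y3; ring2 two0.
rewrite H /X1 /X2 /Y3; ring2 two0.
Qed.

Lemma bilinear_b s nu p r x2 x3 y2 y3 :
  s * r + nu * p = 1 ->
  let X2 := x2 + p * s * x3 in
  let Y2 := r * y2 + nu * y3 in let Y3 := p * y2 + s * y3 in
  s * X2 * Y2 + s * x3 * Y3 + nu * (X2 * Y3) = x2 * y2 + s ^+ 2 * x3 * y3.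
Proof.
move=> H X2 Y2 Y3.
transitivity ((s * r + nu * p) * (X2 * y2) + s * x3 * Y3).
  rewrite /Y2 /Y3; ring2 two0.
rewrite H /X2 /Y3; ring2 two0.
Qed.

End Identities.

Section Reduction.
Variable k : closedFieldType.
Hypothesis char2 : 2%N \in [pchar k].
Let two0 : 2%:R = 0 :> k. Proof. exact: pcharf0. Qed.

Variables (q1 q2 : {mpoly k[6]}).

Definition diagonalized (j : bool) (n u v : 'I_3 -> {poly k}) :=
  exists g gi : 'M[{poly k}]_6, g *m gi = 1%:M /\ forall T (w : 'rV[k]_6),
    lc j T 0 * q1.@[(w *m mev g T) 0] + lc j T 1 * q2.@[(w *m mev g T) 0] =
    dq (pev n T) (pev u T) (pev v T) w.

Definition one_degenerate (n : 'I_3 -> {poly k}) :=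
  forall T, exists l, forall i, i != l -> (n i).[T] != 0.

Lemma diagonalized_chart j n u v kap : nonsingular_ci q1 q2 ->
  diagonalized j n u v -> one_degenerate n -> PB n != 0 ->
  exists lam, chart_gen q1 q2 j (PB n) (PA n u v kap) lam.
Proof.
move=> NS [g [gi [ggi qE]]] nT Bn0; have mT := nonsingular_mild char2 ggi qE nT NS.
exists (fun z => lam (pev n (tau j z.1)) (pev u (tau j z.1)) (pev v (tau j z.1))
   (Mb z.2 *m mev gi (tau j z.1)) + kap.[tau j z.1]) => U d d0 UE; split.
- exact: (lamZ_regular char2 kap ggi qE mT UE).
- exact: (lamZ_quadratic char2 kap ggi qE mT UE).
- move=> f; exact: (regular_generation char2 kap ggi qE mT Bn0 d0 UE).
- exact: (lamZ_free char2 ggi qE mT Bn0 d0 UE).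
Qed.

(** What remains for each pencil is to diagonalize it over both charts and to check that the
    resulting B and A are reversals of each other in degrees 3 and 6. *)
Theorem diagonalized_curve n u v kap B A n' u' v' kap' B' A' T0 :
  nonsingular_ci q1 q2 ->
  diagonalized true n u v -> one_degenerate n -> PB n = B -> PA n u v kap = A ->
  diagonalized false n' u' v' -> one_degenerate n' -> PB n' = B' -> PA n' u' v' kap' = A' ->
  B != 0 -> root B T0 ->
  (forall t, t != 0 -> B.[t] = t ^+ 3 * B'.[t^-1]) ->
  (forall t, t != 0 -> A.[t] = t ^+ 6 * A'.[t^-1]) ->
  [/\ curve_nonsingular q1 q2, curve_genus q1 q2 2 &
      curve_given_by q1 q2 (quadratic_eq B A)].
Proof.
move=> NS D1 nT1 <- <- D0 nT0 <- <- B1 rB revB revA.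
have B0 : PB n' != 0.
  apply: contraNneq B1 => E; apply/eqP/(@poly_eq_except _ 'X); first by rewrite polyX_eq0.
  by move=> t; rewrite hornerX horner0 => t0; rewrite revB // E horner0 mulr0.
have [l1 C1] := diagonalized_chart kap NS D1 nT1 B1.
have [l0 C0] := diagonalized_chart kap' NS D0 nT0 B0.
have s1 : smooth_quadratic (PB n) (PA n u v kap).
  by have [g [gi [ggi qE]]] := D1; apply: nonsingular_smooth ggi qE nT1 NS.
have s0 : smooth_quadratic (PB n') (PA n' u' v' kap').
  by have [g [gi [ggi qE]]] := D0; apply: nonsingular_smooth ggi qE nT0 NS.
split.
- exact: (glued_nonsingular char2 C1 C0 s1 s0 rB revB revA).
- exact: (glued_genus char2 C1 C0 s1 rB revB revA).
- exact: glued_given_by C1.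
Qed.

End Reduction.

(** * Coordinate changes over k[T] *)

Section CoordinateChange.
Variable k : closedFieldType.
Hypothesis char2 : 2%N \in [pchar k].
Let two0 : 2%:R = 0 :> k. Proof. exact: pcharf0. Qed.

Variables (al be ga de : 'I_3 -> k) (P Pi Q Qi : 'M[{poly k}]_3).
Hypothesis unimod : forall i, al i * de i + be i * ga i = 1.
Hypothesis PPi : P *m Pi = 1%:M.
Hypothesis QQi : Q *m Qi = 1%:M.

Let D (e : 'I_3 -> k) : 'M[{poly k}]_3 := diag_mx (\row_i (e i)%:P).

(** P and Q act on the xi- and eta-coordinates and diagonalize the bilinear part; the constant
    second factor substitutes be x + al y and de x + ga y for each pair (X_i, Y_i). *)
Definition coord_mx : 'M[{poly k}]_(3 + 3) :=
  block_mx P 0 0 Q *m block_mx (D be) (D de) (D al) (D ga).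

Definition coord_inv : 'M[{poly k}]_(3 + 3) :=
  block_mx (D ga) (D de) (D al) (D be) *m block_mx Pi 0 0 Qi.

Lemma coord_mxK : coord_mx *m coord_inv = 1%:M.
Proof.
have DM e e' : D e *m D e' = D (fun i => e i * e' i).
  by apply/matrixP => i i'; rewrite mul_diag_mx !mxE polyCM mulrnAr.
have DD e e' : D e + D e' = D (fun i => e i + e' i).
  by apply/matrixP => i i'; rewrite !mxE polyCD mulrnDl.
have D1 e : (forall i, e i = 1) -> D e = 1%:M.
  by move=> e1; apply/matrixP => i i'; rewrite !mxE e1.
have D0 e : (forall i, e i = 0) -> D e = 0.
  by move=> e0; apply/matrixP => i i'; rewrite !mxE e0 mul0rn.
have mid : block_mx (D be) (D de) (D al) (D ga) *m block_mx (D ga) (D de) (D al) (D be) = 1%:M.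
  rewrite mulmx_block !DM !DD [RHS]scalar_mx_block; congr block_mx.
  - by apply: D1 => i; rewrite -(unimod i) addrC [de i * _]mulrC.
  - by apply: D0 => i; ring2 two0.
  - by apply: D0 => i; ring2 two0.
  - by apply: D1 => i; rewrite -(unimod i) [ga i * _]mulrC.
rewrite /coord_mx /coord_inv mulmxA -(mulmxA _ _ (block_mx (D ga) _ _ _)) mid mulmx1.
by rewrite mulmx_block !mul0mx !mulmx0 !addr0 !add0r PPi QQi [RHS]scalar_mx_block.
Qed.

Lemma coord_mxE (w : 'rV[k]_6) T i :
  let x := \sum_s xc w s * (P s i).[T] in let y := \sum_s yc w s * (Q s i).[T] in
  xc (w *m mev (coord_mx : 'M_6) T) i = be i * x + al i * y /\
  yc (w *m mev (coord_mx : 'M_6) T) i = de i * x + ga i * y.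
Proof.
have wE : w = row_mx (\row_i xc w i) (\row_i yc w i) :> 'rV_(3 + 3).
  by rewrite -[LHS](@hsubmxK _ 1 3 3 w); congr row_mx; apply/rowP => t; rewrite !mxE.
have mE : mev (coord_mx : 'M_6) T = block_mx (mev P T) 0 0 (mev Q T) *m
    block_mx (mev (D be) T) (mev (D de) T) (mev (D al) T) (mev (D ga) T) :> 'M_(3 + 3).
  rewrite /mev -(map_mx0 (horner_eval T) 3 3) -!(@map_block_mx _ _ (horner_eval T) 3 3 3 3).
  exact: map_mxM.
have dE m (R : 'M[k]_(m, 3)) e s t : (R *m mev (D e) T) s t = e t * R s t.
  have -> : mev (D e) T = diag_mx (\row_i e i).
    by apply/matrixP => a b; rewrite !mxE /horner_eval hornerMn hornerC.
  by rewrite mul_mx_diag !mxE mulrC.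
have E : w *m mev (coord_mx : 'M_6) T =
   row_mx (\row_i (be i * (\sum_s xc w s * (P s i).[T]) + al i * (\sum_s yc w s * (Q s i).[T])))
          (\row_i (de i * (\sum_s xc w s * (P s i).[T]) + ga i * (\sum_s yc w s * (Q s i).[T])))
     :> 'rV_(3 + 3).
  transitivity (row_mx (\row_i xc w i) (\row_i yc w i) *m block_mx (mev P T) 0 0 (mev Q T) *m
    block_mx (mev (D be) T) (mev (D de) T) (mev (D al) T) (mev (D ga) T)).
    by rewrite -mulmxA -mE -wE.
  rewrite !mul_row_block !mulmx0 addr0 add0r.
  have rE (f : 'I_3 -> k) (R : 'M_3) t : ((\row_i f i) *m mev R T) 0 t = \sum_s f s * (R s t).[T].
    by rewrite !mxE; apply: eq_bigr => s _; rewrite !mxE.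
  congr row_mx; apply/rowP => t; rewrite mxE !dE !rE mxE; congr (_ * _ + _ * _);
    by apply: eq_bigr => s _; rewrite ?xc_row ?yc_row.
move=> x y; split.
  by have := congr1 (fun M : 'rV_(3 + 3) => M 0 (lshift 3 i)) E; rewrite row_mxEl [RHS]mxE.
by have := congr1 (fun M : 'rV_(3 + 3) => M 0 (rshift 3 i)) E; rewrite row_mxEr [RHS]mxE.
Qed.

End CoordinateChange.

Definition tri (T : Type) (a b c : T) (i : 'I_3) : T :=
  if i == i1 then a else if i == i2 then b else c.

Lemma sum3 (V : nmodType) (F : 'I_3 -> V) : \sum_i F i = F i1 + F i2 + F i3.
Proof. exact: sum_ord3_distinct. Qed.

Lemma prod3 (R : comPzRingType) (F : 'I_3 -> R) : \prod_i F i = F i1 * F i2 * F i3.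
Proof.
by rewrite (bigD1 i1) //= (@prod_ord3_others _ F i1 i2 i3) // mulrA.
Qed.

Lemma ord3P (P : 'I_3 -> Prop) : P i1 -> P i2 -> P i3 -> forall i, P i.
Proof. exact: ord3_ind. Qed.

Definition mat3 (R : Type) (r1 r2 r3 : 'I_3 -> R) : 'M[R]_3 := \matrix_(i, j) tri r1 r2 r3 i j.

Lemma mat3_mul (R : comNzRingType) (r1 r2 r3 s1 s2 s3 : 'I_3 -> R) :
  (forall i j, tri r1 r2 r3 i i1 * s1 j + tri r1 r2 r3 i i2 * s2 j + tri r1 r2 r3 i i3 * s3 j
     = (i == j)%:R) ->
  mat3 r1 r2 r3 *m mat3 s1 s2 s3 = 1%:M.
Proof. by move=> E; apply/matrixP => i j; rewrite !mxE sum3 !mxE -E. Qed.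

Section Evaluation.
Variables (k : closedFieldType) (w : 'rV[k]_6).

Lemma meval_X i : (X_ k i).@[w 0] = xc w i. Proof. exact: mevalXU. Qed.
Lemma meval_Y i : (Y_ k i).@[w 0] = yc w i. Proof. exact: mevalXU. Qed.

Lemma meval_qG : qG.@[w 0] = \sum_i xc w i * yc w i.
Proof. by rewrite meval_sum; apply: eq_bigr => i _; rewrite mevalM meval_X meval_Y. Qed.

Lemma meval_qQ a c d : (qQ a c d).@[w 0] =
  \sum_i (a i * (xc w i * yc w i) + c i * xc w i ^+ 2 + d i * yc w i ^+ 2).
Proof.
rewrite meval_sum; apply: eq_bigr => i _.
by rewrite !mevalD !mevalZ mevalM !expr2 !mevalM meval_X meval_Y.
Qed.

Lemma meval_qQ1 a c d b1 b2 b3 b4 : (qQ1 a c d b1 b2 b3 b4).@[w 0] =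
  (qQ a c d).@[w 0] + b1 * (xc w i2 * yc w i3) + b2 * (xc w i3 * yc w i2)
  + b3 * (xc w i2 * xc w i3) + b4 * (yc w i2 * yc w i3).
Proof. by rewrite !mevalD !mevalZ !mevalM !(meval_X, meval_Y). Qed.

Lemma meval_qQ0 a c d b1 b2 b3 b4 b5 b6 b7 b8 :
  (qQ0 a c d b1 b2 b3 b4 b5 b6 b7 b8).@[w 0] = (qQ1 a c d b1 b2 b3 b4).@[w 0]
  + b5 * (xc w i1 * yc w i2) + b6 * (xc w i2 * yc w i1)
  + b7 * (xc w i1 * xc w i2) + b8 * (yc w i1 * yc w i2).
Proof. by rewrite !mevalD !mevalZ !mevalM !(meval_X, meval_Y). Qed.

End Evaluation.

(** * The three kinds of pencils *)

Section Cases.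
Variable k : closedFieldType.
Hypothesis char2 : 2%N \in [pchar k].
Let two0 : 2%:R = 0 :> k. Proof. exact: pcharf0. Qed.
Let two0P : 2%:R = 0 :> {poly k}.
Proof. by rewrite -[2%:R]polyC_natr two0. Qed.

Variables (j : bool) (a : k) (mu nu p r s : {poly k}).
Hypothesis muE : forall T, mu.[T] = lc j T 0.
Hypothesis nuE : forall T, nu.[T] = lc j T 1.

Section CaseC.
Variables (c d al be ga de : 'I_3 -> k).
Hypothesis unimod : forall i, al i * de i + be i * ga i = 1.
Hypothesis sE : forall T, s.[T] = mu.[T] + nu.[T] * a.
Hypothesis spE : s ^+ 2 * r + nu ^+ 2 * p = 1.
Let A i := sq s nu (be i)%:P (de i)%:P (c i)%:P (d i)%:P.
Let E i := sq s nu (al i)%:P (ga i)%:P (c i)%:P (d i)%:P.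

Definition n_c := tri 1 1 (s ^+ 3).
Definition u_c := tri (A i1) (A i2)
  (A i3 + A i1 * p ^+ 2 * s ^+ 4 + A i2 * p ^+ 2 * s ^+ 2 * nu ^+ 2).
Definition v_c := tri
  (E i1 * s ^+ 2 * r ^+ 2 + E i2 * nu ^+ 2 * p ^+ 2 + E i3 * p ^+ 2 * s ^+ 2)
  (E i1 * nu ^+ 2 * r ^+ 2 + E i2 * s ^+ 2 * r ^+ 2 + E i3 * nu ^+ 2 * p ^+ 2)
  (E i1 * nu ^+ 4 + E i2 * s ^+ 2 * nu ^+ 2 + E i3 * s ^+ 4).

(** After the substitutions of [binary_form] and [cross_term] the bilinear part is s times the
    identity plus nu times a nilpotent Jordan block of size 3. Its elementary divisors are 1, 1,
    s^3, and P, Q realize the reduction. *)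
Lemma diagonalized_c : diagonalized qG
  (qQ0 (fun=> a) c d (be i3 * ga i2) (al i2 * de i3) (ga i2 * de i3) (al i2 * be i3)
     (be i2 * ga i1) (al i1 * de i2) (ga i1 * de i2) (al i1 * be i2)) j n_c u_c v_c.
Proof.
pose P := mat3 (tri 1 0 0) (tri 0 1 0) (tri (p * s ^+ 2) (p * s * nu) 1).
pose Q := mat3 (tri (s * r) (nu * p) (p * s)) (tri (nu * r) (s * r) (nu * p))
  (tri (nu ^+ 2) (s * nu) (s ^+ 2)).
pose Qi := mat3 (tri s 0 p) (tri nu s 0) (tri 0 nu r).
have PP : P *m P = 1%:M.
  apply: mat3_mul => i t; elim/ord3P: i; elim/ord3P: t; rewrite /tri /=; ring2 two0P.
have QQ : Q *m Qi = 1%:M.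
  apply: mat3_mul => i t; elim/ord3P: i; elim/ord3P: t; rewrite /tri /= -?spE; ring2 two0P.
exists (coord_mx al be ga de P Q), (coord_inv al be ga de P Qi).
split=> [|T w]; first exact: coord_mxK.
rewrite meval_qQ0 meval_qQ1 meval_qQ meval_qG.
have := coord_mxE al be ga de P Q w T; set w' := w *m _ => /= w'E.
pose x i := \sum_t xc w t * (P t i).[T]; pose y i := \sum_t yc w t * (Q t i).[T].
have xE i : xc w' i = be i * x i + al i * y i by case: (w'E i).
have yE i : yc w' i = de i * x i + ga i * y i by case: (w'E i).
pose M := mu.[T]; pose N := nu.[T]; pose S := s.[T].
have SE : S = M + N * a by exact: sE.
have H : S ^+ 2 * r.[T] + N ^+ 2 * p.[T] = 1.
  by have := congr1 (horner^~ T) spE; rewrite !(hornerD, horner_exp, hornerM, hornerC).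
pose A' i := sq S N (be i) (de i) (c i) (d i); pose E' i := sq S N (al i) (ga i) (c i) (d i).
transitivity (\sum_i (S * x i * y i + A' i * x i ^+ 2 + E' i * y i ^+ 2)
    + N * (x i1 * y i2) + N * (x i2 * y i3)).
  rewrite -(cross_term two0 (x i1) (y i1) (x i2) (y i2) (unimod i1) (unimod i2)).
  rewrite -(cross_term two0 (x i2) (y i2) (x i3) (y i3) (unimod i2) (unimod i3)).
  have B i : S * x i * y i + A' i * x i ^+ 2 + E' i * y i ^+ 2 =
      S * (xc w' i * yc w' i) + N * (c i * xc w' i ^+ 2 + d i * yc w' i ^+ 2).
    by rewrite xE yE binary_form.
  by rewrite -!xE -!yE -muE -nuE -/M -/N !sum3 !B SE; ring.
rewrite /dq !sum3.
have ev (R1 R2 R3 : 'I_3 -> {poly k}) (g : 'I_3 -> k) t :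
    \sum_e g e * (mat3 R1 R2 R3 e t).[T] = g i1 * (R1 t).[T] + g i2 * (R2 t).[T] + g i3 * (R3 t).[T].
  by rewrite sum3 !mxE.
have A'E i : (A i).[T] = A' i by rewrite /A /A' /sq !(hornerD, horner_exp, hornerM, hornerC).
have E'E i : (E i).[T] = E' i by rewrite /E /E' /sq !(hornerD, horner_exp, hornerM, hornerC).
rewrite /pev /n_c /u_c /v_c /x /y /P /Q !ev /tri /=.
rewrite !(A'E, E'E, hornerD, horner_exp, hornerM, hornerC, horner0) -/S -/N.
have /= := bilinear_c two0 (xc w i1) (xc w i2) (xc w i3) (yc w i1) (yc w i2) (yc w i3) H.
move/eqP; rewrite -subr_eq0 => /eqP B0; apply: (eq_of_add0 two0); rewrite -[RHS]B0.
ring2 two0.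
Qed.

Lemma PA_c :
  let b1 := be i3 * ga i2 in let b2 := al i2 * de i3 in
  let b3 := ga i2 * de i3 in let b4 := al i2 * be i3 in
  let b5 := be i2 * ga i1 in let b6 := al i1 * de i2 in
  let b7 := ga i1 * de i2 in let b8 := al i1 * be i2 in
  PA n_c u_c v_c (s ^+ 2 * (nu * (al i1 * be i1 * c i1 + ga i1 * de i1 * d i1 +
    al i2 * be i2 * c i2 + ga i2 * de i2 * d i2 + al i3 * be i3 * c i3 + ga i3 * de i3 * d i3)%:P
    + s * (be i1 * ga i1 + be i2 * ga i2 + be i3 * ga i3)%:P)) =
  s ^+ 4 * nu ^+ 2 * (c i1 * d i1 + c i2 * d i2 + c i3 * d i3 + b1 * b2 + b5 * b6)%:P
  + s ^+ 3 * nu ^+ 3 * (b6 * b8 * c i1 + (b2 * b4 + b5 * b8) * c i2 + b1 * b4 * c i3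
     + b5 * b7 * d i1 + (b1 * b3 + b6 * b7) * d i2 + b2 * b3 * d i3)%:P
  + s ^+ 2 * nu ^+ 4 * (b8 ^+ 2 * c i1 * c i2 + b6 ^+ 2 * c i1 * d i2
                  + b5 ^+ 2 * c i2 * d i1 + b7 ^+ 2 * d i1 * d i2
                  + b4 ^+ 2 * c i2 * c i3 + b2 ^+ 2 * c i2 * d i3
                  + b1 ^+ 2 * c i3 * d i2 + b3 ^+ 2 * d i2 * d i3
                  + b1 * b3 * b5 * b8 + b2 * b4 * b6 * b7)%:P
  + s * nu ^+ 5 * ((b1 * b3 * b8 ^+ 2 + b2 * b4 * b6 ^+ 2) * c i1
                  + (b1 * b3 * b5 ^+ 2 + b2 * b4 * b7 ^+ 2) * d i1
                  + (b1 ^+ 2 * b5 * b8 + b4 ^+ 2 * b6 * b7) * c i3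
                  + (b3 ^+ 2 * b5 * b8 + b2 ^+ 2 * b6 * b7) * d i3)%:P
  + nu ^+ 6 * ((b1 * b8 + b4 * b6) ^+ 2 * c i1 * c i3
                + (b2 * b6 + b3 * b8) ^+ 2 * c i1 * d i3
                + (b1 * b5 + b4 * b7) ^+ 2 * c i3 * d i1
                + (b2 * b7 + b3 * b5) ^+ 2 * d i1 * d i3)%:P.
Proof.
move=> b1 b2 b3 b4 b5 b6 b7 b8.
have U i : (al i)%:P * (de i)%:P + (be i)%:P * (ga i)%:P = 1 :> {poly k}.
  by rewrite -!polyCM -polyCD unimod.
rewrite /PA /PB prod3 sum3 (@prod_ord3_others _ _ i1 i2 i3) // (@prod_ord3_others _ _ i2 i1 i3) //.
rewrite (@prod_ord3_others _ _ i3 i1 i2) //.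
rewrite /n_c /u_c /v_c /tri /= discriminant_c //.
rewrite /b1 /b2 /b3 /b4 /b5 /b6 /b7 /b8 !(polyCD, polyCM, polyC_exp).
have := arf_c two0P s nu (c i1)%:P (c i2)%:P (c i3)%:P (d i1)%:P (d i2)%:P (d i3)%:P
  (U i1) (U i2) (U i3).
move=> /= <-; rewrite /A /E; ring.
Qed.

End CaseC.
Section CaseB.
Variables (a1 : k) (s1 : {poly k}) (c d al be ga de : 'I_3 -> k).
Hypothesis unimod : forall i, al i * de i + be i * ga i = 1.
Hypothesis s1E : forall T, s1.[T] = mu.[T] + nu.[T] * a1.
Hypothesis sE : forall T, s.[T] = mu.[T] + nu.[T] * a.
Hypothesis spE : s * r + nu * p = 1.
Let A i := sq s nu (be i)%:P (de i)%:P (c i)%:P (d i)%:P.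
Let E i := sq s nu (al i)%:P (ga i)%:P (c i)%:P (d i)%:P.

Definition n_b := tri s1 1 (s ^+ 2).
Definition u_b := tri (nu * (c i1)%:P) (A i2) (A i3 + A i2 * p ^+ 2 * s ^+ 2).
Definition v_b := tri (nu * (d i1)%:P) (E i2 * r ^+ 2 + E i3 * p ^+ 2)
  (E i2 * nu ^+ 2 + E i3 * s ^+ 2).

(** Here the Jordan block has size 2 and involves the indices 2 and 3 only, with elementary divisors
    1 and s^2. *)
Lemma diagonalized_b : diagonalized qG
  (qQ1 (tri a1 a a) c d (be i3 * ga i2) (al i2 * de i3) (ga i2 * de i3) (al i2 * be i3))
  j n_b u_b v_b.
Proof.
pose P : 'M[{poly k}]_3 := mat3 (tri 1 0 0) (tri 0 1 0) (tri 0 (p * s) 1).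
pose Q := mat3 (tri 1 0 0) (tri 0 r p) (tri 0 nu s).
pose Qi := mat3 (tri 1 0 0) (tri 0 s p) (tri 0 nu r).
have PP : P *m P = 1%:M.
  apply: mat3_mul => i t; elim/ord3P: i; elim/ord3P: t; rewrite /tri /=; ring2 two0P.
have QQ : Q *m Qi = 1%:M.
  apply: mat3_mul => i t; elim/ord3P: i; elim/ord3P: t; rewrite /tri /=;
    first [ring2 two0P|rewrite -spE; ring2 two0P].
(* For the first index the constants 0, 1, 1, 0 make the substitution the identity. *)
pose al' := tri 0 (al i2) (al i3); pose be' := tri 1 (be i2) (be i3).
pose ga' := tri 1 (ga i2) (ga i3); pose de' := tri 0 (de i2) (de i3).
have unimod' i : al' i * de' i + be' i * ga' i = 1.
  by elim/ord3P: i; rewrite /al' /be' /ga' /de' /tri /= ?unimod // mul0r mul1r add0r.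
exists (coord_mx al' be' ga' de' P Q), (coord_inv al' be' ga' de' P Qi).
split=> [|T w]; first exact: coord_mxK.
rewrite meval_qQ1 meval_qQ meval_qG.
have := coord_mxE al' be' ga' de' P Q w T; set w' := w *m _ => /= w'E.
pose x i := \sum_t xc w t * (P t i).[T]; pose y i := \sum_t yc w t * (Q t i).[T].
have xE i : xc w' i = be' i * x i + al' i * y i by case: (w'E i).
have yE i : yc w' i = de' i * x i + ga' i * y i by case: (w'E i).
pose M := mu.[T]; pose N := nu.[T]; pose S := s.[T]; pose S1 := s1.[T].
have SE : S = M + N * a by exact: sE.
have S1E : S1 = M + N * a1 by exact: s1E.
have H : S * r.[T] + N * p.[T] = 1.
  by have := congr1 (horner^~ T) spE; rewrite !(hornerD, horner_exp, hornerM, hornerC).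
pose A' i := sq S N (be i) (de i) (c i) (d i); pose E' i := sq S N (al i) (ga i) (c i) (d i).
transitivity (S1 * x i1 * y i1 + N * c i1 * x i1 ^+ 2 + N * d i1 * y i1 ^+ 2 +
    (S * x i2 * y i2 + A' i2 * x i2 ^+ 2 + E' i2 * y i2 ^+ 2) +
    (S * x i3 * y i3 + A' i3 * x i3 ^+ 2 + E' i3 * y i3 ^+ 2) + N * (x i2 * y i3)).
  rewrite -(cross_term two0 (x i2) (y i2) (x i3) (y i3) (unimod i2) (unimod i3)).
  have B2 : S * x i2 * y i2 + A' i2 * x i2 ^+ 2 + E' i2 * y i2 ^+ 2 =
      S * (xc w' i2 * yc w' i2) + N * (c i2 * xc w' i2 ^+ 2 + d i2 * yc w' i2 ^+ 2).
    by rewrite xE yE binary_form.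
  have B3 : S * x i3 * y i3 + A' i3 * x i3 ^+ 2 + E' i3 * y i3 ^+ 2 =
      S * (xc w' i3 * yc w' i3) + N * (c i3 * xc w' i3 ^+ 2 + d i3 * yc w' i3 ^+ 2).
    by rewrite xE yE binary_form.
  have x1 : xc w' i1 = x i1 by rewrite xE mul1r mul0r addr0.
  have y1 : yc w' i1 = y i1 by rewrite yE mul1r mul0r add0r.
  have := xE i2; have := xE i3; have := yE i2; have := yE i3; rewrite /tri /= => <- <- <- <-.
  rewrite B2 B3 -muE -nuE -/M -/N !sum3 x1 y1 SE S1E /tri /=; ring.
rewrite /dq !sum3.
have ev (R1 R2 R3 : 'I_3 -> {poly k}) (g : 'I_3 -> k) t :
    \sum_e g e * (mat3 R1 R2 R3 e t).[T] = g i1 * (R1 t).[T] + g i2 * (R2 t).[T] + g i3 * (R3 t).[T].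
  by rewrite sum3 !mxE.
have A'E i : (A i).[T] = A' i by rewrite /A /A' /sq !(hornerD, horner_exp, hornerM, hornerC).
have E'E i : (E i).[T] = E' i by rewrite /E /E' /sq !(hornerD, horner_exp, hornerM, hornerC).
rewrite /pev /n_b /u_b /v_b /x /y /P /Q !ev /tri /=.
rewrite !(A'E, E'E, hornerD, horner_exp, hornerM, hornerC, horner0) -/S -/S1 -/N.
have /= := bilinear_b two0 (xc w i2) (xc w i3) (yc w i2) (yc w i3) H.
move/eqP; rewrite -subr_eq0 => /eqP B0; apply: (eq_of_add0 two0); rewrite -[RHS]B0.
ring2 two0.
Qed.

Lemma PA_b :
  let b1 := be i3 * ga i2 in let b2 := al i2 * de i3 in
  let b3 := ga i2 * de i3 in let b4 := al i2 * be i3 in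
  let b0 := b1 * sqrt (c i3 * d i2) + b2 * sqrt (c i2 * d i3)
    + b3 * sqrt (d i2 * d i3) + b4 * sqrt (c i2 * c i3) in
  PA n_b u_b v_b (s1 * (nu ^+ 2 * b0%:P + s * nu * (al i2 * be i2 * c i2 + ga i2 * de i2 * d i2
    + al i3 * be i3 * c i3 + ga i3 * de i3 * d i3)%:P + s ^+ 2 * (be i2 * ga i2 + be i3 * ga i3)%:P)) =
  s ^+ 4 * nu ^+ 2 * (c i1 * d i1)%:P
  + s1 ^+ 2 * s ^+ 2 * nu ^+ 2 * (b1 * b2 + c i2 * d i2 + c i3 * d i3
      + b1 * sqrt (c i3 * d i2) + b2 * sqrt (c i2 * d i3)
      + b3 * sqrt (d i2 * d i3) + b4 * sqrt (c i2 * c i3))%:P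
  + s1 ^+ 2 * s * nu ^+ 3 * (b3 * (b1 * d i2 + b2 * d i3) + b4 * (b2 * c i2 + b1 * c i3))%:P.
Proof.
move=> b1 b2 b3 b4.
have U i : (al i)%:P * (de i)%:P + (be i)%:P * (ga i)%:P = 1 :> {poly k}.
  by rewrite -!polyCM -polyCD unimod.
have sqrtM (e f : k) : sqrt (e * f) = sqrt e * sqrt f.
  by apply/esym/sqrt_unique; rewrite // exprMn !sqr_sqrt.
rewrite !sqrtM /PA /PB prod3 sum3 (@prod_ord3_others _ _ i1 i2 i3) //.
rewrite (@prod_ord3_others _ _ i2 i1 i3) // (@prod_ord3_others _ _ i3 i1 i2) //.
rewrite /n_b /u_b /v_b /tri /= discriminant_b //.
have := arf_b two0P s s1 nu (sqrt (c i2))%:P (sqrt (c i3))%:P (sqrt (d i2))%:P (sqrt (d i3))%:P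
  (U i2) (U i3).
rewrite /= -!polyC_exp !sqr_sqrt /b1 /b2 /b3 /b4 !(polyCD, polyCM) => AE.
rewrite -[RHS]addrA -AE /A /E; ring.
Qed.

End CaseB.

Section CaseA.
Variables (sg : 'I_3 -> {poly k}) (b c d : 'I_3 -> k).
Hypothesis sgE : forall i T, (sg i).[T] = mu.[T] + nu.[T] * b i.

Lemma diagonalized_a : diagonalized qG (qQ b c d) j sg
  (fun i => nu * (c i)%:P) (fun i => nu * (d i)%:P).
Proof.
exists 1%:M, 1%:M; split=> [|T w]; first by rewrite mulmx1.
rewrite /mev map_mx1 mulmx1 meval_qQ meval_qG -muE -nuE !mulr_sumr -big_split.
by apply: eq_bigr => i _; rewrite /pev /= sgE !hornerM !hornerC; ring.
Qed.

Lemma PA_a : PA sg (fun i => nu * (c i)%:P) (fun i => nu * (d i)%:P) 0 =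
  nu ^+ 2 * ((c i1 * d i1)%:P * (sg i2 * sg i3) ^+ 2 + (c i2 * d i2)%:P * (sg i1 * sg i3) ^+ 2
   + (c i3 * d i3)%:P * (sg i1 * sg i2) ^+ 2).
Proof.
rewrite /PA mulr0 addr0 expr0n addr0 sum3 (@prod_ord3_others _ _ i1 i2 i3) //.
rewrite (@prod_ord3_others _ _ i2 i1 i3) // (@prod_ord3_others _ _ i3 i1 i2) //.
by rewrite !polyCM; ring.
Qed.

End CaseA.

End Cases.

(** * The linear factors in the two charts *)

Section Charts.
Variable k : closedFieldType.
Hypothesis char2 : 2%N \in [pchar k].
Let two0 : 2%:R = 0 :> k. Proof. exact: pcharf0. Qed.
Let two0P : 2%:R = 0 :> {poly k}.
Proof. by rewrite -[2%:R]polyC_natr two0. Qed.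

Lemma one_degenerateI (n : 'I_3 -> {poly k}) :
  (forall T i i', i != i' -> (n i).[T] = 0 -> (n i').[T] != 0) -> one_degenerate n.
Proof.
move=> nn T; case: (boolP [exists l, (n l).[T] == 0]) => [/existsP [l /eqP l0]|/existsPn nl].
  by exists l => i il; apply: nn l0; rewrite eq_sym.
by exists i1 => i _.
Qed.

(* The factor s_i of the two charts: t + a_i and, in terms of 1/t, 1 + a_i / t. *)
Definition lin (j : bool) (a : k) : {poly k} := if j then 'X + a%:P else 1 + 'X * a%:P.

Lemma lin_neq0 j a b T : a != b -> (lin j a).[T] = 0 -> (lin j b).[T] != 0.
Proof.
move=> ab aT; apply: contra_neq ab => bT; move: aT bT.
rewrite /lin; case: j; rewrite !hornerE /=.
  by move/eqP; rewrite addr_eq0 => /eqP -> /eqP; rewrite addrC subr_eq0 => /eqP.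
move=> aT bT; have /eqP : T * (a - b) = 0 by rewrite -[RHS](subrr (1 + T * a)) {2}aT -bT; ring.
rewrite mulf_eq0 subr_eq0 => /orP[/eqP T0|/eqP //].
by move: aT; rewrite T0 mul0r addr0 => /eqP; rewrite oner_eq0.
Qed.

Lemma lin_root a : root (lin true a) a.
Proof. by rewrite /root !hornerE -mulr2n -mulr_natr two0 mulr0. Qed.

Lemma lin_nonzero a : lin true a != 0.
Proof. by rewrite -size_poly_gt0 size_XaddC. Qed.

Lemma lin_rev a t : t != 0 -> (lin true a).[t] = t * (lin false a).[t^-1].
Proof. by move=> t0; rewrite !hornerE /=; field. Qed.

Definition chart_mu (j : bool) : {poly k} := if j then 'X else 1.
Definition chart_nu (j : bool) : {poly k} := if j then 1 else 'X.

Lemma chart_muE j T : (chart_mu j).[T] = lc j T 0.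
Proof. by rewrite /chart_mu /lc; case: j; rewrite ?hornerX ?hornerC. Qed.

Lemma chart_nuE j T : (chart_nu j).[T] = lc j T 1.
Proof. by rewrite /chart_nu /lc; case: j; rewrite ?hornerX ?hornerC. Qed.

Lemma linE j a T : (lin j a).[T] = (chart_mu j).[T] + (chart_nu j).[T] * a.
Proof. by rewrite /lin /chart_mu /chart_nu; case: j; rewrite !hornerE. Qed.

(** Bezout coefficients: in the chart of t, nu is 1; in the other, (1 + a T) + T a = 1 in
    characteristic 2. For squares the argument is a^2. *)
Definition coef_p (j : bool) (a : k) : {poly k} := if j then 1 else a%:P.
Definition coef_r (j : bool) : {poly k} := if j then 0 else 1.

Lemma coef_b j a : lin j a * coef_r j + chart_nu j * coef_p j a = 1.
Proof.
rewrite /lin /coef_r /chart_nu /coef_p; case: j; first by rewrite mulr0 add0r mulr1.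
by move: (a%:P) => y; ring2 two0P.
Qed.

Lemma coef_c j a : lin j a ^+ 2 * coef_r j + chart_nu j ^+ 2 * coef_p j (a ^+ 2) = 1.
Proof.
rewrite /lin /coef_r /chart_nu /coef_p; case: j; first by rewrite mulr0 add0r mulr1 expr1n.
by rewrite polyC_exp; move: (a%:P) => y; ring2 two0P.
Qed.

End Charts.

Theorem theorem1p3 (k : closedFieldType) (char2 : 2%N \in [pchar k]) :
  (forall a c d : 'I_3 -> k,
    a i1 != a i2 -> a i1 != a i3 -> a i2 != a i3 ->
    nonsingular_ci qG (qQ a c d) ->
    [/\ curve_nonsingular qG (qQ a c d),
        curve_genus qG (qQ a c d) 2 &
        curve_given_by qG (qQ a c d)
          (quadratic_eq
            (('X + (a i1)%:P) * ('X + (a i2)%:P) * ('X + (a i3)%:P))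
            ((c i1 * d i1)%:P * ('X + (a i2)%:P) ^+ 2 * ('X + (a i3)%:P) ^+ 2
             + (c i2 * d i2)%:P * ('X + (a i1)%:P) ^+ 2 * ('X + (a i3)%:P) ^+ 2
             + (c i3 * d i3)%:P * ('X + (a i1)%:P) ^+ 2
                 * ('X + (a i2)%:P) ^+ 2))])
  /\
  (forall (a c d alpha beta gamma delta : 'I_3 -> k) (b1 b2 b3 b4 : k),
    a i1 != a i2 -> a i2 = a i3 ->
    (forall i, alpha i * delta i + beta i * gamma i = 1) ->
    b1 = beta i3 * gamma i2 -> b2 = alpha i2 * delta i3 ->
    b3 = gamma i2 * delta i3 -> b4 = alpha i2 * beta i3 ->
    nonsingular_ci qG (qQ1 a c d b1 b2 b3 b4) ->
    [/\ curve_nonsingular qG (qQ1 a c d b1 b2 b3 b4),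
        curve_genus qG (qQ1 a c d b1 b2 b3 b4) 2 &
        curve_given_by qG (qQ1 a c d b1 b2 b3 b4)
          (quadratic_eq
            (('X + (a i1)%:P) * ('X + (a i2)%:P) ^+ 2)
            (('X + (a i2)%:P) ^+ 4 * (c i1 * d i1)%:P
             + ('X + (a i1)%:P) ^+ 2 * ('X + (a i2)%:P) ^+ 2
                 * (b1 * b2 + c i2 * d i2 + c i3 * d i3
                    + b1 * sqrt (c i3 * d i2) + b2 * sqrt (c i2 * d i3)
                    + b3 * sqrt (d i2 * d i3) + b4 * sqrt (c i2 * c i3))%:P
             + ('X + (a i1)%:P) ^+ 2 * ('X + (a i2)%:P)
                 * (b3 * (b1 * d i2 + b2 * d i3)
                    + b4 * (b2 * c i2 + b1 * c i3))%:P))])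
  /\
  (forall (a : k) (c d alpha beta gamma delta : 'I_3 -> k)
      (b1 b2 b3 b4 b5 b6 b7 b8 : k),
    (forall i, alpha i * delta i + beta i * gamma i = 1) ->
    b1 = beta i3 * gamma i2 -> b2 = alpha i2 * delta i3 ->
    b3 = gamma i2 * delta i3 -> b4 = alpha i2 * beta i3 ->
    b5 = beta i2 * gamma i1 -> b6 = alpha i1 * delta i2 ->
    b7 = gamma i1 * delta i2 -> b8 = alpha i1 * beta i2 ->
    nonsingular_ci qG (qQ0 (fun=> a) c d b1 b2 b3 b4 b5 b6 b7 b8) ->
    [/\ curve_nonsingular qG (qQ0 (fun=> a) c d b1 b2 b3 b4 b5 b6 b7 b8),
        curve_genus qG (qQ0 (fun=> a) c d b1 b2 b3 b4 b5 b6 b7 b8) 2 &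
        curve_given_by qG (qQ0 (fun=> a) c d b1 b2 b3 b4 b5 b6 b7 b8)
          (quadratic_eq
            (('X + a%:P) ^+ 3)
            (('X + a%:P) ^+ 4
               * (c i1 * d i1 + c i2 * d i2 + c i3 * d i3
                  + b1 * b2 + b5 * b6)%:P
             + ('X + a%:P) ^+ 3
               * (b6 * b8 * c i1 + (b2 * b4 + b5 * b8) * c i2 + b1 * b4 * c i3
                  + b5 * b7 * d i1 + (b1 * b3 + b6 * b7) * d i2
                  + b2 * b3 * d i3)%:P
             + ('X + a%:P) ^+ 2
               * (b8 ^+ 2 * c i1 * c i2 + b6 ^+ 2 * c i1 * d i2
                  + b5 ^+ 2 * c i2 * d i1 + b7 ^+ 2 * d i1 * d i2
                  + b4 ^+ 2 * c i2 * c i3 + b2 ^+ 2 * c i2 * d i3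
                  + b1 ^+ 2 * c i3 * d i2 + b3 ^+ 2 * d i2 * d i3
                  + b1 * b3 * b5 * b8 + b2 * b4 * b6 * b7)%:P
             + ('X + a%:P)
               * ((b1 * b3 * b8 ^+ 2 + b2 * b4 * b6 ^+ 2) * c i1
                  + (b1 * b3 * b5 ^+ 2 + b2 * b4 * b7 ^+ 2) * d i1
                  + (b1 ^+ 2 * b5 * b8 + b4 ^+ 2 * b6 * b7) * c i3
                  + (b3 ^+ 2 * b5 * b8 + b2 ^+ 2 * b6 * b7) * d i3)%:P
             + ((b1 * b8 + b4 * b6) ^+ 2 * c i1 * c i3
                + (b2 * b6 + b3 * b8) ^+ 2 * c i1 * d i3
                + (b1 * b5 + b4 * b7) ^+ 2 * c i3 * d i1
                + (b2 * b7 + b3 * b5) ^+ 2 * d i1 * d i3)%:P))]).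
Proof.
split; last split.
- move=> a c d a12 a13 a23 NS.
  pose sg j i := lin j (a i).
  have sgE j i T : (sg j i).[T] = (chart_mu k j).[T] + (chart_nu k j).[T] * a i by exact: linE.
  have D j := diagonalized_a (@chart_muE k j) (@chart_nuE k j) c d (sgE j).
  have nT j : one_degenerate (sg j).
    apply: one_degenerateI => T i i' ii'; apply: lin_neq0.
    by elim/ord3P: i ii'; elim/ord3P: i' => //= _; rewrite // eq_sym.
  have BE j : PB (sg j) = sg j i1 * sg j i2 * sg j i3 by exact: prod3.
  have AE j := PA_a (chart_nu k j) (sg j) c d.
  have L t i : t != 0 -> (sg true i).[t] = t * (sg false i).[t^-1] by exact: lin_rev.
  (* The zero a_1 of B serves as the base point for the integrality of the curve. *)
  have [||||S g given] := diagonalized_curve (T0 := a i1) char2 NS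
      (D true) (nT true) (BE true) (AE true) (D false) (nT false) (BE false) (AE false).
  * by rewrite !mulf_neq0 // lin_nonzero.
  * by rewrite !rootM lin_root.
  * by move=> t t0; rewrite !hornerM !L //; ring.
  * move=> t t0; move: (L t ^~ t0); move: (sg true) (sg false) => f f' {}L.
    by rewrite !(hornerM, hornerD, horner_exp) !L !hornerC hornerX; field.
  split=> //; move: given; rewrite /sg /=; congr (curve_given_by _ _ (quadratic_eq _ _)).
  by rewrite expr1n mul1r /lin; ring.
- move=> a c d alpha beta gamma delta b1 b2 b3 b4 a12 a23 U -> -> -> -> NS.
  have aE : a = tri (a i1) (a i2) (a i2) by apply/funext; apply: ord3P.
  pose L1 j := lin j (a i1); pose L j := lin j (a i2).
  have L1E j T : (L1 j).[T] = (chart_mu k j).[T] + (chart_nu k j).[T] * a i1 by exact: linE.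
  have LE j T : (L j).[T] = (chart_mu k j).[T] + (chart_nu k j).[T] * a i2 by exact: linE.
  have pE j : L j * coef_r k j + chart_nu k j * coef_p j (a i2) = 1 by exact: coef_b.
  have D j := diagonalized_b char2 (@chart_muE k j) (@chart_nuE k j) c d U (L1E j) (LE j) (pE j).
  rewrite -aE in D.
  have nT j : one_degenerate (n_b (L j) (L1 j)).
    apply: one_degenerateI => T i i'; rewrite /n_b /tri.
    elim/ord3P: i; elim/ord3P: i' => //= _; rewrite ?hornerC ?oner_neq0 // ?horner_exp.
    - by move=> n0; rewrite expf_neq0 //; apply: lin_neq0 a12 n0.
    - by move/eqP; rewrite oner_eq0.
    - by move/eqP; rewrite oner_eq0.
    - by move/eqP; rewrite expf_eq0 => /eqP; apply: lin_neq0; rewrite eq_sym.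
  have BE j : PB (n_b (L j) (L1 j)) = L1 j * L j ^+ 2 by rewrite /PB prod3 mulr1.
  have AE j := PA_b char2 (L1 j) c d U (pE j).
  have LR t : t != 0 -> (L true).[t] = t * (L false).[t^-1] by exact: lin_rev.
  have L1R t : t != 0 -> (L1 true).[t] = t * (L1 false).[t^-1] by exact: lin_rev.
  have [||||S g given] := diagonalized_curve (T0 := a i1) char2 NS
      (D true) (nT true) (BE true) (AE true) (D false) (nT false) (BE false) (AE false).
  * by rewrite mulf_neq0 ?expf_neq0 // lin_nonzero.
  * by rewrite rootM lin_root.
  * by move=> t t0; rewrite !(horner_exp, hornerM) LR // L1R //; ring.
  * move=> t t0; move: (LR t t0) (L1R t t0).
    move: (L true) (L false) (L1 true) (L1 false) => f f' f1 f1' {}LR {}L1R.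
    by rewrite !(hornerM, hornerD, horner_exp) LR L1R !hornerC hornerX; field.
  split=> //; move: given; congr (curve_given_by _ _ (quadratic_eq _ _)).
  by rewrite !expr1n !mulr1.
- move=> a c d alpha beta gamma delta b1 b2 b3 b4 b5 b6 b7 b8 U -> -> -> -> -> -> -> -> NS.
  pose L j := lin j a; pose p j := coef_p j (a ^+ 2).
  have LE j T : (L j).[T] = (chart_mu k j).[T] + (chart_nu k j).[T] * a by exact: linE.
  have pE j : L j ^+ 2 * coef_r k j + chart_nu k j ^+ 2 * p j = 1 by exact: coef_c.
  have D j := diagonalized_c char2 (@chart_muE k j) (@chart_nuE k j) c d U (LE j) (pE j).
  have nT j : one_degenerate (n_c (L j)).
    apply: one_degenerateI => T i i'; rewrite /n_c /tri.
    elim/ord3P: i; elim/ord3P: i' => //= _; rewrite ?hornerC ?oner_neq0 //;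
      by move/eqP; rewrite oner_eq0.
  have BE j : PB (n_c (L j)) = L j ^+ 3 by rewrite /PB prod3 !mul1r.
  have AE j := PA_c char2 c d U (pE j).
  have LR t : t != 0 -> (L true).[t] = t * (L false).[t^-1] by exact: lin_rev.
  have [||||S g given] := diagonalized_curve (T0 := a) char2 NS
      (D true) (nT true) (BE true) (AE true) (D false) (nT false) (BE false) (AE false).
  * by rewrite expf_neq0 // lin_nonzero.
  * by rewrite /root horner_exp expf_eq0 /=; apply: lin_root.
  * by move=> t t0; rewrite !horner_exp LR //; ring.
  * move=> t t0; move: (LR t t0); move: (L true) (L false) => f f' {}LR.
    rewrite !(horner_exp, hornerM, hornerC, hornerX, hornerD) LR.
    by field.
  split=> //; move: given; congr (curve_given_by _ _ (quadratic_eq _ _)).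
  by rewrite !expr1n !mulr1 mul1r.
Qed.
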